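(* Let $w_1,w_2\in\mathrm{ACol}(C_n)^*$. Then $w_1\equiv_\epsilon w_2$ (extended crystal congruence) if and only if $w_1$ and $w_2$ have the same image in $Pl^{\mathbb N}(C_n)$. In other words, $\mathrm{ACol}(C_n)^*/\!\equiv_\epsilon\;=Pl^{\mathbb N}(C_n)$.
   Context: Setting: $C_n=\{1<\cdots<n<\overline n<\cdots<\overline1\}$ with crystal graph $1\xrightarrow{1}2\xrightarrow{2}\cdots\xrightarrow{n-1}n\xrightarrow{n}\overline n\xrightarrow{n-1}\cdots\xrightarrow{1}\overline1$; Kashiwara operators $e_i,f_i$ ($1\le i\le n$) act on $C_n^*$ by the usual tensor product rule ($f_i(uv)=(f_iu)v$ if $\varphi_i(u)>\varepsilon_i(v)$, else $u(f_iv)$; $e_i(uv)=(e_iu)v$ if $\varphi_i(u)\ge\varepsilon_i(v)$, else $u(e_iv)$). Columns, admissible columns, $\preceq$, tableau words, $Pl(C_n)$ and column insertion are the standard type $C$ notions (Lecouvey). $\mathrm{ACol}(C_n)$ is the set of admissible columns together with an extra symbol $\epsilon$; $p:\mathrm{ACol}(C_n)^*\to C_n^*$ is the monoid morphism sending $\epsilon$ to the empty word and each admissible column to itself (as a word). $\preceq$ is extended by $c\preceq\epsilon$ for all $c$ and $\epsilon\not\preceq c$ for $c\ne\epsilon$; $(c_1\leftarrow c_2)\in\mathrm{ACol}(C_n)^2$ is $d_1d_2$, $\epsilon d$, or $\epsilon\epsilon$ according as the tableau word of $p(c_1)p(c_2)$ is $d_1d_2$, one column $d$, or empty. $Pl^{\mathbb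 N}(C_n)$ is $\mathrm{ACol}(C_n)^*$ modulo the congruence generated by $c_1c_2=(c_1\leftarrow c_2)$ for $c_2\not\preceq c_1$. Crystal structure on $\mathrm{ACol}(C_n)^*$: for $w\in\mathrm{ACol}(C_n)^*$, $f_iw$ (resp. $e_iw$) is defined iff $f_ip(w)$ (resp. $e_ip(w)$) is defined, and then it is obtained from $w$ by replacing the column containing the letter modified by $f_i$ (resp. $e_i$) in $p(w)$ by the modified column (which is again admissible), all other letters of $w$, including the $\epsilon$'s, being unchanged. $B(w)$ is the connected component of $w$ in the labelled graph on $\mathrm{ACol}(C_n)^*$ with edges $w\xrightarrow{i}f_iw$. The extended crystal congruence $\equiv_\epsilon$ is the congruence on $\mathrm{ACol}(C_n)^*$ generated by: $w_1\sim_\epsilon w_2$ if $w_1,w_2$ have the same length (number of letters of $\mathrm{ACol}(C_n)$) and there is a label-preserving graph isomorphism $B(w_1)\to B(w_2)$ sending $w_1$ to $w_2$. *)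

(* Defs.v *)
From mathcomp Require Import all_boot.

Set Implicit Arguments.
Unset Strict Implicit.
Unset Printing Implicit Defensive.

Inductive rst_clos {T : Type} (R : T -> T -> Prop) : T -> T -> Prop :=
| rst_step x y : R x y -> rst_clos R x y
| rst_refl x : rst_clos R x x
| rst_sym x y : rst_clos R x y -> rst_clos R y x
| rst_trans x y z : rst_clos R x y -> rst_clos R y z -> rst_clos R x z.

Inductive cong_gen {T : Type} (R : seq T -> seq T -> Prop) :
  seq T -> seq T -> Prop :=
| cg_step u v : R u v -> cong_gen R u v
| cg_refl u : cong_gen R u u
| cg_sym u v : cong_gen R u v -> cong_gen R v u
| cg_trans u v w : cong_gen R u v -> cong_gen R v w -> cong_gen R u w
| cg_ctx x y u v : cong_gen R u v -> cong_gen R (x ++ u ++ y) (x ++ v ++ y).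

(* labelled graphs given by E i a b  ("a --i--> b") *)
Definition component {T : Type} (E : nat -> T -> T -> Prop) (x u : T) : Prop :=
  rst_clos (fun a b => exists i, E i a b) x u.

Definition comp_iso {T : Type} (E : nat -> T -> T -> Prop) (x y : T) : Prop :=
  exists phi psi : T -> T,
    [/\ phi x = y,
        (forall u, component E x u -> component E y (phi u) /\ psi (phi u) = u),
        (forall v, component E y v -> component E x (psi v) /\ phi (psi v) = v)
      & (forall i u v, component E x u -> component E x v ->
           (E i u v <-> E i (phi u) (phi v)))].

Section TypeC.
Variable n : nat.

(* The alphabet C_n = {1 < ... < n < bar n < ... < bar 1}             *)
(* (j, false) is the letter j+1 ; (j, true) is the letter bar (j+1)   *)
Definition letter := ('I_n * bool)%type.

Definition lval (x : letter) : nat := (nat_of_ord x.1).+1.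

(* position in the total order 1 < ... < n < bar n < ... < bar 1 (0-based) *)
Definition rank (x : letter) : nat :=
  if x.2 then (2 * n).-1 - x.1 else nat_of_ord x.1.

Definition ltl (x y : letter) : bool := rank x < rank y.

(* the crystal graph of C_n:
   z --z--> z+1, bar(z+1) --z--> bar z  (1 <= z < n),  n --n--> bar n *)
Definition arrow (i : nat) (x y : letter) : bool :=
  [|| [&& 0 < i, i < n, ~~ x.2, ~~ y.2, lval x == i & lval y == i.+1],
      [&& 0 < i, i < n, x.2, y.2, lval x == i.+1 & lval y == i]
    | [&& 0 < i, i == n, ~~ x.2, y.2, lval x == n & lval y == n]].

Definition f_letter (i : nat) (x : letter) : option letter := [pick y | arrow i x y].
Definition phi_l (i : nat) (x : letter) : nat := [exists y, arrow i x y].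
Definition eps_l (i : nat) (y : letter) : nat := [exists x, arrow i x y].

Definition word := seq letter.

(* tensor product rule on C_n^*, decomposing a word as (first letter) (rest):
   eps_i(uv) = eps_i(u) + max(0, eps_i(v) - phi_i(u)) ;
   f_i(uv) = (f_i u) v if phi_i(u) > eps_i(v), else u (f_i v). *)
Fixpoint eps_w (i : nat) (w : word) : nat :=
  if w is a :: v then eps_l i a + (eps_w i v - phi_l i a) else 0.

Fixpoint f_w (i : nat) (w : word) : option word :=
  if w is a :: v then
    if eps_w i v < phi_l i a then omap (fun b => b :: v) (f_letter i a)
    else omap (cons a) (f_w i v)
  else None.

Definition edgeW (i : nat) (u v : word) : Prop := (0 < i <= n) /\ f_w i u = Some v.

Definition crystal_rel (u v : word) : Prop := comp_iso edgeW u v.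
Definition plac_equiv (u v : word) : Prop := cong_gen crystal_rel u v.

(* a column: nonempty word strictly increasing (read top to bottom) *)
Definition is_column (c : word) : bool := (0 < size c) && sorted ltl c.

Definition mem_unb (c : word) (z : nat) : bool := has (fun x => ~~ x.2 && (lval x == z)) c.
Definition mem_bar (c : word) (z : nat) : bool := has (fun x => x.2 && (lval x == z)) c.

Definition pair_letters (c : word) : seq nat :=
  [seq z <- rev (iota 1 n) | mem_unb c z && mem_bar c z].

Definition free_letter (c : word) (t : nat) : bool := ~~ mem_unb c t && ~~ mem_bar c t.

(* J = {t1 > ... > tr}: t1 greatest letter < z1 with t1, bar t1 not in c;
   t_i greatest letter < min(t_{i-1}, z_i) with t_i, bar t_i not in c.
   None if some t_i does not exist (c cannot be split). *)
Fixpoint split_ts (c : word) (zs : seq nat) (b : nat) : option (seq nat) :=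
  if zs is z :: zs' then
    let cands := [seq t <- iota 1 (minn b z).-1 | free_letter c t] in
    if cands is [::] then None
    else let t := last 0 cands in omap (cons t) (split_ts c zs' t)
  else Some [::].

Definition t_letters (c : word) : option (seq nat) := split_ts c (pair_letters c) n.+1.

Definition admissible (c : word) : bool := is_column c && (t_letters c != None).

(* lC: change z_i into t_i and reorder; rC: change bar z_i into bar t_i and
   reorder.  Columns of the split are recorded through the ranks of their
   letters (top to bottom), which is all that \preceq uses. *)
Definition lrank (c : word) (x : letter) : nat :=
  let zs := pair_letters c in let ts := odflt [::] (t_letters c) in
  if ~~ x.2 && (lval x \in zs) then (nth 0 ts (index (lval x) zs)).-1 else rank x.

Definition rrank (c : word) (x : letter) : nat :=
  let zs := pair_letters c in let ts := odflt [::] (t_letters c) in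
  if x.2 && (lval x \in zs) then 2 * n - nth 0 ts (index (lval x) zs) else rank x.

Definition lcol (c : word) : seq nat := sort leq (map (lrank c) c).
Definition rcol (c : word) : seq nat := sort leq (map (rrank c) c).

Definition colle (c1 c2 : word) : bool :=
  (size c2 <= size c1) &&
  all (fun k => nth 0 (rcol c1) k <= nth 0 (lcol c2) k) (iota 0 (size c2)).

(* ACol(C_n) = admissible columns + epsilon (None)                    *)
Definition admcol := {c : word | admissible c}.
Definition ACol := option admcol.

Definition pcol (a : ACol) : word := if a is Some c then val c else [::].
Definition p (w : seq ACol) : word := flatten (map pcol w).

Definition leA (c d : ACol) : bool :=
  match c, d with
  | _, None => true
  | None, Some _ => false
  | Some c', Some d' => colle (val c') (val d')
  end.

(* (c1 <- c2) = d1 d2 : the tableau word of p(c1)p(c2) is d1 d2 (resp. one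
   column d, resp. empty).  A two-column tableau word is d1 d2 with d2 \preceq d1
   (columns read right to left); "the tableau word of w" is the (unique)
   tableau word in the Pl(C_n)-class of w. *)
Definition insert_rel (c1 c2 d1 d2 : ACol) : Prop :=
  match d1, d2 with
  | Some a, Some b => colle (val b) (val a) /\ plac_equiv (pcol c1 ++ pcol c2) (val a ++ val b)
  | None, Some b => plac_equiv (pcol c1 ++ pcol c2) (val b)
  | None, None => plac_equiv (pcol c1 ++ pcol c2) [::]
  | Some _, None => False
  end.

Definition plN_rel (w w' : seq ACol) : Prop :=
  exists c1 c2 d1 d2, [/\ w = [:: c1; c2], w' = [:: d1; d2], ~~ leA c2 c1
                        & insert_rel c1 c2 d1 d2].

Definition plN_equiv (w1 w2 : seq ACol) : Prop := cong_gen plN_rel w1 w2.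

(* crystal structure on ACol(C_n)^*: w --i--> w' iff f_i p(w) = p(w') and w'
   has the same column structure as w (epsilons at the same places, each
   column replaced by a column of the same height), i.e. w' is w with the
   column containing the modified letter replaced by the modified column. *)
Definition edgeA (i : nat) (w w' : seq ACol) : Prop :=
  edgeW i (p w) (p w') /\ map (fun a => size (pcol a)) w' = map (fun a => size (pcol a)) w.

Definition ext_rel (w1 w2 : seq ACol) : Prop :=
  size w1 = size w2 /\ comp_iso edgeA w1 w2.

Definition ext_equiv (w1 w2 : seq ACol) : Prop := cong_gen ext_rel w1 w2.

End TypeC.

(* Main.v *)
(* Letters are encoded by their position in the order 1 < ... < n < bar n < ...
   < bar 1, so that every f_i adds 1 to a letter and e_i subtracts 1.

   A column is controlled by U(k) and B(k), the numbers of its letters in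
   {1, ..., k} and in {bar k, ..., bar 1}: it is admissible iff
   U(m) + B(m) <= m for all m <= n, and the relation c1 \preceq c2 on splits
   becomes a family of linear inequalities between these functions (solve the
   greedy choice of the t_i as a queue). An edge changes U and B at a single
   index, so both conditions are stable under crystal operators by a local
   check.

   Every highest weight word is crystal equivalent to a product of columns
   1 2 ... h: this follows from two explicit isomorphisms, the type C Knuth
   relations on three letters and the contraction of 1 2 ... k bar k to
   1 2 ... k-1. Applied to a product of two admissible columns, and propagated
   along the component, it yields c1 <- c2 and shows that rewriting terminates.
   Conversely the columns of a highest weight tableau are all of the form
   1 2 ... h, with heights counted by the phi_i, so that crystal equivalent
   normal forms of the same length are equal. *)

Require Import Defs.
From mathcomp Require Import all_boot.
From mathcomp Require Import zify.
From Stdlib Require Import ClassicalEpsilon.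

Set Implicit Arguments.
Unset Strict Implicit.
Unset Printing Implicit Defensive.

(** * Words of positions *)

(** The obstacle is that splitting is a global greedy procedure, so its behaviour under a crystal
    operator cannot be read off locally. Put D(k) = U(k) + B(k) - k for one column and, for a
    product of columns [a1] and [a2], let P(k) add U(k) of [a2] to B(k) of [a1] and subtract k.
    Admissibility is then an upper bound on D, and the comparison of the two columns is a family
    D(m) <= P(k) + const for k <= m, with D taken for either column. An edge labelled i < n alters
    these sequences at the index i only, and whichever of the two values there is extreme (the
    larger for D, the smaller for P) equals a neighbouring value, so that the bounds survive.
    Properties are therefore checked on highest weight words and carried back along edges; e_i
    lowers the sum of the positions, so a highest weight word is always reached. The symbol epsilon
    is treated as the empty column. The crystal does not see it, and the number of epsilons in a
    normal form is recovered from the number of letters of the word, which both congruences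
    preserve. *)

Section CodeWords.
Variable n : nat.

(** Positions run from 1 to 2n, with the letter i at i and its bar at 2n+1-i. The arrows labelled i
    start at i and at 2n-i, the bar of i+1; the two coincide for i = n. *)
Definition phl (i a : nat) : bool :=
  (0 < i <= n) && ((a == i) || (a == 2 * n - i)).
Definition epl (i a : nat) : bool :=
  (0 < i <= n) && ((a == i.+1) || (a == (2 * n).+1 - i)).

Fixpoint eps (i : nat) (w : seq nat) : nat :=
  if w is a :: v then epl i a + (eps i v - phl i a) else 0.
Fixpoint phi (i : nat) (w : seq nat) : nat :=
  if w is a :: v then phi i v + (phl i a - eps i v) else 0.
Fixpoint fop (i : nat) (w : seq nat) : seq nat :=
  if w is a :: v then
    if eps i v < phl i a then a.+1 :: v else a :: fop i v
  else [::].
(** While [fop] returns a word with [phi] equal to 0 unchanged, [eop] replaces the first letter of a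
    nonempty word with [eps] equal to 0 by its predecessor. It represents e_i only under
    [0 < eps i w]. *)
Fixpoint eop (i : nat) (w : seq nat) : seq nat :=
  if w is a :: v then
    if eps i v <= phl i a then a.-1 :: v else a :: eop i v
  else [::].

Lemma phlP i a : phl i a -> [/\ 0 < i, i <= n & a = i \/ a = 2 * n - i].
Proof. by rewrite /phl => h; split; lia. Qed.

Lemma phl_epl i a : phl i a -> epl i a = false.
Proof. by move=> /phlP[h1 h2 h3]; apply/negbTE; rewrite /epl; lia. Qed.

Lemma phl_eplS i a : phl i a = epl i a.+1.
Proof. by rewrite /phl /epl; lia. Qed.

Lemma epl_pos i a : epl i a -> 0 < a.
Proof. by rewrite /epl; lia. Qed.

Lemma epl_phl i a : epl i a -> phl i a = false.
Proof. by move=> h; apply: contraTF h => /phl_epl ->. Qed.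

Lemma eps_cat i u v : eps i (u ++ v) = eps i u + (eps i v - phi i u).
Proof. by elim: u => [|a u IH] /=; [lia|rewrite IH; lia]. Qed.

Lemma phi_cat i u v : phi i (u ++ v) = phi i v + (phi i u - eps i v).
Proof. by elim: u => [|a u IH] /=; [lia|rewrite eps_cat IH; lia]. Qed.

(* After cancelling [phi]-letters against later [eps]-letters, [f_i] acts on the
   leftmost letter left over; the same splitting describes [e_i] on the target. *)
Definition step (i : nat) (a b : seq nat) : Prop :=
  exists u x v, [/\ a = u ++ x :: v, b = u ++ x.+1 :: v, phl i x,
                    phi i u = 0 & eps i v = 0].

Lemma step_fop i a : 0 < phi i a -> step i a (fop i a).
Proof.
elim: a => //= x v IH hp; case: ifP => [lt|nlt].
  exists [::], x, v; split=> //; case: (phl i x) lt => //=; lia.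
have [|u [y [v' [e1 -> hy hu hv]]]] := IH; first lia.
exists (x :: u), y, v'; split=> //=; first by rewrite e1.
by move: nlt hp; rewrite e1 phi_cat eps_cat /= hu hv phl_epl // hy; lia.
Qed.

Lemma step_eop i b : 0 < eps i b -> step i (eop i b) b.
Proof.
elim: b => //= x v IH hp; case: ifP => [lt|nlt].
  have hx : epl i x by move: hp lt; case: (epl i x) => //=; lia.
  have x0 := epl_pos hx.
  exists [::], x.-1, v; rewrite prednK //; split=> //.
  - by rewrite phl_eplS prednK.
  - by move: lt; rewrite epl_phl //; lia.
have [|u [y [v' [-> e2 hy hu hv]]]] := IH; first lia.
exists (x :: u), y, v'; split=> //=; first by rewrite e2.
move: nlt; rewrite e2 eps_cat /= hu hv -phl_eplS hy; lia.
Qed.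

(** Each endpoint of an edge is computed from the other, so statements about edges reduce to
    statements about [fop] and [eop]. *)
Lemma step_inv i a b : step i a b ->
  [/\ 0 < phi i a, b = fop i a, 0 < eps i b & a = eop i b].
Proof.
move=> [u [x [v [-> -> hx hu hv]]]].
have hx' : epl i x.+1 by rewrite -phl_eplS.
elim: u hu => [_|y u IH] /=.
  by rewrite hv hx hx' (epl_phl hx') /=; split=> //; lia.
move=> h; have [|h1 h2 h3 h4] := IH; first lia.
rewrite !eps_cat !phi_cat /= -h2 -h4 hv hx hx' (phl_epl hx) (epl_phl hx') /= in h1 h3 *.
by split=> //; try (case: ifP => //); lia.
Qed.

Lemma step_weight i a b : step i a b ->
  eps i b = (eps i a).+1 /\ phi i a = (phi i b).+1.
Proof.
move=> [u [x [v [-> -> hx hu hv]]]].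
have hx' : epl i x.+1 by rewrite -phl_eplS.
by rewrite !eps_cat !phi_cat /= hu hv hx hx' (phl_epl hx) (epl_phl hx') /=; lia.
Qed.

End CodeWords.

(** * Isomorphisms of connected components *)

Section Graphs.

Definition functional_rel {T T' : Type} (R : T -> T' -> Prop) : Prop :=
  forall a b b', R a b -> R a b' -> b = b'.

Definition flip_rel {T T' : Type} (R : T -> T' -> Prop) b a := R a b.

Definition simulation {T : Type} (E : nat -> T -> T -> Prop)
    (R : T -> T -> Prop) : Prop :=
  (forall i a b a', R a b -> E i a a' -> exists2 b', E i b b' & R a' b') /\
  (forall i a b a', R a b -> E i a' a -> exists2 b', E i b' b & R a' b').

Definition graph_iso {T : Type} (E : nat -> T -> T -> Prop)
    (R : T -> T -> Prop) : Prop :=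
  [/\ simulation E R, simulation E (flip_rel R), functional_rel R
    & functional_rel (flip_rel R)].

Lemma graph_iso_flip T (E : nat -> T -> T -> Prop) R :
  graph_iso E R -> graph_iso E (flip_rel R).
Proof. by case. Qed.

Lemma simulation_component T (E : nat -> T -> T -> Prop) R x y :
  simulation E R -> R x y ->
  forall u, component E x u -> exists2 v, component E y v & R u v.
Proof.
move=> [fw bw] Rxy u cxu.
(* A path may use an edge backwards, so the transfer is proved from either end at once; the symmetry
   case is then immediate. *)
suff H : forall a b, rst_clos (fun a b => exists i, E i a b) a b ->
    (forall c, R a c -> exists2 d, component E c d & R b d) /\
    (forall c, R b c -> exists2 d, component E c d & R a d).
  by have [H1 _] := H _ _ cxu; apply: H1.
move=> a b; elim=> {a b} [a b [i Eab]|a|a b _ [H1 H2]|a b c _ [H1 H2] _ [H3 H4]].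
- split=> c Rc.
    have [d Ed Rd] := fw _ _ _ _ Rc Eab.
    by exists d => //; apply: rst_step; exists i.
  have [d Ed Rd] := bw _ _ _ _ Rc Eab.
  by exists d => //; apply: rst_sym; apply: rst_step; exists i.
- by split=> c Rc; exists c => //; apply: rst_refl.
- by split.
- split=> d Rd.
    have [e c1 R1] := H1 _ Rd; have [f c2 R2] := H3 _ R1.
    by exists f => //; apply: rst_trans c1 c2.
  have [e c1 R1] := H4 _ Rd; have [f c2 R2] := H2 _ R1.
  by exists f => //; apply: rst_trans c1 c2.
Qed.

(** A relation need not be total and may extend beyond the component of [x], so isomorphisms can be
    given by explicit local rules. In return the two maps are chosen from the relation by [epsilon];
    functionality in both directions makes the choices mutually inverse. *)
Lemma comp_isoP T (E : nat -> T -> T -> Prop) x y :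
  comp_iso E x y <-> exists2 R, graph_iso E R & R x y.
Proof.
split=> [[f [g [fx Hf Hg HE]]]|[R [sR sR' fR fR'] Rxy]].
  have fwd a : component E x a -> forall i a', E i a a' -> component E x a'.
    by move=> c i a' Ea; apply: rst_trans c _; apply: rst_step; exists i.
  have bwd a : component E x a -> forall i a', E i a' a -> component E x a'.
    move=> c i a' Ea; apply: rst_trans c _; apply: rst_sym.
    by apply: rst_step; exists i.
  have fwd' b : component E y b -> forall i b', E i b b' -> component E y b'.
    by move=> c i a' Ea; apply: rst_trans c _; apply: rst_step; exists i.
  have bwd' b : component E y b -> forall i b', E i b' b -> component E y b'.
    move=> c i a' Ea; apply: rst_trans c _; apply: rst_sym.
    by apply: rst_step; exists i.
  exists (fun a b => component E x a /\ b = f a); last first.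
    by split=> //; apply: rst_refl.
  split.
  - split=> i a b a' [ca ->] Ea.
      have ca' := fwd _ ca _ _ Ea.
      by exists (f a') => //; apply: (HE _ _ _ _ _).1 => //.
    have ca' := bwd _ ca _ _ Ea.
    by exists (f a') => //; apply: (HE _ _ _ _ _).1 => //.
  - split=> i b a b' [ca eb]; rewrite {}eb => Eb; have [cb _] := Hf _ ca.
      have cb' := fwd' _ cb _ _ Eb; have [cg fg] := Hg _ cb'.
      by exists (g b') => //; apply/HE => //; rewrite fg.
    have cb' := bwd' _ cb _ _ Eb; have [cg fg] := Hg _ cb'.
    by exists (g b') => //; apply/HE => //; rewrite fg.
  - by move=> a b b' [_ ->] [_ ->].
  - move=> b a a' [ca eb] [ca' eb'].
  by rewrite -(Hf _ ca).2 -(Hf _ ca').2 -eb -eb'.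
pose f a := epsilon (inhabits y) (R a).
pose g b := epsilon (inhabits x) (fun a => R a b).
have fP a b : R a b -> f a = b.
  move=> Rab; apply: (fR a) => //.
  by apply: (epsilon_spec (inhabits y) (R a)); exists b.
have gP a b : R a b -> g b = a.
  move=> Rab; apply: (fR' b) => //.
  by apply: (epsilon_spec (inhabits x) (fun a => R a b)); exists a.
have cR u : component E x u -> exists2 v, component E y v & R u v.
  exact: simulation_component.
have cR' v : component E y v -> exists2 u, component E x u & R u v.
  by move=> cv; have [u cu Ru] := simulation_component sR' (Rxy : flip_rel R y x) cv; exists u.
exists f, g; split=> [|u cu|v cv|i u v cu cv]; first exact: fP.
- by have [v cv Ruv] := cR u cu; rewrite (fP _ _ Ruv) (gP _ _ Ruv).
- by have [u cu Ruv] := cR' v cv; rewrite (gP _ _ Ruv) (fP _ _ Ruv).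
have [u' _ Ru] := cR u cu; have [v' _ Rv] := cR v cv.
rewrite (fP _ _ Ru) (fP _ _ Rv); split=> Eu.
  have [b Eb Rb] := sR.1 _ _ _ _ Ru Eu.
  by rewrite (fR _ _ _ Rv Rb).
have [b Eb Rb] := sR'.1 _ _ _ _ (Ru : flip_rel R u' u) Eu.
by rewrite (fR' _ _ _ Rv Rb).
Qed.

(** Edges preserve the shape [sh] and [g] is injective at a given shape, so a component upstairs is
    a copy of its image carrying the shape of its base point. It serves twice: with a trivial shape
    to pass from letters to positions, and with the column heights as shape to pass from words of
    columns to words. *)
Lemma comp_iso_transport (T T' S : Type) (E : nat -> T -> T -> Prop)
    (E' : nat -> T' -> T' -> Prop) (g : T -> T') (sh : T -> S) x y :
  (forall i a b, E i a b <-> E' i (g a) (g b) /\ sh b = sh a) ->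
  (forall a b, sh a = sh b -> g a = g b -> a = b) ->
  (forall i a b', E' i (g a) b' -> exists2 b, b' = g b & sh b = sh a) ->
  (forall i a b', E' i b' (g a) -> exists2 b, b' = g b & sh b = sh a) ->
  comp_iso E x y <-> comp_iso E' (g x) (g y).
Proof.
move=> EE inj lf lb.
have lf' i a b' : E' i (g a) b' -> exists b, [/\ b' = g b, sh b = sh a & E i a b].
  move=> h; have [b e1 e2] := lf _ _ _ h; exists b; split=> //.
  by apply/EE; rewrite -e1.
have lb' i a b' : E' i b' (g a) -> exists b, [/\ b' = g b, sh b = sh a & E i b a].
  move=> h; have [b e1 e2] := lb _ _ _ h; exists b; split=> //.
  by apply/EE; rewrite -e1.
split=> /comp_isoP[R [[s1 s2] [s3 s4] fR fR'] Rxy]; apply/comp_isoP.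
  (* Fixing the shapes to those of [x] and [y] makes the preimages unique, hence the relation
     functional both ways. *)
  exists (fun a' b' => exists a b, [/\ a' = g a, b' = g b, sh a = sh x,
                                     sh b = sh y & R a b]); last by exists x, y.
  split.
  - split=> i a b a' [a1 [b1 [-> -> ha hb Rab]]] Ea.
      have [c [-> hc Ec]] := lf' _ _ _ Ea.
      have [d Ed Rd] := s1 _ _ _ _ Rab Ec; have [h1 h2] := (EE _ _ _).1 Ed.
      by exists (g d) => //; exists c, d; split=> //; congruence.
    have [c [-> hc Ec]] := lb' _ _ _ Ea.
    have [d Ed Rd] := s2 _ _ _ _ Rab Ec; have [h1 h2] := (EE _ _ _).1 Ed.
    by exists (g d) => //; exists c, d; split=> //; congruence.
  - split=> i b a b' [a1 [b1 [-> -> ha hb Rab]]] Ea.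
      have [c [-> hc Ec]] := lf' _ _ _ Ea.
      have [d Ed Rd] := s3 _ _ _ _ Rab Ec; have [h1 h2] := (EE _ _ _).1 Ed.
      by exists (g d) => //; exists d, c; split=> //; congruence.
    have [c [-> hc Ec]] := lb' _ _ _ Ea.
    have [d Ed Rd] := s4 _ _ _ _ Rab Ec; have [h1 h2] := (EE _ _ _).1 Ed.
    by exists (g d) => //; exists d, c; split=> //; congruence.
  - move=> a b b' [a1 [b1 [-> -> ha hb Rab]]] [a2 [b2 [e -> ha2 hb2 Rab2]]].
    have ea : a1 = a2 by apply: inj => //; congruence.
    by rewrite ea in Rab; rewrite (fR _ _ _ Rab Rab2).
  - move=> b a a' [a1 [b1 [-> -> ha hb Rab]]] [a2 [b2 [-> e ha2 hb2 Rab2]]].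
    have eb : b1 = b2 by apply: inj => //; congruence.
    by rewrite -eb in Rab2; rewrite (fR' _ _ _ Rab Rab2).
exists (fun a b => [/\ sh a = sh x, sh b = sh y & R (g a) (g b)]) => //; split.
- split=> i a b a' [ha hb Rab] /EE[Ea ea].
    have [d' Ed Rd] := s1 _ _ _ _ Rab Ea.
    have [d [ed hd Ed']] := lf' _ _ _ Ed.
    by exists d => //; split; [congruence|congruence|rewrite -ed].
  have [d' Ed Rd] := s2 _ _ _ _ Rab Ea.
  have [d [ed hd Ed']] := lb' _ _ _ Ed.
  by exists d => //; split; [congruence|congruence|rewrite -ed].
- split=> i b a b' [ha hb Rab] /EE[Ea ea].
    have [d' Ed Rd] := s3 _ _ _ _ Rab Ea.
    have [d [ed hd Ed']] := lf' _ _ _ Ed.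
    by exists d => //; split; [congruence|congruence|rewrite -ed].
  have [d' Ed Rd] := s4 _ _ _ _ Rab Ea.
  have [d [ed hd Ed']] := lb' _ _ _ Ed.
  by exists d => //; split; [congruence|congruence|rewrite -ed].
- move=> a b b' [_ hb Rb] [_ hb' Rb'].
  by apply: inj; [congruence|apply: fR Rb Rb'].
- move=> b a a' [ha _ Ra] [ha' _ Ra'].
  by apply: inj; [congruence|apply: fR' Ra Ra'].
Qed.

Lemma comp_iso_refl T (E : nat -> T -> T -> Prop) x : comp_iso E x x.
Proof.
apply/comp_isoP; exists eq => //; split.
- by split=> i a b a' -> ?; exists a'.
- by split=> i a b a' -> ?; exists a'.
- by move=> a b b' -> ->.
- by move=> a b b' -> ->.
Qed.

Lemma comp_iso_sym T (E : nat -> T -> T -> Prop) x y :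
  comp_iso E x y -> comp_iso E y x.
Proof.
move=> /comp_isoP[R iR Rxy]; apply/comp_isoP; exists (flip_rel R) => //.
exact: graph_iso_flip.
Qed.

Lemma simulation_comp T (E : nat -> T -> T -> Prop) R R' :
  simulation E R -> simulation E R' ->
  simulation E (fun a c => exists2 b, R a b & R' b c).
Proof.
move=> [s1 s2] [t1 t2]; split=> i a c a' [b Rb Rc] Ea.
  have [b' Eb' Rb'] := s1 _ _ _ _ Rb Ea; have [c' Ec' Rc'] := t1 _ _ _ _ Rc Eb'.
  by exists c' => //; exists b'.
have [b' Eb' Rb'] := s2 _ _ _ _ Rb Ea; have [c' Ec' Rc'] := t2 _ _ _ _ Rc Eb'.
by exists c' => //; exists b'.
Qed.

Lemma comp_iso_trans T (E : nat -> T -> T -> Prop) x y z :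
  comp_iso E x y -> comp_iso E y z -> comp_iso E x z.
Proof.
move=> /comp_isoP[R [s1 s2 f1 f2] Rxy] /comp_isoP[R' [t1 t2 g1 g2] Ryz].
apply/comp_isoP; exists (fun a c => exists2 b, R a b & R' b c); last by exists y.
split; first exact: simulation_comp.
- have [h1 h2] := simulation_comp t2 s2; split=> i a c a' [b Rb Rc] Ea.
    have [|c' E' [b' R1 R2]] := h1 i a c a' _ Ea; first by exists b.
    by exists c' => //; exists b'.
  have [|c' E' [b' R1 R2]] := h2 i a c a' _ Ea; first by exists b.
  by exists c' => //; exists b'.
- by move=> a c c' [b R1 R2] [b' R3 R4]; rewrite (f1 _ _ _ R1 R3) in R2; apply: g1 R2 R4.
- by move=> c a a' [b R1 R2] [b' R3 R4]; rewrite (g2 _ _ _ R2 R4) in R1; apply: f2 R1 R3.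
Qed.

End Graphs.

(** * Crystal equivalence is a congruence *)

Section CrystalEquivalence.
Variable n : nat.
Local Notation phi := (phi n).
Local Notation eps := (eps n).
Local Notation fop := (fop n).
Local Notation eop := (eop n).
Local Notation step := (step n).

Definition crys (u v : seq nat) : Prop := comp_iso step u v.

Definition crystal_map (R : seq nat -> seq nat -> Prop) : Prop :=
  forall u v, R u v -> forall i,
    [/\ phi i u = phi i v, eps i u = eps i v,
        0 < phi i u -> R (fop i u) (fop i v)
      & 0 < eps i u -> R (eop i u) (eop i v)].

Lemma crys_of_map R u v : crystal_map R -> functional_rel R ->
  functional_rel (flip_rel R) -> R u v -> crys u v.
Proof.
move=> mR f1 f2 Ruv; apply/comp_isoP; exists R => //; split=> //.
- split=> i a b a' Rab /step_inv[].
    by have [h1 _ h3 _] := mR _ _ Rab i; move=> h -> _ _; exists (fop i b);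
      [apply: step_fop; rewrite -h1|apply: h3].
  by have [_ h1 _ h3] := mR _ _ Rab i; move=> _ _ h ->; exists (eop i b);
    [apply: step_eop; rewrite -h1|apply: h3].
split=> i b a b' Rab /step_inv[].
  by have [h1 _ h3 _] := mR _ _ Rab i; move=> h -> _ _; exists (fop i a);
    [apply: step_fop; rewrite h1|apply: h3; rewrite h1].
by have [_ h1 _ h3] := mR _ _ Rab i; move=> _ _ h ->; exists (eop i a);
  [apply: step_eop; rewrite h1|apply: h3; rewrite h1].
Qed.

(** [phi i u] is the number of times f_i applies to [u], and a simulation carries that whole string
    to one starting at [v]. Used in both directions, this shows that isomorphisms preserve string
    lengths although only edges are assumed to be preserved. *)
Lemma simulation_phi R i u v :
  simulation step R -> R u v -> phi i u <= phi i v.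
Proof.
move=> sR; move e : (phi i u) => k; elim: k u v e => // k IH u v e Ruv.
have su : step i u (fop i u) by apply: step_fop; rewrite e.
have [v' sv Rv] := sR.1 _ _ _ _ Ruv su.
have [_ e1] := step_weight su; have [_ ->] := step_weight sv.
by apply: IH Rv; move: e1; rewrite e => -[].
Qed.

Lemma simulation_eps R i u v :
  simulation step R -> R u v -> eps i u <= eps i v.
Proof.
move=> sR; move e : (eps i u) => k; elim: k u v e => // k IH u v e Ruv.
have su : step i (eop i u) u by apply: step_eop; rewrite e.
have [v' sv Rv] := sR.2 _ _ _ _ Ruv su.
have [e1 _] := step_weight su; have [-> _] := step_weight sv.
by apply: IH Rv; move: e1; rewrite e => -[].
Qed.

Lemma graph_iso_map R : graph_iso step R -> crystal_map R.
Proof.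
move=> [s1 s2 f1 f2] u v Ruv i.
have h1 : phi i u = phi i v.
  by apply/eqP; rewrite eqn_leq (simulation_phi i s1 Ruv)
    (simulation_phi i s2 (Ruv : flip_rel R v u)).
have h2 : eps i u = eps i v.
  by apply/eqP; rewrite eqn_leq (simulation_eps i s1 Ruv)
    (simulation_eps i s2 (Ruv : flip_rel R v u)).
split=> // h.
  by have [v' /step_inv[_ -> _ _]] := s1.1 _ _ _ _ Ruv (step_fop h).
by have [v' /step_inv[_ _ _ ->]] := s1.2 _ _ _ _ Ruv (step_eop h).
Qed.

Lemma crys_phi i u v : crys u v -> phi i u = phi i v.
Proof. by move=> /comp_isoP[R /graph_iso_map mR /mR /(_ i)[]]. Qed.

Lemma crys_eps i u v : crys u v -> eps i u = eps i v.
Proof. by move=> /comp_isoP[R /graph_iso_map mR /mR /(_ i)[]]. Qed.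

Lemma crys_fop i u v : crys u v -> 0 < phi i u -> crys (fop i u) (fop i v).
Proof.
move=> /comp_isoP[R iR Ruv] h; apply/comp_isoP; exists R => //.
by have [_ _ + _] := graph_iso_map iR Ruv i; apply.
Qed.

Lemma crys_eop i u v : crys u v -> 0 < eps i u -> crys (eop i u) (eop i v).
Proof.
move=> /comp_isoP[R iR Ruv] h; apply/comp_isoP; exists R => //.
by have [_ _ _] := graph_iso_map iR Ruv i; apply.
Qed.

(** * Compatibility with concatenation *)

Lemma fop_cat i u v : 0 < phi i (u ++ v) ->
  fop i (u ++ v) = if eps i v < phi i u then fop i u ++ v else u ++ fop i v.
Proof.
elim: u => [|x u IH] //= h; rewrite eps_cat.
have := IH; rewrite phi_cat.
case: (ltnP (eps i v) (phi i u)) => h1 IH'.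
  have -> : eps i u + (eps i v - phi i u) = eps i u by lia.
  rewrite [RHS]ifT; last by lia.
  by case: ifP => // _; rewrite IH' //; lia.
case: (ltnP (eps i u + (eps i v - phi i u)) (phl n i x)) => h2.
  by rewrite ifT; [rewrite ifT //; lia|lia].
rewrite ifF; last by lia.
by rewrite IH' //; move: h; rewrite phi_cat eps_cat; lia.
Qed.

Lemma eop_cat i u v : 0 < eps i (u ++ v) ->
  eop i (u ++ v) = if eps i v <= phi i u then eop i u ++ v else u ++ eop i v.
Proof.
elim: u => [|x u IH] /= h.
  by rewrite leqn0; case: eqP => // e; rewrite e in h.
have := IH; move: h; rewrite eps_cat.
case: (leqP (eps i v) (phi i u)) => h1 h IH'.
  have e1 : eps i u + (eps i v - phi i u) = eps i u by lia.
  rewrite e1 in h IH' *; rewrite [RHS]ifT; last by lia.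
  by case: ifP => // h2; rewrite IH' //; lia.
case: (leqP (eps i u + (eps i v - phi i u)) (phl n i x)) => h2.
  by rewrite ifT; [rewrite ifT //; lia|lia].
rewrite [RHS]ifF; last by lia.
by rewrite IH' //; lia.
Qed.

Lemma size_fop i u : size (fop i u) = size u.
Proof. by elim: u => //= a u IH; case: ifP => //= _; rewrite IH. Qed.

Lemma size_eop i u : size (eop i u) = size u.
Proof. by elim: u => //= a u IH; case: ifP => //= _; rewrite IH. Qed.

(** Which factor moves depends only on [phi] of the left factor and [eps] of the right one, and
    related words share both. *)
Lemma crys_catr u v y : crys u v -> crys (u ++ y) (v ++ y).
Proof.
move=> /comp_isoP[R iR Ruv]; have mR := graph_iso_map iR.
(* Operators preserve length, so prescribing the lengths of the left factors makes the cut unique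
   and the relation functional in both directions. *)
pose R' a b := exists u1 v1 y1, [/\ a = u1 ++ y1, b = v1 ++ y1,
  size u1 = size u, size v1 = size v & R u1 v1].
apply: (crys_of_map (R := R')); last by exists u, v, y.
- move=> a b [u1 [v1 [y1 [-> -> su sv R1]]]] i.
  have [h1 h2 h3 h4] := mR _ _ R1 i.
  split; rewrite ?phi_cat ?eps_cat ?h1 ?h2 // => h.
    rewrite !fop_cat ?phi_cat ?h1 //; case: ifP => h5.
      exists (fop i u1), (fop i v1), y1; rewrite !size_fop; split=> //.
      by apply: h3; rewrite h1; lia.
    by exists u1, v1, (fop i y1).
  rewrite !eop_cat ?eps_cat ?h2 ?h1 //; case: ifP => h5.
    exists (eop i u1), (eop i v1), y1; rewrite !size_eop; split=> //.
    by apply: h4; rewrite h2; lia.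
  by exists u1, v1, (eop i y1).
- move=> a b b' [u1 [v1 [y1 [-> -> su sv R1]]]] [u2 [v2 [y2 [e -> su2 sv2 R2]]]].
  move/eqP: e; rewrite eqseq_cat ?su //; case/andP => /eqP e1 /eqP ->.
  by case: iR => _ _ f _; rewrite e1 in R1; rewrite (f _ _ _ R1 R2).
- move=> a b b' [u1 [v1 [y1 [-> -> su sv R1]]]] [u2 [v2 [y2 [-> e su2 sv2 R2]]]].
  move/eqP: e; rewrite eqseq_cat ?sv //; case/andP => /eqP e1 /eqP ->.
  by case: iR => _ _ _ f; rewrite -e1 in R2; rewrite (f _ _ _ R1 R2).
Qed.

Lemma crys_catl u v x : crys u v -> crys (x ++ u) (x ++ v).
Proof.
move=> /comp_isoP[R iR Ruv]; have mR := graph_iso_map iR.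
pose R' a b := exists u1 v1 y1, [/\ a = y1 ++ u1, b = y1 ++ v1,
  size y1 = size x & R u1 v1].
apply: (crys_of_map (R := R')); last by exists u, v, x.
- move=> a b [u1 [v1 [y1 [-> -> sy R1]]]] i.
  have [h1 h2 h3 h4] := mR _ _ R1 i.
  split; rewrite ?phi_cat ?eps_cat ?h1 ?h2 // => h.
    rewrite !fop_cat ?phi_cat ?h1 ?h2 //; case: ifP => h5.
      by exists u1, v1, (fop i y1); rewrite !size_fop; split.
    exists (fop i u1), (fop i v1), y1; split=> //.
    by apply: h3; rewrite h1; lia.
  rewrite !eop_cat ?eps_cat ?h2 ?h1 //; case: ifP => h5.
    by exists u1, v1, (eop i y1); rewrite !size_eop; split.
  exists (eop i u1), (eop i v1), y1; split=> //.
  by apply: h4; rewrite h2; lia.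
- move=> a b b' [u1 [v1 [y1 [-> -> sy R1]]]] [u2 [v2 [y2 [e -> sy2 R2]]]].
  move/eqP: e; rewrite eqseq_cat ?sy //; case/andP => /eqP -> /eqP e1.
  by case: iR => _ _ f _; rewrite e1 in R1; rewrite (f _ _ _ R1 R2).
- move=> a b b' [u1 [v1 [y1 [-> -> sy R1]]]] [u2 [v2 [y2 [-> e sy2 R2]]]].
  move/eqP: e; rewrite eqseq_cat ?sy //; case/andP => /eqP -> /eqP e1.
  by case: iR => _ _ _ f; rewrite -e1 in R2; rewrite (f _ _ _ R1 R2).
Qed.

Lemma crys_refl u : crys u u. Proof. exact: comp_iso_refl. Qed.
Lemma crys_sym u v : crys u v -> crys v u. Proof. exact: comp_iso_sym. Qed.
Lemma crys_trans u v w : crys u v -> crys v w -> crys u w.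
Proof. exact: comp_iso_trans. Qed.

(** * Translation between letters and positions *)

Definition code (x : letter n) : nat := (rank x).+1.
Definition codes (w : word n) : seq nat := map code w.

Lemma codeP (x : letter n) : 0 < code x <= 2 * n.
Proof. case: x => j b; rewrite /code /rank /=; have := ltn_ord j; case: b; lia. Qed.

Lemma code_inj : injective code.
Proof.
move=> [j b] [k c]; rewrite /code /rank /= => h.
have hj := ltn_ord j; have hk := ltn_ord k.
have bc : b = c by move: h; case: b; case: c => /= h; lia.
by subst c; congr pair; apply: val_inj; move: h => /=; case: b; lia.
Qed.

Lemma code_surj a : 0 < a <= 2 * n -> exists x : letter n, code x = a.
Proof.
move=> h; case: (leqP a n) => ha.
  have h1 : a.-1 < n by lia.
  by exists (Ordinal h1, false); rewrite /code /rank /=; lia.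
have h1 : 2 * n - a < n by lia.
by exists (Ordinal h1, true); rewrite /code /rank /=; lia.
Qed.

Lemma arrow_code i x y : arrow i x y = phl n i (code x) && (code y == (code x).+1).
Proof.
case: x => j b; case: y => k c; rewrite /arrow /phl /code /rank /lval /=.
have hj := ltn_ord j; have hk := ltn_ord k.
by case: b; case: c => /=; lia.
Qed.

Lemma phi_lE i (x : letter n) : phi_l i x = phl n i (code x) :> nat.
Proof.
rewrite /phi_l; congr nat_of_bool; apply/existsP/idP => [[y]|h].
  by rewrite arrow_code => /andP[].
have [|y ey] := @code_surj (code x).+1.
  by have := codeP x; move: h; rewrite /phl; lia.
by exists y; rewrite arrow_code h ey /=.
Qed.

Lemma eps_lE i (x : letter n) : eps_l i x = epl n i (code x) :> nat.
Proof.
rewrite /eps_l; congr nat_of_bool; apply/existsP/idP => [[y]|h].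
  by rewrite arrow_code => /andP[h /eqP ->]; rewrite -phl_eplS.
have [|y ey] := @code_surj (code x).-1.
  by have := codeP x; move: h; rewrite /epl; lia.
exists y; have hx : code x = (code y).+1 by rewrite ey; have := codeP x; lia.
by rewrite arrow_code hx eqxx andbT phl_eplS -hx.
Qed.

Lemma f_letterE i (x : letter n) :
  omap code (f_letter i x) = if phl n i (code x) then Some (code x).+1 else None.
Proof.
rewrite /f_letter; case: pickP => [y|no] /=.
  by rewrite arrow_code => /andP[-> /eqP ->].
case: ifP => // h; have := phi_lE i x; rewrite /phi_l h.
by case: existsP => // -[y]; rewrite no.
Qed.

Lemma eps_wE i (w : word n) : eps_w i w = eps i (codes w).
Proof. by elim: w => //= a w ->; rewrite phi_lE eps_lE. Qed.

Lemma codes_inj : injective codes.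
Proof. exact/inj_map/code_inj. Qed.

Lemma f_wE i (w : word n) :
  omap codes (f_w i w) = if 0 < phi i (codes w) then Some (fop i (codes w)) else None.
Proof.
elim: w => //= a w IH; rewrite eps_wE phi_lE.
case: ifP => h.
  rewrite ifT; last by lia.
  have := f_letterE i a; case: (phl n i (code a)) h => //= h.
  by case: (f_letter i a) => //= b [e]; rewrite /code e.
have -> : phl n i (code a) - eps i (codes w) = 0 by lia.
by rewrite addn0; move: IH; case: (f_w i w) => [v|] /=; case: ifP => // _ [<-].
Qed.

Lemma edgeW_step i (u v : word n) : edgeW i u v <-> step i (codes u) (codes v).
Proof.
split=> [[hi h]|h].
  have := f_wE i u; rewrite h /=; case: ifP => // hp [->].
  exact: step_fop.
have [h1 h2 _ _] := step_inv h.
have hi : 0 < i <= n by move: h => [? [? [? [_ _ /phlP[-> ->]]]]].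
split=> //; have := f_wE i u; rewrite h1 -h2.
by case: (f_w i u) => //= w [/codes_inj ->].
Qed.

Lemma step_codes i (u : word n) b :
  step i (codes u) b -> exists v, b = codes v.
Proof.
move=> h; have [h1 h2 _ _] := step_inv h.
have := f_wE i u; rewrite h1 -h2.
by case: (f_w i u) => //= w [<-]; exists w.
Qed.

Lemma codes_surj b : all (fun a => 0 < a <= 2 * n) b -> exists v, b = codes v.
Proof.
elim: b => [|a b IH] /=; first by exists [::].
by case/andP => /code_surj[x <-] /IH[v ->]; exists (x :: v).
Qed.

Lemma codesP u : all (fun a => 0 < a <= 2 * n) (codes u).
Proof. by apply/allP => a /mapP[x _ ->]; apply: codeP. Qed.

Lemma codes_step i (u : word n) b :
  step i b (codes u) -> exists v, b = codes v.
Proof.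
move=> [b1 [x [b2 [-> e hx _ _]]]]; apply: codes_surj.
have := codesP u; rewrite e !all_cat /= => /and3P[-> _ ->].
by move: hx; rewrite /phl; lia.
Qed.

Lemma crystal_relE (u v : word n) : crystal_rel u v <-> crys (codes u) (codes v).
Proof.
apply: (comp_iso_transport (sh := fun=> tt)).
- by move=> i a b; split=> [/edgeW_step //|[/edgeW_step]].
- by move=> a b _ /codes_inj.
- by move=> i a b /step_codes[c ->]; exists c.
- by move=> i a b /codes_step[c ->]; exists c.
Qed.

(** Crystal equivalence is already closed under contexts, so generating a congruence from it adds
    nothing. *)
Lemma plac_equivE (u v : word n) : plac_equiv u v <-> crys (codes u) (codes v).
Proof.
split=> [|h]; last by apply: cg_step; apply/crystal_relE.
elim=> {u v} [u v /crystal_relE //|u|u v _|u v w _ h1 _ h2|x y u v _ h].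
- exact: crys_refl.
- exact: crys_sym.
- exact: crys_trans h1 h2.
- by rewrite /codes !map_cat; apply: crys_catl; apply: crys_catr.
Qed.

End CrystalEquivalence.

(** * Columns *)

Section Columns.
Variable n : nat.
Local Notation phi := (phi n).
Local Notation eps := (eps n).
Local Notation step := (step n).

Lemma step_cat i a1 a2 b1 b2 : size a1 = size b1 ->
  step i (a1 ++ a2) (b1 ++ b2) <->
  (step i a1 b1 /\ a2 = b2 /\ eps i a2 < phi i a1) \/
  (a1 = b1 /\ step i a2 b2 /\ phi i a1 <= eps i a2).
Proof.
move=> sab; split=> [h|].
  have [h1 h2 _ _] := step_inv h; move: (h1) h2; rewrite phi_cat => h3.
  rewrite fop_cat //; case: ifP => h4 /eqP.
    rewrite eqseq_cat ?size_fop // => /andP[/eqP -> /eqP ->]; left; split=> //.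
    by apply: step_fop; lia.
  rewrite eqseq_cat // => /andP[/eqP -> /eqP ->]; right; split=> //; split; last by lia.
  by apply: step_fop; lia.
move=> [[[u [x [v [-> -> hx hu hv]]]] [<- h]]|[<- [[u [x [v [-> -> hx hu hv]]]] h]]].
  exists u, x, (v ++ a2); rewrite -!catA /=; split=> //.
  move: h; rewrite eps_cat hv phi_cat hu /= hv hx (phl_epl hx) /=; lia.
exists (a1 ++ u), x, v; rewrite -!catA /=; split=> //.
by move: h; rewrite eps_cat phi_cat hu /= hv hx (phl_epl hx) /=; lia.
Qed.

Definition nU (c : seq nat) (k : nat) : nat := count (fun x => x <= k) c.
Definition nB (c : seq nat) (k : nat) : nat := count (fun x => (2 * n).+1 - k <= x) c.

Definition col (c : seq nat) : bool :=
  sorted ltn c && all (fun x => 0 < x <= 2 * n) c.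

(* Admissibility of the column [c]: see [admissibleP]. *)
Definition bnd (c : seq nat) : Prop := forall m, m <= n -> nU c m + nB c m <= m.

(* [cle c1 c2] is the relation \preceq with the splits of [c1] and [c2] eliminated
   (see [colleP]): the first inequality compares the unbarred letters, the second
   the barred ones. *)
Definition cle (c1 c2 : seq nat) : Prop := forall k m, k <= m -> m <= n ->
  nU c2 m + nB c2 m + k <= nU c1 k + nB c2 k + m /\
  size c2 + nU c1 m + nB c1 m + k <= size c1 + nB c2 k + nU c1 k + m.

Lemma col_uniq c : col c -> uniq c.
Proof. by case/andP => /(sorted_uniq ltn_trans ltnn). Qed.

Lemma nU0 c : col c -> nU c 0 = 0.
Proof.
case/andP => _ /allP h; apply/eqP; rewrite -leqn0 leqNgt -has_count.
by apply/hasPn => x /h; lia.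
Qed.

Lemma nB0 c : col c -> nB c 0 = 0.
Proof.
case/andP => _ /allP h; apply/eqP; rewrite -leqn0 leqNgt -has_count.
by apply/hasPn => x /h; lia.
Qed.

Lemma nUS c m : col c -> nU c m.+1 = nU c m + (m.+1 \in c).
Proof.
move=> /col_uniq uc; rewrite /nU -(count_uniq_mem _ uc) -count_predUI.
rewrite [X in _ = _ + X](eq_count (a2 := pred0)) ?count_pred0 ?addn0.
  by apply: eq_count => x /=; lia.
by move=> x /=; lia.
Qed.

Lemma nBS c m : col c -> m < 2 * n -> nB c m.+1 = nB c m + (2 * n - m \in c).
Proof.
move=> /col_uniq uc hm; rewrite /nB -(count_uniq_mem _ uc) -count_predUI.
rewrite [X in _ = _ + X](eq_count (a2 := pred0)) ?count_pred0 ?addn0.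
  by apply: eq_count => x /=; lia.
by move=> x /=; lia.
Qed.

Lemma nUp c m : col c -> 0 < m -> nU c m = nU c m.-1 + (m \in c).
Proof. by case: m => // m h _; rewrite nUS. Qed.

Lemma nBp c m : col c -> 0 < m <= 2 * n ->
  nB c m = nB c m.-1 + ((2 * n).+1 - m \in c).
Proof. by case: m => // m h hm; rewrite nBS //; lia. Qed.

(** * String lengths of a column *)

Lemma eps_filter i w : eps i w = eps i [seq x <- w | phl n i x || epl n i x].
Proof.
elim: w => //= a w IH; case: ifP => /=; first by rewrite IH.
by case: (phl n i a) => //; case: (epl n i a) => //= _; rewrite IH subn0.
Qed.

Lemma phi_filter i w : phi i w = phi i [seq x <- w | phl n i x || epl n i x].
Proof.
elim: w => //= a w IH; case: ifP => /=; first by rewrite IH -eps_filter.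
by case: (phl n i a) => //; case: (epl n i a) => //= _; rewrite IH addn0.
Qed.

(** Only these four letters lie on an arrow labelled i, and a column lists the ones it contains in
    increasing order; its string lengths therefore depend on four memberships only. *)
Lemma col_relevant i c : col c -> 0 < i < n ->
  [seq x <- c | phl n i x || epl n i x] =
  [seq x <- [:: i; i.+1; 2 * n - i; (2 * n).+1 - i] | x \in c].
Proof.
move=> /andP[sc _] hi; apply: (irr_sorted_eq ltn_trans ltnn).
- exact: (sorted_filter ltn_trans).
- by apply: (sorted_filter ltn_trans) => /=; lia.
move=> x; rewrite !mem_filter andbC; congr (_ && _).
by rewrite !inE /phl /epl; lia.
Qed.

Lemma col_relevant_n c : col c -> 0 < n ->
  [seq x <- c | phl n n x || epl n n x] = [seq x <- [:: n; n.+1] | x \in c].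
Proof.
move=> /andP[sc _] hi; apply: (irr_sorted_eq ltn_trans ltnn).
- exact: (sorted_filter ltn_trans).
- by apply: (sorted_filter ltn_trans) => /=; lia.
move=> x; rewrite !mem_filter andbC; congr (_ && _).
by rewrite !inE /phl /epl; lia.
Qed.

Lemma col_eps i c : col c -> 0 < i < n ->
  eps i c = ((i.+1 \in c) && (i \notin c)) +
    [&& (2 * n).+1 - i \in c, 2 * n - i \notin c & ~~ ((i \in c) && (i.+1 \notin c))].
Proof.
move=> hc hi; rewrite eps_filter col_relevant //=.
have p1 : phl n i i by rewrite /phl; lia.
have p2 : phl n i (2 * n - i) by rewrite /phl; lia.
have m1 : epl n i i.+1 by rewrite /epl; lia.
have m2 : epl n i ((2 * n).+1 - i) by rewrite /epl; lia.
by case: (i \in c); case: (i.+1 \in c); case: (2 * n - i \in c);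
  case: ((2 * n).+1 - i \in c) => //=;
  rewrite ?p1 ?p2 ?m1 ?m2 ?(phl_epl p1) ?(phl_epl p2) ?(epl_phl m1) ?(epl_phl m2).
Qed.

Lemma col_phi i c : col c -> 0 < i < n ->
  phi i c = ((2 * n - i \in c) && ((2 * n).+1 - i \notin c)) +
    [&& i \in c, i.+1 \notin c & ~~ (((2 * n).+1 - i \in c) && (2 * n - i \notin c))].
Proof.
move=> hc hi; rewrite phi_filter col_relevant //=.
have p1 : phl n i i by rewrite /phl; lia.
have p2 : phl n i (2 * n - i) by rewrite /phl; lia.
have m1 : epl n i i.+1 by rewrite /epl; lia.
have m2 : epl n i ((2 * n).+1 - i) by rewrite /epl; lia.
by case: (i \in c); case: (i.+1 \in c); case: (2 * n - i \in c);
  case: ((2 * n).+1 - i \in c) => //=;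
  rewrite ?p1 ?p2 ?m1 ?m2 ?(phl_epl p1) ?(phl_epl p2) ?(epl_phl m1) ?(epl_phl m2).
Qed.

Lemma col_eps_n c : col c -> 0 < n -> eps n c = (n.+1 \in c) && (n \notin c) :> nat.
Proof.
move=> hc hi; rewrite eps_filter col_relevant_n //=.
have p1 : phl n n n by rewrite /phl; lia.
have m1 : epl n n n.+1 by rewrite /epl; lia.
by case: (n \in c); case: (n.+1 \in c) => //=;
  rewrite ?p1 ?m1 ?(phl_epl p1) ?(epl_phl m1).
Qed.

Lemma col_phi_n c : col c -> 0 < n -> phi n c = (n \in c) && (n.+1 \notin c) :> nat.
Proof.
move=> hc hi; rewrite phi_filter col_relevant_n //=.
have p1 : phl n n n by rewrite /phl; lia.
have m1 : epl n n n.+1 by rewrite /epl; lia.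
by case: (n \in c); case: (n.+1 \in c) => //=;
  rewrite ?p1 ?m1 ?(phl_epl p1) ?(epl_phl m1).
Qed.

Lemma col_split u x v : col (u ++ x :: v) =
  [&& col u, col v, all (fun y => y < x) u, all (fun y => x < y) v & 0 < x <= 2 * n].
Proof.
rewrite /col !(sorted_pairwise ltn_trans) pairwise_cat all_cat allrel_consr /=.
apply/idP/idP.
  by case/andP => /and3P[/andP[-> _] -> /andP[-> ->]] /and3P[-> -> ->].
case/and5P => /andP[-> ->] /andP[-> ->] h1 h2 ->.
have h3 : allrel ltn u v.
  apply/allrelP => y z hy hz.
  by apply: (@ltn_trans x); [apply: (allP h1)|apply: (allP h2)].
by rewrite h1 h2 h3.
Qed.

(* The letter moved by [f_i] in a column is determined by which of
   [i, i+1, bar(i+1), bar i] it contains. *)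
Definition col_move (i x : nat) (c : seq nat) : bool :=
  [&& x == i, i \in c, i.+1 \notin c
    & (i < n) ==> ((2 * n - i \in c) || ((2 * n).+1 - i \notin c))] ||
  [&& x == 2 * n - i, i < n, 2 * n - i \in c, (2 * n).+1 - i \notin c
    & (i \in c) ==> (i.+1 \in c)].

(** Being a column could fail only by a collision. A letter x+1 just after the moved x would cancel
    it, and a letter x just before the new x+1 would be an uncancelled letter further left; [step]
    excludes both. *)
Lemma step_col i a b : step i a b -> col a || col b ->
  exists x, [/\ col a, col b, 0 < i <= n, col_move i x a
    & [/\ forall y, (y \in b) = (y == x.+1) || ((y \in a) && (y != x)),
      size b = size a,
      forall m, nU b m + (m == x) = nU a m &
      forall m, m <= n -> nB b m = nB a m + (x == 2 * n - m)]].
Proof.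
move=> [u [x [v [-> -> hx hu hv]]]] h; exists x.
have [i0 ilen hxi] := phlP hx.
have xn : x < 2 * n by lia.
have cu : col u by case/orP: h; rewrite col_split => /and5P[].
have cv : col v by case/orP: h; rewrite col_split => /and5P[].
have [lu lv] : (forall y, y \in u -> y < x) /\ (forall y, y \in v -> x.+1 < y).
  case/orP: h; rewrite col_split => /and5P[_ _ /allP h1 /allP h2 _]; split=> y hy.
  - exact: h1.
  - rewrite ltn_neqAle h2 // andbT; apply/negP => /eqP e; subst y.
    have [z [z' ez]] : exists z z', v = z ++ x.+1 :: z' by case/splitPr: hy => z z';
      exists z, z'.
    have [ez0|] := boolP (z == [::]).
      by move: hv; rewrite ez (eqP ez0) /= -phl_eplS hx.
    case: z ez => // z0 z ez _.
    have := h2 z0; rewrite ez inE eqxx => /(_ isT).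
    by move: cv; rewrite ez col_split => /and5P[_ _ /allP /(_ z0)]; rewrite inE eqxx; lia.
  - have := h1 _ hy; rewrite ltnS leq_eqVlt => /orP[/eqP e|//]; subst y.
    have [z [z' ez]] : exists z z', u = z ++ x :: z' by case/splitPr: hy => z z'; exists z, z'.
    case: z' ez => [|z0 z'] ez.
      by move: hu; rewrite ez phi_cat /= hx.
    have := h1 z0; rewrite ez mem_cat !inE eqxx !orbT => /(_ isT).
    by move: cu; rewrite ez col_split => /and5P[_ _ _ /allP /(_ z0)]; rewrite inE eqxx; lia.
  - exact: h2.
have ca : col (u ++ x :: v).
  rewrite col_split cu cv /=; apply/and3P; split; last by lia.
    by apply/allP => y /lu.
  by apply/allP => y /lv; lia.
have cb : col (u ++ x.+1 :: v).
  rewrite col_split cu cv /=; apply/and3P; split; last by lia.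
    by apply/allP => y /lu; lia.
  by apply/allP => y /lv.
have mu y : (y \in u) = (y \in u ++ x :: v) && (y < x).
  rewrite mem_cat inE; case: (boolP (y \in u)) => [/lu -> //|_ /=].
  by case: (boolP (y \in v)) => [/lv|_]; lia.
have mv y : (y \in v) = (y \in u ++ x :: v) && (x < y).
  rewrite mem_cat inE; case: (boolP (y \in v)) => [/lv|_ /=]; first by rewrite !orbT /=; lia.
  by case: (boolP (y \in u)) => [/lu|_]; lia.
have xa : x \in u ++ x :: v by rewrite mem_cat inE eqxx orbT.
have xb : x.+1 \notin u ++ x :: v.
  rewrite mem_cat inE; apply/negP => /or3P[/lu|/eqP|/lv]; lia.
split=> //; first by rewrite i0.
  move: hu hv; rewrite /col_move; have [e|ltn_i] := eqVneq i n.
    have ex : x = n by lia.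
    move=> _ _; move: xa xb; rewrite ex e eqxx ltnn /= => -> ->; lia.
  have hi : 0 < i < n by lia.
  rewrite col_phi // col_eps // !mu !mv.
  case: hxi => e; move: xa xb; rewrite e.
    by move=> -> -> /=; rewrite eqxx /=; lia.
  have -> : (2 * n - i).+1 = (2 * n).+1 - i by lia.
  by move=> -> -> /=; rewrite eqxx /=; lia.
split=> [y||m|m hm].
- rewrite !mem_cat !inE; case: (boolP (y \in u)) => [/lu|_ /=]; first by lia.
  by case: (boolP (y \in v)) => [/lv|_]; lia.
- by rewrite !size_cat.
- by rewrite /nU !count_cat /=; lia.
- by rewrite /nB !count_cat /=; lia.
Qed.

End Columns.

(** * Stability along edges *)

Section Stability.
Variable n : nat.
Local Notation step := (step n).
Local Notation col := (col n).
Local Notation nB := (nB n).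
Local Notation bnd := (bnd n).
Local Notation cle := (cle n).

Lemma col_profile i c : col c -> 0 < i <= n ->
  [/\ nU c i = nU c i.-1 + (i \in c),
      i < n -> nU c i.+1 = nU c i + (i.+1 \in c),
      nB c i = nB c i.-1 + ((2 * n).+1 - i \in c) &
      i < n -> nB c i.+1 = nB c i + (2 * n - i \in c)].
Proof.
move=> hc hi; split=> *; [apply: nUp|apply: nUS|apply: nBp|apply: nBS] => //; lia.
Qed.

(** The cases are n moving to its bar, i moving to i+1, and the bar of i+1 moving to the bar of i.
    The memberships are kept because they fix the increments of [nU] and [nB] next to [i]. *)
Lemma step_local i a b : step i a b -> col a || col b ->
  [/\ col a, col b, 0 < i <= n, size b = size a &
  [/\ forall m, m <= n -> m != i -> nU b m = nU a m,
      forall m, m <= n -> m != i -> nB b m = nB a m &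
   [\/ [/\ i = n, nU a n = (nU b n).+1, nB b n = (nB a n).+1,
           n \in a & n.+1 \notin a],
       [/\ i < n, nU a i = (nU b i).+1, nB b i = nB a i &
        [/\ i \in a, i.+1 \notin a
          & (2 * n - i \in a) || ((2 * n).+1 - i \notin a)]] |
       [/\ i < n, nU b i = nU a i, nB b i = (nB a i).+1 &
        [/\ 2 * n - i \in a, (2 * n).+1 - i \notin a
          & (i \in a) ==> (i.+1 \in a)]]]]].
Proof.
move=> sab hab; have [x [ca cb hi hm [_ hs hU hB]]] := step_col sab hab.
split=> //; move: hm => /orP[/and4P[/eqP ex h1 h2 h3]|/and5P[/eqP ex ltin h1 h2 h3]].
  split=> [m hmn mi|m hmn mi|].
  - by have := hU m; clear -mi ex; lia.
  - by have := hB m hmn; clear -mi ex hi hmn; lia.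
  have [ein|ltin] := eqVneq i n.
    rewrite ein in ex h1 h2; apply: Or31; split=> //.
      by have := hU n; clear -ex; lia.
    by have := hB n (leqnn n); clear -ex; lia.
  have {}ltin : i < n by clear -ltin hi; lia.
  apply: Or32; split=> //.
  - by have := hU i; clear -ltin ex; lia.
  - by have := hB i; clear -ltin ex hi; lia.
  by split=> //; move: h3; rewrite ltin.
split=> [m hmn mi|m hmn mi|].
- by have := hU m; clear -hmn mi ex ltin hi; lia.
- by have := hB m hmn; clear -mi ex hi hmn; lia.
apply: Or33; split=> //.
- by have := hU i; clear -ltin ex; lia.
- by have := hB i; clear -ltin ex hi; lia.
Qed.

(** With D(k) = nU(k) + nB(k) - k: when i moves, D(i) drops from a value equal to D(i+1) if the bar
    of i+1 is present, and to D(i-1) otherwise. When the bar of i+1 moves, D(i) rises to D(i+1) if i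
    is present, and to D(i-1) otherwise. [Z] and [W] express an arbitrary integer bound without
    subtraction. *)
Lemma defect_step i a b Z W : step i a b -> col a || col b -> i < n ->
  (forall m, i.-1 <= m <= i.+1 -> nU a m + nB a m + W <= Z + m) <->
  (forall m, i.-1 <= m <= i.+1 -> nU b m + nB b m + W <= Z + m).
Proof.
move=> sab hab ltin.
have [ca cb hi _ [hU hB hm]] := step_local sab hab.
have [p1 /(_ ltin) p2 p3 /(_ ltin) p4] := col_profile ca hi.
have r1 := hU i.-1; have r2 := hU i.+1; have r3 := hB i.-1; have r4 := hB i.+1.
have i0 : 0 < i by case/andP: hi.
have {hU hB hi} [q1 q2 q3 q4] : [/\ nU b i.-1 = nU a i.-1, nU b i.+1 = nU a i.+1,
    nB b i.-1 = nB a i.-1 & nB b i.+1 = nB a i.+1].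
  by split; [apply: r1|apply: r2|apply: r3|apply: r4]; clear -ltin i0; lia.
have red (c : seq nat) : (forall m, i.-1 <= m <= i.+1 -> nU c m + nB c m + W <= Z + m) <->
    [/\ nU c i.-1 + nB c i.-1 + W <= Z + i.-1, nU c i + nB c i + W <= Z + i
      & nU c i.+1 + nB c i.+1 + W <= Z + i.+1].
  split=> [h|[h1 h2 h3] m hm']; first by split; apply: h; clear -i0; lia.
  have [->|[->|->]] : m = i.-1 \/ m = i \/ m = i.+1 by clear -hm'; lia.
  - by [].
  - by [].
  - by [].
clear r1 r2 r3 r4; rewrite !red; clear red.
case: hm => [[e]|[_ e1 e2 [b1 b2 b3]]|[_ e1 e2 [b1 b2 b3]]].
- by exfalso; clear -e ltin; lia.
- move: p1 p2 p3 p4; rewrite b1 (negbTE b2).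
  case: (_ \in a) b3; case: (_ \in a) => //= _ p1 p2 p3 p4;
  clear -e1 e2 q1 q2 q3 q4 p1 p2 p3 p4 i0; split=> -[h1 h2 h3]; split; lia.
move: p1 p2 p3 p4; rewrite b1 (negbTE b2).
case: (_ \in a) b3; case: (_ \in a) => //= _ p1 p2 p3 p4;
clear -e1 e2 q1 q2 q3 q4 p1 p2 p3 p4 i0; split=> -[h1 h2 h3]; split; lia.
Qed.

Lemma bnd_step i a b : step i a b -> col a || col b -> bnd a <-> bnd b.
Proof.
move=> sab hab; have [ca cb hi _ [hU hB hm]] := step_local sab hab.
have key m : m <= n -> m != i -> nU b m = nU a m /\ nB b m = nB a m.
  by move=> hmn hmi; split; [apply: hU|apply: hB].
suff key2 : (bnd a -> nU b i + nB b i <= i) /\ (bnd b -> nU a i + nB a i <= i).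
  split=> h m hmn; have [->|mi] := eqVneq m i; first by apply: key2.1.
  - by have [-> ->] := key m hmn mi; apply: h.
  - by apply: key2.2.
  - by have [<- <-] := key m hmn mi; apply: h.
(* For i = n there is no index to the right, but n is traded for its bar and the sum at n does not
   change. *)
have [ein|ltin] : i = n \/ i < n by clear -hi; lia.
  case: hm => [[_ e1 e2 _ _]|[e _ _ _]|[e _ _ _]]; try by clear -ein e; lia.
  rewrite ein; split=> h; have := h n (leqnn n); clear -e1 e2; lia.
have [D1 D2] := defect_step 0 0 sab hab ltin.
by split=> h; rewrite -[leqRHS]add0n -[leqLHS]addn0;
  [apply: D1 => [m hm'|]|apply: D2 => [m hm'|]];
  rewrite ?add0n ?addn0; try apply: h; try (clear -hm' ltin; lia); clear -ltin; lia.
Qed.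

(* For a pair word [a1 ++ a2], the quantity [nU a2 k + nB a1 k - k] obeys a
   discrete minimum principle along edges, as [nU a k + nB a k - k] obeys the
   maximum principle above; [cle] is a conjunction of bounds on these. *)
Lemma pair_step i a1 a2 b1 b2 Z W : size a1 = size b1 ->
  step i (a1 ++ a2) (b1 ++ b2) -> col a1 || col b1 -> col a2 || col b2 -> i < n ->
  (forall m, i.-1 <= m <= i.+1 -> Z + m <= nU a2 m + nB a1 m + W) <->
  (forall m, i.-1 <= m <= i.+1 -> Z + m <= nU b2 m + nB b1 m + W).
Proof.
move=> ss st c1 c2 ltin.
have i0 : 0 < i by move: st => [? [? [? [_ _ /phlP[]]]]].
have red (f g : nat -> nat) : (forall m, i.-1 <= m <= i.+1 -> Z + m <= f m + g m + W) <->
    [/\ Z + i.-1 <= f i.-1 + g i.-1 + W, Z + i <= f i + g i + W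
      & Z + i.+1 <= f i.+1 + g i.+1 + W].
  split=> [h|[h1 h2 h3] m hm']; first by split; apply: h; clear -i0; lia.
  have [->|[->|->]] : m = i.-1 \/ m = i \/ m = i.+1 by clear -hm'; lia.
  - by [].
  - by [].
  - by [].
rewrite !red {red}; have hi : 0 < i < n by rewrite i0.
have hi' : 0 < i <= n by clear -hi; lia.
have [j1 j2] : i.-1 <= n /\ i.-1 != i by clear -hi; lia.
have j3 : i.+1 != i by clear; lia.
(* Only barred letters of the first column and unbarred letters of the second are counted. When one
   of these moves, the single membership pattern that would break the bound is ruled out by the
   tensor product rule [he]. *)
have [[sa [e21 he]]|[e11 [sa he]]] := (step_cat _ _ _ _ ss).1 st.
  subst b2; rewrite orbb in c2; have [ca cb _ _ [hU hB hm]] := step_local sa c1.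
  have [p1 /(_ ltin) p2 p3 /(_ ltin) p4] := col_profile ca hi'.
  have [q1 /(_ ltin) q2 q3 /(_ ltin) q4] := col_profile c2 hi'.
  rewrite (hB _ j1 j2) (hB _ ltin j3) {hU hB}.
  move: he; rewrite col_phi // col_eps //.
  case: hm => [[e]|[_ _ -> _]|[_ _ -> [t1 t2 t3]]].
  - by exfalso; clear -e ltin; lia.
  - by [].
  clear -p1 p2 p3 p4 q1 q2 q3 q4 t1 t2 t3 i0.
  move: t3 p1 p2 p3 p4 q1 q2 q3 q4; rewrite t1 (negbTE t2).
  case: (_ \in a1); case: (_ \in a1) => //= _ p1 p2 p3 p4; case: (_ \in a2);
  case: (_ \in a2) => q1 q2 q3 q4 //= h;
  clear -p1 p2 p3 p4 q1 q2 q3 q4 i0 h; split=> -[h1 h2 h3]; split; lia.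
subst b1; rewrite orbb in c1; have [ca cb _ _ [hU hB hm]] := step_local sa c2.
have [p1 /(_ ltin) p2 p3 /(_ ltin) p4] := col_profile ca hi'.
have [q1 /(_ ltin) q2 q3 /(_ ltin) q4] := col_profile c1 hi'.
rewrite (hU _ j1 j2) (hU _ ltin j3) {hU hB}.
move: he; rewrite col_phi // col_eps //.
case: hm => [[e]|[_ e1 _ [t1 t2 t3]]|[_ -> _ _]].
- by exfalso; clear -e ltin; lia.
- clear -e1 p1 p2 p3 p4 q1 q2 q3 q4 t1 t2 t3 i0.
  move: t3 p1 p2 p3 p4 q1 q2 q3 q4; rewrite t1 (negbTE t2).
  case: (2 * n - i \in a2); case: ((2 * n).+1 - i \in a2) => //= _ p1 p2 p3 p4;
  case: (2 * n - i \in a1); case: ((2 * n).+1 - i \in a1);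
  case: (i \in a1); case: (i.+1 \in a1) => q1 q2 q3 q4 //= h;
  clear -e1 p1 p2 p3 p4 q1 q2 q3 q4 i0 h; split=> -[h1 h2 h3]; split; lia.
by [].
Qed.

Lemma col_size c : col c -> size c = nU c n + nB c n.
Proof.
move=> /andP[_ /allP h]; rewrite /nU /nB -count_predUI -[size c](count_predT c).
rewrite [X in _ = _ + X](eq_in_count (a2 := pred0)) ?count_pred0 ?addn0.
  by apply: eq_in_count => x /h /=; lia.
by move=> x /h /=; lia.
Qed.

(* The diagonal instances of [cle] say that the columns are entrywise
   comparable before splitting. *)
Lemma diag_step i a1 a2 b1 b2 : size a1 = size b1 ->
  step i (a1 ++ a2) (b1 ++ b2) -> col a1 || col b1 -> col a2 || col b2 ->
  (cle a2 a1 -> nU b1 i <= nU b2 i /\ size b1 + nB b2 i <= size b2 + nB b1 i) /\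
  (cle b2 b1 -> nU a1 i <= nU a2 i /\ size a1 + nB a2 i <= size a2 + nB a1 i).
Proof.
move=> ss st c1 c2.
have hi : 0 < i <= n by move: st => [? [? [? [_ _ /phlP[-> ->]]]]].
have [[sa [e21 he]]|[e11 [sa he]]] := (step_cat _ _ _ _ ss).1 st.
  subst b2; rewrite orbb in c2; have [ca cb _ hs [hU hB hm]] := step_local sa c1.
  have [ein|ltin] : i = n \/ i < n by clear -hi; lia.
    subst i; have n0 : 0 < n by clear -hi; lia.
    move: he; rewrite col_phi_n // col_eps_n // => he.
    case: hm => [[_ u1 u2 m1 m2]|[e]|[e]]; try by exfalso; clear -e; lia.
    have := col_size c2; have := col_size ca; have := col_size cb.
    have [q1 _ q3 _] := col_profile c2 hi; have [p1 _ p3 _] := col_profile ca hi.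
    move: q1 q3 p1 p3 he; rewrite m1; have -> : (2 * n).+1 - n = n.+1 by clear; lia.
    rewrite (negbTE m2) => q1 q3 p1 p3 he s1 s2 s3.
    have hp : n.-1 <= n by clear; lia.
    split=> h; have [h1 _] := h n n (leqnn _) (leqnn _).
      by move: h1; clear -u1 u2 s1 s2 s3; lia.
    have [h2 h3] := h _ _ (leqnn _) hp.
    have r1 := hU n.-1 hp ltac:(clear -n0; lia); have r2 := hB n.-1 hp ltac:(clear -n0; lia).
    move: q1 q3 he h1 h2 h3 r1 r2; case: (n \in a2); case: (n.+1 \in a2) => //= q1 q3 _;
    clear -u1 u2 s1 s2 s3 q1 q3 p1 p3; lia.
  have h1n : i.-1 <= n by clear -hi; lia.
  have [r1 r2] : nU b1 i.-1 = nU a1 i.-1 /\ nB b1 i.-1 = nB a1 i.-1.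
    by split; [apply: hU|apply: hB] => //; clear -hi; lia.
  have [r3 r4] : nU b1 i.+1 = nU a1 i.+1 /\ nB b1 i.+1 = nB a1 i.+1.
    by split; [apply: hU|apply: hB] => //; clear; lia.
  have [p1 /(_ ltin) p2 p3 /(_ ltin) p4] := col_profile ca hi.
  have [q1 /(_ ltin) q2 q3 /(_ ltin) q4] := col_profile c2 hi.
  have hi' : 0 < i < n by clear -hi ltin; lia.
  have h2n : i <= n by clear -hi; lia.
  have h12 : i.-1 <= i by clear; lia.
  have h13 : i.-1 <= i.+1 by clear; lia.
  move: he; rewrite col_phi // col_eps //.
  case: hm => [[e]|[_ u1 u2 [t1 t2 t3]]|[_ u1 u2 [t1 t2 t3]]].
  - by exfalso; clear -e ltin; lia.
  - move: t3 p1 p2 p3 p4 q1 q2 q3 q4; rewrite t1 (negbTE t2) hs.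
    case: (2 * n - i \in a1); case: ((2 * n).+1 - i \in a1) => //= _ p1 p2 p3 p4;
    case: (2 * n - i \in a2); case: ((2 * n).+1 - i \in a2);
    case: (i \in a2); case: (i.+1 \in a2) => //= q1 q2 q3 q4 he;
    try (exfalso; clear -he; lia);
    split=> h; have [g1 g2] := h _ _ (leqnn i) h2n;
    have [g3 g4] := h _ _ (leqnn i.-1) h1n; have [g5 g6] := h _ _ (leqnn i.+1) ltin;
    have [g7 g8] := h _ _ h12 h2n; have [g9 g10] := h _ _ (leqnSn i) ltin;
    have [g11 g12] := h _ _ h13 ltin;
    clear -p1 p2 p3 p4 q1 q2 q3 q4 g1 g2 g3 g4 g5 g6 g7 g8 g9 g10 g11 g12 r1 r2 r3 r4 u1 u2 hs hi; lia.
  - move: t3 p1 p2 p3 p4 q1 q2 q3 q4; rewrite t1 (negbTE t2) hs.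
    case: (i \in a1); case: (i.+1 \in a1) => //= _ p1 p2 p3 p4;
    case: (2 * n - i \in a2); case: ((2 * n).+1 - i \in a2);
    case: (i \in a2); case: (i.+1 \in a2) => //= q1 q2 q3 q4 he;
    try (exfalso; clear -he; lia);
    split=> h; have [g1 g2] := h _ _ (leqnn i) h2n;
    have [g3 g4] := h _ _ (leqnn i.-1) h1n; have [g5 g6] := h _ _ (leqnn i.+1) ltin;
    have [g7 g8] := h _ _ h12 h2n; have [g9 g10] := h _ _ (leqnSn i) ltin;
    have [g11 g12] := h _ _ h13 ltin;
    clear -p1 p2 p3 p4 q1 q2 q3 q4 g1 g2 g3 g4 g5 g6 g7 g8 g9 g10 g11 g12 r1 r2 r3 r4 u1 u2 hs hi; lia.
subst b1; rewrite orbb in c1; have [ca cb _ hs [hU hB hm]] := step_local sa c2.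
have [ein|ltin] : i = n \/ i < n by clear -hi; lia.
  subst i; have n0 : 0 < n by clear -hi; lia.
  move: he; rewrite col_phi_n // col_eps_n // => he.
  case: hm => [[_ u1 u2 m1 m2]|[e]|[e]]; try by exfalso; clear -e; lia.
  have := col_size c1; have := col_size ca; have := col_size cb.
  have [q1 _ q3 _] := col_profile c1 hi; have [p1 _ p3 _] := col_profile ca hi.
  move: q1 q3 p1 p3 he; rewrite m1; have -> : (2 * n).+1 - n = n.+1 by clear; lia.
  rewrite (negbTE m2) => q1 q3 p1 p3 he s1 s2 s3.
  have hp : n.-1 <= n by clear; lia.
  have r1 := hU n.-1 hp ltac:(clear -n0; lia); have r2 := hB n.-1 hp ltac:(clear -n0; lia).
  split=> h; have [h1 _] := h n n (leqnn _) (leqnn _);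
    have [h2 h3] := h _ _ (leqnn _) hp;
    move: q1 q3 he h1 h2 h3 r1 r2; case: (n \in a1); case: (n.+1 \in a1) => //= q1 q3 _;
    clear -u1 u2 s1 s2 s3 q1 q3 p1 p3; lia.
have h1n : i.-1 <= n by clear -hi; lia.
have [r1 r2] : nU b2 i.-1 = nU a2 i.-1 /\ nB b2 i.-1 = nB a2 i.-1.
  by split; [apply: hU|apply: hB] => //; clear -hi; lia.
have [r3 r4] : nU b2 i.+1 = nU a2 i.+1 /\ nB b2 i.+1 = nB a2 i.+1.
  by split; [apply: hU|apply: hB] => //; clear; lia.
have [p1 /(_ ltin) p2 p3 /(_ ltin) p4] := col_profile ca hi.
have [q1 /(_ ltin) q2 q3 /(_ ltin) q4] := col_profile c1 hi.
have hi' : 0 < i < n by clear -hi ltin; lia.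
have h2n : i <= n by clear -hi; lia.
have h12 : i.-1 <= i by clear; lia.
have h13 : i.-1 <= i.+1 by clear; lia.
move: he; rewrite col_phi // col_eps //.
case: hm => [[e]|[_ u1 u2 [t1 t2 t3]]|[_ u1 u2 [t1 t2 t3]]].
- by exfalso; clear -e ltin; lia.
- move: t3 p1 p2 p3 p4 q1 q2 q3 q4; rewrite t1 (negbTE t2) hs.
  case: (2 * n - i \in a2); case: ((2 * n).+1 - i \in a2) => //= _ p1 p2 p3 p4;
  case: (2 * n - i \in a1); case: ((2 * n).+1 - i \in a1);
  case: (i \in a1); case: (i.+1 \in a1) => //= q1 q2 q3 q4 he;
  try (exfalso; clear -he; lia);
  split=> h; have [g1 g2] := h _ _ (leqnn i) h2n;
  have [g3 g4] := h _ _ (leqnn i.-1) h1n; have [g5 g6] := h _ _ (leqnn i.+1) ltin;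
  have [g7 g8] := h _ _ h12 h2n; have [g9 g10] := h _ _ (leqnSn i) ltin;
  have [g11 g12] := h _ _ h13 ltin;
  clear -p1 p2 p3 p4 q1 q2 q3 q4 g1 g2 g3 g4 g5 g6 g7 g8 g9 g10 g11 g12 r1 r2 r3 r4 u1 u2 hs hi; lia.
- move: t3 p1 p2 p3 p4 q1 q2 q3 q4; rewrite t1 (negbTE t2) hs.
  case: (i \in a2); case: (i.+1 \in a2) => //= _ p1 p2 p3 p4;
  case: (2 * n - i \in a1); case: ((2 * n).+1 - i \in a1);
  case: (i \in a1); case: (i.+1 \in a1) => //= q1 q2 q3 q4 he;
  try (exfalso; clear -he; lia);
  split=> h; have [g1 g2] := h _ _ (leqnn i) h2n;
  have [g3 g4] := h _ _ (leqnn i.-1) h1n; have [g5 g6] := h _ _ (leqnn i.+1) ltin;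
  have [g7 g8] := h _ _ h12 h2n; have [g9 g10] := h _ _ (leqnSn i) ltin;
  have [g11 g12] := h _ _ h13 ltin;
  clear -p1 p2 p3 p4 q1 q2 q3 q4 g1 g2 g3 g4 g5 g6 g7 g8 g9 g10 g11 g12 r1 r2 r3 r4 u1 u2 hs hi; lia.
Qed.

(** Each instance of [cle] compares D at [m] with the pair quantity at [k]. If i = k < m, the window
    around [k] stays at or below [m] and the minimum principle applies; if k < m = i, the window
    around [m] stays at or above [k] and the maximum principle applies, replaced for i = n by the
    unchanged letter count. Only k = m = i escapes, and it is supplied as a separate hypothesis. *)
Lemma cle_transfer i a1 a2 b1 b2 : size b1 = size a1 -> size b2 = size a2 ->
  0 < i <= n ->
  (forall m, m <= n -> m != i -> [/\ nU b1 m = nU a1 m, nB b1 m = nB a1 m,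
     nU b2 m = nU a2 m & nB b2 m = nB a2 m]) ->
  (i < n -> forall Z W,
    (forall m, i.-1 <= m <= i.+1 -> Z + m <= nU a2 m + nB a1 m + W) ->
    (forall m, i.-1 <= m <= i.+1 -> Z + m <= nU b2 m + nB b1 m + W)) ->
  (i < n -> forall Z W,
    (forall m, i.-1 <= m <= i.+1 -> nU a1 m + nB a1 m + W <= Z + m) ->
    (forall m, i.-1 <= m <= i.+1 -> nU b1 m + nB b1 m + W <= Z + m)) ->
  (i < n -> forall Z W,
    (forall m, i.-1 <= m <= i.+1 -> nU a2 m + nB a2 m + W <= Z + m) ->
    (forall m, i.-1 <= m <= i.+1 -> nU b2 m + nB b2 m + W <= Z + m)) ->
  (i = n -> nU b1 n + nB b1 n = nU a1 n + nB a1 n /\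
            nU b2 n + nB b2 n = nU a2 n + nB a2 n) ->
  nU b1 i <= nU b2 i /\ size b1 + nB b2 i <= size b2 + nB b1 i ->
  cle a2 a1 -> cle b2 b1.
Proof.
move=> s1 s2 hi un hp hd1 hd2 hn [g1 g2] h k m km mn.
have [km'|ltkm] : k = m \/ k < m by clear -km; lia.
  subst m; have [e|ki] := eqVneq k i.
    by subst k; split; [clear -g1|clear -g2]; lia.
  by have [-> -> -> ->] := un k mn ki; rewrite s1 s2; apply: h.
have kn : k <= n by clear -mn ltkm; lia.
have [e|ki] := eqVneq k i.
  have mi : m != i by clear -e ltkm; lia.
  have [e1 e2 e3 e4] := un m mn mi.
  have ltin : i < n by clear -e ltkm mn; lia.
  have w : i.-1 <= k <= i.+1 by clear -e; lia.
  rewrite e1 e2 e3 e4 s1 s2; split.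
    suff : nU a1 m + nB a1 m + k <= nU b2 k + nB b1 k + m by [].
    apply: (hp ltin) => // j hj.
    by have [] := h j m; [clear -hj e ltkm; lia|exact: mn|].
  suff : (size a1 + nU a2 m + nB a2 m) + k <= nU b2 k + nB b1 k + (size a2 + m).
    by clear; lia.
  apply: (hp ltin) => // j hj.
  have [] := h j m; [by clear -hj e ltkm; lia|exact: mn|].
  by clear; lia.
have [e1 e2 e3 e4] := un k kn ki.
have [e|mi] := eqVneq m i; last first.
  have [e5 e6 e7 e8] := un m mn mi.
  by rewrite ?e1 e2 e3 ?e4 e5 e6 e7 e8 s1 s2; apply: h.
rewrite e2 e3 s1 s2.
have [ein|ltin] : i = n \/ i < n by clear -hi; lia.
  have emn : m = n by clear -e ein; lia.
  have [q1 q2] := hn ein; have [] := h _ _ km mn; rewrite emn.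
  by clear -q1 q2; lia.
have w : i.-1 <= m <= i.+1 by clear -e; lia.
split.
  suff : nU b1 m + nB b1 m + k <= (nU a2 k + nB a1 k) + m by [].
  apply: (hd1 ltin) => // j hj.
  by have [] := h k j; [clear -hj e ltkm; lia|clear -hj ltin; lia|].
suff : nU b2 m + nB b2 m + (size a1 + k) <= (size a2 + nB a1 k + nU a2 k) + m.
  by clear; lia.
apply: (hd2 ltin) => // j hj.
have [] := h k j; [by clear -hj e ltkm; lia|by clear -hj ltin; lia|].
by clear; lia.
Qed.

Lemma cle_step i a1 a2 b1 b2 : size a1 = size b1 ->
  step i (a1 ++ a2) (b1 ++ b2) -> col a1 || col b1 -> col a2 || col b2 ->
  cle a2 a1 <-> cle b2 b1.
Proof.
move=> ss st c1 c2; have [D1 D2] := diag_step ss st c1 c2.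
have st' := st; have hi : 0 < i <= n by move: st => [? [? [? [_ _ /phlP[-> ->]]]]].
have [[sa [e21 he]]|[e11 [sa he]]] := (step_cat _ _ _ _ ss).1 st.
  subst b2; have [ca cb _ hs [hU hB hm]] := step_local sa c1.
  have hn : i = n -> nU b1 n + nB b1 n = nU a1 n + nB a1 n.
    by case: hm => [[_ u1 u2 _ _]|[e]|[e]] => [_|h|h];
      [clear -u1 u2|clear -e h|clear -e h]; lia.
  split=> h; [have g := D1 h|have g := D2 h]; apply: (cle_transfer _ _ hi _ _ _ _ _ g h) => //.
  - by move=> m hm1 hm2; split=> //; [apply: hU|apply: hB].
  - by move=> ltin Z W; apply: (pair_step Z W ss st c1 c2 ltin).1.
  - by move=> ltin Z W; apply: (defect_step Z W sa c1 ltin).1.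
  - by move=> ein; split=> //; apply: hn.
  - by move=> m hm1 hm2; split=> //; symmetry; [apply: hU|apply: hB].
  - by move=> ltin Z W; apply: (pair_step Z W ss st c1 c2 ltin).2.
  - by move=> ltin Z W; apply: (defect_step Z W sa c1 ltin).2.
  - by move=> ein; split=> //; symmetry; apply: hn.
subst b1; have [ca cb _ hs [hU hB hm]] := step_local sa c2.
have hn : i = n -> nU b2 n + nB b2 n = nU a2 n + nB a2 n.
  by case: hm => [[_ u1 u2 _ _]|[e]|[e]] => [_|h|h]; [clear -u1 u2|clear -e h|clear -e h]; lia.
split=> h; [have g := D1 h|have g := D2 h]; apply: (cle_transfer _ _ hi _ _ _ _ _ g h) => //.
- by move=> m hm1 hm2; split=> //; [apply: hU|apply: hB].
- by move=> ltin Z W; apply: (pair_step Z W ss st c1 c2 ltin).1.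
- by move=> ltin Z W; apply: (defect_step Z W sa c2 ltin).1.
- by move=> ein; split=> //; apply: hn.
- by move=> m hm1 hm2; split=> //; symmetry; [apply: hU|apply: hB].
- by move=> ltin Z W; apply: (pair_step Z W ss st c1 c2 ltin).2.
- by move=> ltin Z W; apply: (defect_step Z W sa c2 ltin).2.
- by move=> ein; split=> //; symmetry; apply: hn.
Qed.

End Stability.

(** * Knuth relations *)

Section Knuth.
Variable n : nat.
Local Notation phi := (phi n).
Local Notation eps := (eps n).
Local Notation fop := (fop n).
Local Notation eop := (eop n).

(* [a b c ~ d e f]: the first two families are Knuth's relations, which fail when
   the extreme letters form a pair [x, bar x]; the last two replace them there
   (Lecouvey's R2). *)
Definition knuth_letters (a b c d e f : nat) : Prop :=
  [\/ [/\ d = a, e = c, f = b, c <= a < b & b + c != (2 * n).+1],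
      [/\ d = b, e = a, f = c, a < c <= b & a + b != (2 * n).+1],
      [/\ d = a, e = c.+1, f.+1 = b, c < a < b & b + c == (2 * n).+1] |
      [/\ d = b.+1, e.+1 = a, f = c, a <= c <= b & (a + b == (2 * n).+1) && (1 < a)]].

Definition knuth (u v : seq nat) : Prop :=
  exists a b c d e f, [/\ u = [:: a; b; c], v = [:: d; e; f],
     [&& 0 < a <= 2 * n, 0 < b <= 2 * n & 0 < c <= 2 * n] & knuth_letters a b c d e f].

Lemma letterP i a : 0 < i <= n ->
  [\/ phl n i a /\ (a = i \/ a = 2 * n - i), epl n i a /\ (a = i.+1 \/ a = (2 * n).+1 - i)
   | [/\ phl n i a = false, epl n i a = false, a <> i & [/\ a <> 2 * n - i, a <> i.+1 & a <> (2 * n).+1 - i]]].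
Proof.
move=> hi; case: (boolP (phl n i a)) => h; first by apply: Or31; case: (phlP h).
case: (boolP (epl n i a)) => h2; first by apply: Or32; split=> //; move: h2;
  rewrite /epl hi /=; clear; lia.
by apply: Or33; split=> //; try split; move: h h2; rewrite /phl /epl hi /=; clear; lia.
Qed.

Ltac letter_cases hi a :=
  let p := fresh "p" in let e := fresh "e" in
  let h := fresh "h" in let h1 := fresh "h" in let h2 := fresh "h" in
  let h3 := fresh "h" in
  case: (letterP a hi) => [[p h]|[e h]|[p e h [h1 h2 h3]]];
  rewrite ?p ?e ?(phl_epl p) ?(epl_phl e).

Ltac knuth_solve :=
  repeat match goal with
    | h : is_true (phl _ _ _) |- _ => clear h
    | h : is_true (epl _ _ _) |- _ => clear h
    | h : _ = false |- _ => clear h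
    | h : is_true (0 < _ + _) |- _ => clear h
    | h : _ \/ _ |- _ => destruct h
    end;
  repeat match goal with h : ?x = _ |- _ => subst x end;
  try (exfalso; lia);
  (eexists _, _, _, _, _, _; split; [reflexivity|reflexivity|lia|]);
  first [ (apply: Or41; split; (reflexivity || lia))
        | (apply: Or42; split; (reflexivity || lia))
        | (apply: Or43; split; (reflexivity || lia))
        | (apply: Or44; split; (reflexivity || lia)) ].

Definition compat i u v :=
  [/\ phi i u = phi i v, eps i u = eps i v,
      0 < phi i u -> knuth (fop i u) (fop i v)
    & 0 < eps i u -> knuth (eop i u) (eop i v)].

Lemma knuth1 i x y z : 0 < i <= n -> 0 < x -> z <= 2 * n -> x <= y < z ->
  z + x != (2 * n).+1 -> compat i [:: y; z; x] [:: y; x; z].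
Proof.
move=> hi x0 zn xyz xz; rewrite /compat /=.
letter_cases hi x; letter_cases hi y; letter_cases hi z; move=> /=; split;
  try (by []); try (clear; lia); intros; knuth_solve.
Qed.

Lemma knuth2 i x y z : 0 < i <= n -> 0 < x -> z <= 2 * n -> x < y <= z ->
  x + z != (2 * n).+1 -> compat i [:: x; z; y] [:: z; x; y].
Proof.
move=> hi x0 zn xyz xz; rewrite /compat /=.
letter_cases hi x; letter_cases hi y; letter_cases hi z; move=> /=; split;
  try (by []); try (clear; lia); intros; knuth_solve.
Qed.

(** Here [z] and [z.+1] are the bars of x+1 and x, so that a case analysis on x and x+1 settles all
    four letters. *)
Lemma mirror_letters i x z : z + x = 2 * n ->
  [/\ phl n i z.+1 = epl n i x, epl n i z.+1 = phl n i x,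
      phl n i z = phl n i x & epl n i z = phl n i x.+1].
Proof. by move=> h; split; rewrite /phl /epl; lia. Qed.

Lemma knuth3 i x y z : 0 < i <= n -> 0 < x -> z <= 2 * n -> x < y < z.+1 ->
  z.+1 + x = (2 * n).+1 -> compat i [:: y; z.+1; x] [:: y; x.+1; z].
Proof.
move=> hi x0 zn xyz xz; rewrite /compat /=; have xz2 : z + x = 2 * n by lia.
have [-> -> -> ->] := mirror_letters i xz2; rewrite -!phl_eplS.
case: (letterP x.+1 hi) => [[p h]|[e h]|[p e h [h1 h2 h3]]].
- rewrite p; letter_cases hi x; letter_cases hi y; move=> /=; split; try (by []);
  try (clear; lia); intros; knuth_solve.
- rewrite (epl_phl e); move: (e); rewrite -phl_eplS => q; rewrite q (phl_epl q).
  letter_cases hi y; move=> /=; split; try (by []); try (clear; lia); intros; knuth_solve.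
move: (e); rewrite -phl_eplS => q; rewrite q p.
letter_cases hi x; letter_cases hi y; move=> /=; split; try (by []); try (clear; lia);
  intros; knuth_solve.
Qed.

Lemma knuth4 i x y z : 0 < i <= n -> 0 < x -> z <= 2 * n -> x.+1 <= y <= z ->
  x.+1 + z = (2 * n).+1 -> compat i [:: x.+1; z; y] [:: z.+1; x; y].
Proof.
move=> hi x0 zn xyz xz; rewrite /compat /=; have xz2 : z + x = 2 * n by lia.
have [-> -> -> ->] := mirror_letters i xz2; rewrite -!phl_eplS.
case: (letterP x.+1 hi) => [[p h]|[e h]|[p e h [h1 h2 h3]]].
- rewrite p; letter_cases hi x; letter_cases hi y; move=> /=; split; try (by []);
  try (clear; lia); intros; knuth_solve.
- rewrite (epl_phl e); move: (e); rewrite -phl_eplS => q; rewrite q (phl_epl q).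
  letter_cases hi y; move=> /=; split; try (by []); try (clear; lia); intros; knuth_solve.
move: (e); rewrite -phl_eplS => q; rewrite q p.
letter_cases hi x; letter_cases hi y; move=> /=; split; try (by []); try (clear; lia);
  intros; knuth_solve.
Qed.

Lemma weights_out i w : ~~ (0 < i <= n) -> phi i w = 0 /\ eps i w = 0.
Proof.
move=> hi; elim: w => //= a w [-> ->].
by rewrite /phl /epl (negbTE hi).
Qed.

(** The four families must be treated together: an operator can turn the extreme letters of a Knuth
    triple into a pair x, bar x, and the triple then passes to one of the last two families. *)
Lemma knuth_map : crystal_map n knuth.
Proof.
move=> u v [a [b [c [d [e [f [-> -> hr hk]]]]]]] i.
case: (boolP (0 < i <= n)) => hi; last first.
  by have [-> ->] := weights_out [:: a; b; c] hi; have [-> ->] := weights_out [:: d; e; f] hi.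
case: hk => [] [ed ee ef h1 h2].
- by rewrite ed ee ef; apply: knuth1; lia.
- by rewrite ed ee ef; apply: knuth2; lia.
- by rewrite ed ee -ef; apply: knuth3; lia.
by rewrite ed -ee ef; apply: knuth4; lia.
Qed.

Lemma knuth_functional : functional_rel knuth.
Proof.
move=> u v v' [a [b [c [d [e [f [-> -> hr hk]]]]]]].
move=> [a' [b' [c' [d' [e' [f' [[<- <- <-] -> hr' hk']]]]]]].
suff [-> -> ->] : [/\ d = d', e = e' & f = f'] by [].
by case: hk => -[h1 h2 h3 h4 h5]; case: hk' => -[g1 g2 g3 g4 g5];
  clear -h1 h2 h3 h4 h5 g1 g2 g3 g4 g5 hr; split; lia.
Qed.

Lemma knuth_injective : functional_rel (flip_rel knuth).
Proof.
move=> v u u' [a [b [c [d [e [f [-> -> hr hk]]]]]]].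
move=> [a' [b' [c' [d' [e' [f' [-> [ed ee ef] hr' hk']]]]]]].
suff [-> -> ->] : [/\ a = a', b = b' & c = c'] by [].
subst d' e' f'.
by case: hk => -[h1 h2 h3 h4 h5]; case: hk' => -[g1 g2 g3 g4 g5];
  clear -h1 h2 h3 h4 h5 g1 g2 g3 g4 g5 hr hr'; split; lia.
Qed.

(** Only this family is applied later, to unbarred letters; the others close the relation under the
    operators. *)
Lemma knuth_crys x y z : 0 < x -> z <= 2 * n -> x <= y < z ->
  x + z != (2 * n).+1 -> crys n [:: y; z; x] [:: y; x; z].
Proof.
move=> x0 zn xyz xz; apply: (crys_of_map knuth_map knuth_functional knuth_injective).
exists y, z, x, y, x, z; split=> //; first lia.
by apply: Or41; split=> //; rewrite addnC.
Qed.

End Knuth.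

(** * Contraction of a column *)

Section Contraction.
Variable n : nat.
Local Notation phi := (phi n).
Local Notation eps := (eps n).
Local Notation fop := (fop n).
Local Notation eop := (eop n).
Local Notation step := (step n).
Local Notation col := (col n).
Local Notation nB := (nB n).
Local Notation bnd := (bnd n).
Local Notation bar x := ((2 * n).+1 - x).

Lemma col_eq c d : col c -> col d -> c =i d -> c = d.
Proof. by move=> /andP[sc _] /andP[sd _]; apply: (irr_sorted_eq ltn_trans ltnn). Qed.

(* [c] is obtained from [c'] by adding a pair [z, bar z]; the position [z] is
   the first one at which [c] has too many letters. *)
Definition pair_at (c c' : seq nat) (z : nat) : Prop :=
  [/\ forall y, (y \in c) = [|| y \in c', y == z | y == bar z],
      z \notin c' & bar z \notin c'].

(** Together with [bnd c'], the first clause makes z the first index at which the column with the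
    pair added violates the bound, so [c] determines z. The second makes z-1 the last index at which
    [c'] attains the bound, so [c'] determines z as well. *)
Definition tight (c' : seq nat) (z : nat) : Prop :=
  nU c' z.-1 + nB c' z.-1 = z.-1 /\
  (forall m, z <= m -> m <= n -> nU c' m + nB c' m < m).

Definition contr (c c' : seq nat) : Prop :=
  [/\ col c, col c', bnd c' & exists z, [/\ 0 < z <= n, pair_at c c' z & tight c' z]].

Lemma pair_counts c c' z : col c -> col c' -> 0 < z <= n -> pair_at c c' z ->
  forall m, m <= n -> nU c m = nU c' m + (z <= m) /\ nB c m = nB c' m + (z <= m).
Proof.
move=> hc hc' hz [hm h1 h2]; elim=> [|m IH] hmn.
  by rewrite (nU0 hc) (nU0 hc') !nB0 //; clear -hz; lia.
have [e1 e2] := IH (ltnW hmn).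
have hm2 : m < 2 * n by clear -hmn; lia.
rewrite (nUS m hc) (nUS m hc') !nBS // e1 e2 !hm.
have [ez|nz] := eqVneq z m.+1.
  have -> : 2 * n - m = bar z by clear -ez hmn; lia.
  rewrite -ez (negbTE h1) (negbTE h2) /= !eqxx orbT /=; clear -ez; lia.
have -> : (m.+1 == bar z) = false by clear -hz hmn; lia.
have -> : (2 * n - m == z) = false by clear -hz hmn; lia.
have -> : (2 * n - m == bar z) = false by clear -nz hz hmn; lia.
have -> : (z <= m.+1) = (z <= m) by clear -nz; lia.
by rewrite !orbF; split; rewrite addnAC.
Qed.

Lemma contr_functional : functional_rel contr.
Proof.
move=> c c1 c2 [hc h1 b1 [z1 [hz1 p1 [t1 s1]]]] [_ h2 b2 [z2 [hz2 p2 [t2 s2]]]].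
have lem c1' c2' z z' : col c1' -> col c2' -> 0 < z <= n -> 0 < z' <= n ->
   pair_at c c1' z -> pair_at c c2' z' -> bnd c2' ->
   nU c1' z.-1 + nB c1' z.-1 = z.-1 -> ~~ (z < z').
  move=> k1 k2 hz hz' q1 q2 b t; apply/negP => ltz.
  have zn : z <= n by clear -hz; lia.
  have [e1 e2] := pair_counts hc k1 hz q1 zn; have [e3 e4] := pair_counts hc k2 hz' q2 zn.
  have := b z zn; have [g1 _ g3 _] := col_profile k1 hz.
  move: g1 g3; case: q1 => _ /negbTE -> /negbTE ->.
  by clear -t e1 e2 e3 e4 ltz hz; lia.
have ez : z1 = z2.
  have := lem _ _ _ _ h1 h2 hz1 hz2 p1 p2 b2 t1; have := lem _ _ _ _ h2 h1 hz2 hz1 p2 p1 b1 t2.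
  by clear; lia.
subst z2; apply: col_eq => // y; case: p1 => [m1 n1 n1']; case: p2 => [m2 n2 n2'].
have := m2 y; rewrite m1.
have [->|ny] := eqVneq y z1; first by rewrite (negbTE n1) (negbTE n2).
have [->|ny'] := eqVneq y (bar z1); first by rewrite (negbTE n1') (negbTE n2').
by rewrite !orbF.
Qed.

Lemma contr_injective : functional_rel (flip_rel contr).
Proof.
move=> c c1 c2 [h1 hc b1 [z1 [hz1 p1 [t1 s1]]]] [h2 _ b2 [z2 [hz2 p2 [t2 s2]]]].
have ez : z1 = z2.
  have [lt|[lt|//]] : z1 < z2 \/ z2 < z1 \/ z1 = z2 by clear; lia.
    have := s1 z2.-1; rewrite t2; clear -lt hz2; lia.
  have := s2 z1.-1; rewrite t1; clear -lt hz1; lia.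
subst z2; apply: col_eq => // y; case: p1 => [m1 _ _]; case: p2 => [m2 _ _].
by rewrite m1 m2.
Qed.

Lemma col_move_inj i x x' c : 0 < i <= n ->
  col_move n i x c -> col_move n i x' c -> x = x'.
Proof.
move=> hi; rewrite /col_move.
case/orP => [/and4P[/eqP -> -> /negbTE -> h]|/and5P[/eqP -> ltin -> /negbTE -> h]];
case/orP => [/and4P[/eqP -> h1 h2 h3]|/and5P[/eqP -> h1 h2 h3 h4]] //.
by rewrite h1 (negbTE h2) in h.
Qed.

Definition col_back (i x : nat) (c : seq nat) : bool :=
  [&& x == i, i.+1 \in c, i \notin c
    & (i < n) ==> ((2 * n - i \in c) || (bar i \notin c))] ||
  [&& x == 2 * n - i, i < n, bar i \in c, 2 * n - i \notin c
    & (i \in c) ==> (i.+1 \in c)].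

Lemma step_col_back i a b : step i a b -> col a || col b ->
  exists x, [/\ col a, col b, 0 < i <= n, col_back i x b &
     forall y, (y \in a) = (y == x) || ((y \in b) && (y != x.+1))].
Proof.
move=> sab hab; have [x [ca cb hi hm [mem _ _ _]]] := step_col sab hab.
exists x.
have xa : x \in a by case/orP: hm => /and3P[/eqP ->] // _ /and3P[].
have xb : x.+1 \notin a.
  case/orP: hm => [/and4P[/eqP ->] //|/and5P[/eqP -> ltin _ + _]].
  by have -> : (2 * n - i).+1 = bar i by clear -ltin; lia.
split=> //; last first.
  move=> y; rewrite mem; have [->|ny] := eqVneq y x; first by rewrite xa.
  have [->|ny'] := eqVneq y x.+1; first by rewrite (negbTE xb) andbF.
  by rewrite /= !andbT.
case/orP: hm => [/and4P[/eqP ex h1 h2 h3]|/and5P[/eqP ex ltin h1 h2 h3]]; apply/orP.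
  left; rewrite ex !mem ex !eqxx /= andbF orbF.
  have -> : (i == i.+1) = false by clear; lia.
  rewrite /=; apply/implyP => ltin; move: h3; rewrite ltin /=.
  have -> : (2 * n - i == i.+1) = false by clear -ltin; lia.
  have -> : (2 * n - i == i) = false by clear -ltin; lia.
  have -> : (bar i == i.+1) = false by clear -ltin; lia.
  have -> : (bar i == i) = false by clear -ltin hi; lia.
  by rewrite /= !andbT.
right; rewrite ex ltin !mem ex eqxx /=.
have -> : bar i == (2 * n - i).+1 by clear -ltin; lia.
have -> : (2 * n - i == (2 * n - i).+1) = false by clear; lia.
have -> : (i == (2 * n - i).+1) = false by clear -ltin; lia.
have -> : (i.+1 == (2 * n - i).+1) = false by clear -ltin; lia.
have -> : (i == 2 * n - i) = false by clear -ltin; lia.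
have -> : (i.+1 == 2 * n - i) = false by clear -ltin; lia.
by rewrite ?eqxx andbF /= !andbT.
Qed.

Lemma col_back_inj i x x' c : 0 < i <= n ->
  col_back i x c -> col_back i x' c -> x = x'.
Proof.
move=> hi; rewrite /col_back.
case/orP => [/and4P[/eqP -> a1 a2 a3]|/and5P[/eqP -> a0 a1 a2 a3]];
case/orP => [/and4P[/eqP -> b1 b2 b3]|/and5P[/eqP -> b0 b1 b2 b3]] //.
- by move: a3; rewrite b0 b1 (negbTE b2).
by move: b3; rewrite a0 a1 (negbTE a2).
Qed.

Lemma pair_bits c c' z i : 0 < i <= n -> 0 < z <= n -> pair_at c c' z ->
  z != i -> z != i.+1 ->
  [/\ (i \in c) = (i \in c'), (i.+1 \in c) = (i.+1 \in c'),
      (2 * n - i \in c) = (2 * n - i \in c') & (bar i \in c) = (bar i \in c')].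
Proof.
move=> hi hz [h _ _] z1 z2; rewrite !h.
have -> : (i == z) = false by clear -z1; lia.
have -> : (i.+1 == z) = false by clear -z2; lia.
have -> : (i == bar z) = false by clear -hi hz; lia.
have -> : (2 * n - i == bar z) = false by clear -z2 hz hi; lia.
have -> : (bar i == bar z) = false by clear -hi hz z1; lia.
have -> : (bar i == z) = false by clear -hi hz; lia.
have [ein|ltin] : i = n \/ i < n by clear -hi; lia.
  have -> : (2 * n - i == z) = false by clear -z1 ein; lia.
  have -> : (i.+1 == bar z) = false by clear -z1 hz ein; lia.
  by rewrite !orbF.
have -> : (2 * n - i == z) = false by clear -hz ltin; lia.
have -> : (i.+1 == bar z) = false by clear -hz ltin; lia.
by rewrite !orbF.
Qed.

(** The bound is attained at i-1, the index i adds nothing, and strictness at i+1 leaves room for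
    one letter only. *)
Lemma contr_bits_l c c' i : contr c c' -> i < n -> 0 < i -> pair_at c c' i -> tight c' i ->
  [/\ i \notin c', bar i \notin c', i \in c, bar i \in c &
   [/\ (i.+1 \in c) = (i.+1 \in c'), (2 * n - i \in c) = (2 * n - i \in c')
     & ~~ ((i.+1 \in c') && (2 * n - i \in c'))]].
Proof.
move=> [hc hc' hb _] ltin i0 [m h1 h2] [t1 t2].
split=> //; rewrite ?m ?eqxx ?orbT //; split.
- have -> : (i.+1 == i) = false by clear; lia.
  by have -> : (i.+1 == bar i) = false by [clear -ltin; lia]; rewrite !orbF.
- have -> : (2 * n - i == i) = false by clear -ltin; lia.
  by have -> : (2 * n - i == bar i) = false by [clear -ltin i0; lia]; rewrite !orbF.
have hi : 0 < i <= n by clear -ltin i0; lia.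
have [q1 /(_ ltin) q2 q3 /(_ ltin) q4] := col_profile hc' hi.
have := t2 i.+1 (leqnSn i) ltin; move: t1 q1 q2 q3 q4.
rewrite (negbTE h1) (negbTE h2).
by case: (i.+1 \in c'); case: (2 * n - i \in c') => //= t1 q1 q2 q3 q4;
  clear -t1 q1 q2 q3 q4 i0; lia.
Qed.

(** The bound is attained at i while the count at i-1 is at most i-1, so the index i must contribute
    a letter. *)
Lemma contr_bits_r c c' i : contr c c' -> i < n -> 0 < i ->
  pair_at c c' i.+1 -> tight c' i.+1 ->
  [/\ i.+1 \notin c', 2 * n - i \notin c', i.+1 \in c, 2 * n - i \in c &
   [/\ (i \in c) = (i \in c'), (bar i \in c) = (bar i \in c')
     & (i \in c') || (bar i \in c')]].
Proof.
move=> [hc hc' hb _] ltin i0 [m h1 h2] [t1 t2].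
have e : bar i.+1 = 2 * n - i by clear; lia.
rewrite e in h2; split=> //; rewrite ?m ?e ?eqxx ?orbT //; split.
- have -> : (i == i.+1) = false by clear; lia.
  by have -> : (i == 2 * n - i) = false by [clear -ltin; lia]; rewrite !orbF.
- have -> : (bar i == i.+1) = false by clear -ltin; lia.
  by have -> : (bar i == 2 * n - i) = false by [clear -ltin i0; lia]; rewrite !orbF.
have hi : 0 < i <= n by clear -ltin i0; lia.
have [q1 _ q3 _] := col_profile hc' hi.
have hi1 : i.-1 <= n by clear -ltin; lia.
have := hb i.-1 hi1; move: t1 q1 q3.
by case: (i \in c'); case: (bar i \in c') => //= t1 q1 q3; clear -t1 q1 q3 i0; lia.
Qed.

Lemma contr_weights c c' i : contr c c' -> phi i c = phi i c' /\ eps i c = eps i c'.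
Proof.
move=> h; case: (boolP (0 < i <= n)) => hi; last first.
  by have [-> ->] := weights_out c hi; have [-> ->] := weights_out c' hi.
case: (h) => hc hc' hb [z [hz hp ht]].
have [ein|ltin] : i = n \/ i < n by clear -hi; lia.
  have n0 : 0 < n by clear -hz; lia.
  rewrite ein !col_phi_n // !col_eps_n //.
  have [ez|nz] := eqVneq z n.
    case: hp => m h1 h2; rewrite !m ez.
    have e : bar n = n.+1 by clear; lia.
    by move: h1 h2; rewrite ez e !eqxx !orbT => /negbTE -> /negbTE ->.
  have nz' : z != n.+1 by clear -hz; lia.
  have hn : 0 < n <= n by rewrite n0 leqnn.
  by have [-> -> _ _] := pair_bits hn hz hp nz nz'.
have hi' : 0 < i < n by clear -hi ltin; lia.
have i0 : 0 < i by clear -hi; lia.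
rewrite !col_phi // !col_eps //.
have [ez|nz] := eqVneq z i.
  rewrite ez in hp ht.
  have [/negbTE -> /negbTE -> -> -> [-> ->]] := contr_bits_l h ltin i0 hp ht.
  by case: (i.+1 \in c'); case: (2 * n - i \in c').
have [ez|nz'] := eqVneq z i.+1.
  rewrite ez in hp ht.
  have [/negbTE -> /negbTE -> -> -> [-> ->]] := contr_bits_r h ltin i0 hp ht.
  by case: (i \in c'); case: (bar i \in c').
by have [-> -> -> ->] := pair_bits hi hz hp nz nz'.
Qed.

Lemma tight_far a b i z : step i a b -> col a || col b -> z != i -> z != i.+1 ->
  0 < z <= n -> tight a z <-> tight b z.
Proof.
move=> sab hab z1 z2 hz; have [ca cb hi _ [hU hB hm]] := step_local sab hab.
have zp : z.-1 <= n by clear -hz; lia.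
have zi : z.-1 != i by clear -z2 hz; lia.
have eq1 : nU b z.-1 + nB b z.-1 = nU a z.-1 + nB a z.-1 by rewrite hU ?hB.
have far m : m <= n -> m != i -> nU b m + nB b m = nU a m + nB a m.
  by move=> mn mi; rewrite hU ?hB.
have [ein|ltin] : i = n \/ i < n by clear -hi; lia.
  have near : nU b n + nB b n = nU a n + nB a n.
    by case: hm => [[_ u1 u2 _ _]|[e]|[e]]; [clear -u1 u2; lia| |];
       exfalso; clear -e ein; lia.
  rewrite /tight eq1; split=> -[-> h]; split=> // m zm mn.
    have [->|mi] := eqVneq m n; first by rewrite near; apply: h => //; clear -hz; lia.
    by rewrite far //; [apply: h|rewrite ein].
  have [->|mi] := eqVneq m n; first by rewrite -near; apply: h => //; clear -hz; lia.
  by rewrite -far //; [apply: h|rewrite ein].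
(* The constant 1 encodes the strict inequality in [tight]. *)
have [D1 D2] := defect_step 0 1 sab hab ltin.
rewrite /tight eq1; split=> -[-> h]; split=> // m zm mn.
  have [em|mi] := eqVneq m i; last by rewrite far //; apply: h.
  rewrite -addn1 -[leqRHS]add0n; apply: D1 => [j hj|]; last by clear -em; lia.
  by rewrite addn1; apply: h; [clear -hj em zm z1|clear -hj ltin]; lia.
have [em|mi] := eqVneq m i; last by rewrite -far //; apply: h.
rewrite -addn1 -[leqRHS]add0n; apply: D2 => [j hj|]; last by clear -em; lia.
by rewrite addn1; apply: h; [clear -hj em zm z1|clear -hj ltin]; lia.
Qed.

(** Far from the pair the same letter moves in both columns. If z = i, then i moves in [c] but the
    bar of i+1 moves in [c'], and the extra pair becomes the one at i+1; if z = i+1, the roles are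
    exchanged and the pair goes to i. *)
Lemma contr_fop c c' i : contr c c' -> 0 < phi i c -> contr (fop i c) (fop i c').
Proof.
move=> h hp0; have [ew _] := contr_weights i h; have hp0' := hp0; rewrite ew in hp0'.
have [hc hc' hb [z [hz hp ht]]] := h.
have s := step_fop hp0; have s' := step_fop hp0'.
have [x [_ cb hi mv [mem _ _ _]]] := step_col s (introT orP (or_introl hc)).
have [x' [_ cb' _ mv' [mem' _ _ _]]] := step_col s' (introT orP (or_introl hc')).
have hb' : bnd (fop i c') by apply/(bnd_step s' (introT orP (or_introl hc'))).
have [_ _ _ _ [hU hB hm]] := step_local s' (introT orP (or_introl hc')).
have i0 : 0 < i by clear -hi; lia.
split=> //.
have [ez|nz] := eqVneq z i.
  rewrite ez in hp ht hz.
  have [ein|ltin] : i = n \/ i < n by clear -hi; lia.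
    have n0 : 0 < n by clear -hz ein; lia.
    by move: hp0'; rewrite ein col_phi_n //; case: hp => _ /negbTE; rewrite ein => ->.
  have [b1 b2 b3 b4 [b5 b6 b7]] := contr_bits_l h ltin i0 hp ht.
  have ex' : x' = 2 * n - i.
    by move: mv'; rewrite /col_move (negbTE b1) /= andbF /= => /and3P[/eqP].
  have ex : x = i.
    move: mv; rewrite /col_move b4 /= !andbF orbF => /andP[/eqP //].
  have [m2 m1] : 2 * n - i \in c' /\ i.+1 \notin c'.
    move: mv'; rewrite /col_move (negbTE b1) /= andbF /= => /and4P[_ _ h1 _].
    by split=> //; move: b7; rewrite h1 andbT.
  exists i.+1; split; first by clear -ltin; lia.
    have e1 : bar i.+1 = 2 * n - i by clear; lia.
    have e2 : (2 * n - i).+1 = bar i by clear -ltin; lia.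
    case: hp => hmem _ _; split.
    - move=> y; rewrite mem mem' hmem ex ex' e1 e2.
      have [->|y1] := eqVneq y i; first by rewrite (negbTE b1) /=; clear -ltin; lia.
      have [->|y2] := eqVneq y (2 * n - i); first by rewrite m2 /= !orbT.
      by rewrite !andbT; clear; case: (y \in c'); case: (y == i.+1); case: (y == bar i).
    - rewrite mem' ex' e2 (negbTE m1) /= orbF; clear -ltin; lia.
    rewrite mem' ex' e2 e1 eqxx andbF orbF; clear -ltin; lia.
  case: ht => t1 t2; case: hm => [[e]|[_ _ _ [e]]|[_ u1 u2 _]].
  - by exfalso; clear -e ltin; lia.
  - by rewrite (negbTE b1) in e.
  split=> [|m im mn] /=; last first.
    have mi : m != i by clear -im; lia.
    by rewrite hU ?hB //; apply: t2 => //; apply: ltnW.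
  rewrite u1 u2; have := t2 i (leqnn i) (ltnW ltin).
  have [q1 _ q3 _] := col_profile hc' hi; move: q1 q3.
  rewrite (negbTE b1) (negbTE b2) !addn0 => -> ->.
  by move: t1; clear -i0; lia.
have [ez|nz'] := eqVneq z i.+1.
  rewrite ez in hp ht hz.
  have ltin : i < n by clear -hz; lia.
  have [b1 b2 b3 b4 [b5 b6 b7]] := contr_bits_r h ltin i0 hp ht.
  have ex' : x' = i.
    by move: mv'; rewrite /col_move (negbTE b2) /= !andbF orbF => /andP[/eqP].
  have ex : x = 2 * n - i.
    by move: mv; rewrite /col_move b3 /= !andbF /= => /andP[/eqP].
  have [m1 m2] : i \in c' /\ bar i \notin c'.
    move: mv'; rewrite /col_move (negbTE b2) /= !andbF orbF => /and4P[_ h1 _].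
    by rewrite ltin.
  exists i; split; first by [].
    have e1 : bar i.+1 = 2 * n - i by clear; lia.
    have e2 : (2 * n - i).+1 = bar i by clear -ltin; lia.
    case: hp => hmem _ _; split.
    - move=> y; rewrite mem mem' hmem ex ex' e1 e2.
      have [->|y1] := eqVneq y (2 * n - i); first by rewrite (negbTE b2) /= !andbF /=;
        clear -ltin; lia.
      have [->|y2] := eqVneq y i; first by rewrite m1 /= !orbT.
      by rewrite !andbT; clear; case: (y \in c'); case: (y == i.+1); case: (y == bar i).
    - rewrite mem' ex' eqxx andbF orbF; clear; lia.
    rewrite mem' ex' (negbTE m2) /= orbF; clear -ltin; lia.
  case: ht => t1 t2; case: hm => [[e]|[_ u1 u2 _]|[_ _ _ [e]]].
  - by exfalso; clear -e ltin; lia.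
  - move: t1 => /= t1.
    have hi1 : i.-1 <= n by clear -ltin; lia.
    have hi2 : i.-1 != i by clear -i0; lia.
    have [q1 _ q3 _] := col_profile hc' hi; move: q1 q3; rewrite m1 (negbTE m2) => q1 q3.
    split; first by rewrite hU // hB //; clear -q1 q3 t1 i0; lia.
    move=> m im mn; have [->|mi] := eqVneq m i.
      by rewrite u2; clear -u1 t1; lia.
    by rewrite hU ?hB //; apply: t2 => //; rewrite ltn_neqAle eq_sym mi.
  by rewrite (negbTE b2) in e.
exists z; split=> //; last first.
  by apply/(tight_far s' (introT orP (or_introl hc')) nz nz' hz).
have [e1 e2 e3 e4] := pair_bits hi hz hp nz nz'.
have exx : x = x'.
  by apply: (col_move_inj hi _ mv'); move: mv; rewrite /col_move e1 e2 e3 e4.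
case: hp => hmem h1 h2.
have xz : [/\ z != x', bar z != x', z != x'.+1 & bar z != x'.+1].
  have hx : x' = i \/ (x' = 2 * n - i /\ i < n).
    by case/orP: mv' => [/andP[/eqP]|/and3P[/eqP]]; auto.
  by split; clear -hx hz hi nz nz'; lia.
case: xz => x1 x2 x3 x4.
split.
- move=> y; rewrite mem mem' hmem exx.
  have [->|y1] := eqVneq y z; first by rewrite x1 /= !orbT.
  have [->|y2] := eqVneq y (bar z); first by rewrite x2 /= !orbT.
  by rewrite !orbF.
- by rewrite mem' (negbTE h1) (negbTE x3).
by rewrite mem' (negbTE h2) (negbTE x4).
Qed.

Lemma contr_eop c c' i : contr c c' -> 0 < eps i c -> contr (eop i c) (eop i c').
Proof.
move=> h hp0; have [_ ew] := contr_weights i h; have hp0' := hp0; rewrite ew in hp0'.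
have [hc hc' hb [z [hz hp ht]]] := h.
have s := step_eop hp0; have s' := step_eop hp0'.
have or1 := introT orP (or_intror hc : col (eop i c) \/ col c).
have or2 := introT orP (or_intror hc' : col (eop i c') \/ col c').
have [x [ca _ hi mv mem]] := step_col_back s or1.
have [x' [ca' _ _ mv' mem']] := step_col_back s' or2.
have hb' : bnd (eop i c') by apply/(bnd_step s' or2).
have [_ _ _ _ [hU hB hm]] := step_local s' or2.
have i0 : 0 < i by clear -hi; lia.
split=> //.
have [ez|nz] := eqVneq z i.
  rewrite ez in hp ht hz.
  have [ein|ltin] : i = n \/ i < n by clear -hi; lia.
    have n0 : 0 < n by clear -hz ein; lia.
    have e : bar n = n.+1 by clear; lia.
    by move: hp0'; rewrite ein col_eps_n //; case: hp => _ _; rewrite ein e => /negbTE ->.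
  have [b1 b2 b3 b4 [b5 b6 b7]] := contr_bits_l h ltin i0 hp ht.
  have ex' : x' = i.
    by move: mv'; rewrite /col_back (negbTE b2) /= !andbF orbF => /andP[/eqP].
  have ex : x = 2 * n - i.
    by move: mv; rewrite /col_back b3 /= !andbF /= => /andP[/eqP].
  have [m1 m2] : i.+1 \in c' /\ 2 * n - i \notin c'.
    have h1 : i.+1 \in c'.
      by move: mv'; rewrite /col_back (negbTE b2) /= !andbF orbF => /and3P[].
    by split=> //; move: b7; rewrite h1.
  exists i.+1; split; first by clear -ltin; lia.
    have e1 : bar i.+1 = 2 * n - i by clear; lia.
    have e2 : (2 * n - i).+1 = bar i by clear -ltin; lia.
    case: hp => hmem _ _; split.
    - move=> y; rewrite mem mem' hmem ex ex' e1 e2.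
      have [->|y1] := eqVneq y (bar i); first by rewrite (negbTE b2) /= ?andbF /=;
        clear -ltin; lia.
      have [->|y2] := eqVneq y i.+1; first by rewrite m1 /= !orbT.
      by rewrite !andbT; clear; case: (y \in c'); case: (y == i); case: (y == 2 * n - i).
    - rewrite mem' ex' eqxx andbF orbF; clear; lia.
    rewrite mem' ex' e1 (negbTE m2) /= orbF; clear -ltin; lia.
  have hi1 : i.-1 <= n by clear -ltin; lia.
  have hi2 : i.-1 != i by clear -i0; lia.
  case: ht => t1 t2; split=> [|m im mn] /=; last first.
    have mi : m != i by clear -im; lia.
    by rewrite -hU -?hB //; apply: t2 => //; apply: ltnW.
  have [-> _ -> _] := col_profile ca' hi; rewrite -hU // -hB //.
  rewrite !mem' ex' eqxx (negbTE b2) /= orbF.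
  by have -> : (bar i == i) = false; [clear -ltin | move: t1; clear -i0]; lia.
have [ez|nz'] := eqVneq z i.+1.
  rewrite ez in hp ht hz.
  have ltin : i < n by clear -hz; lia.
  have [b1 b2 b3 b4 [b5 b6 b7]] := contr_bits_r h ltin i0 hp ht.
  have ex' : x' = 2 * n - i.
    by move: mv'; rewrite /col_back (negbTE b1) /= !andbF /= => /andP[/eqP].
  have ex : x = i.
    by move: mv; rewrite /col_back b4 /= !andbF orbF => /andP[/eqP].
  have [m1 m2] : i \notin c' /\ bar i \in c'.
    move: mv'; rewrite /col_back (negbTE b1) /= !andbF /= ltin /= => /and4P[_ -> _ h1].
    by split=> //; case: (i \in c') h1.
  exists i; split; first by [].
    have e1 : bar i.+1 = 2 * n - i by clear; lia.
    have e2 : (2 * n - i).+1 = bar i by clear -ltin; lia.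
    case: hp => hmem _ _; split.
    - move=> y; rewrite mem mem' hmem ex ex' e1 e2.
      have [->|y1] := eqVneq y i.+1; first by rewrite (negbTE b1) /= ?andbF /=;
        clear -ltin; lia.
      have [->|y2] := eqVneq y (bar i); first by rewrite m2 /= !orbT.
      by rewrite !andbT; clear; case: (y \in c'); case: (y == i); case: (y == 2 * n - i).
    - rewrite mem' ex' (negbTE m1) /= orbF; clear -ltin; lia.
    rewrite mem' ex' e2 eqxx andbF orbF; clear -ltin; lia.
  have hi1 : i.-1 <= n by clear -ltin; lia.
  have hi2 : i.-1 != i by clear -i0; lia.
  have [q1 _ q3 _] := col_profile hc' hi; move: q1 q3.
  rewrite (negbTE m1) m2 => q1 q3; case: ht => /= t1 t2.
  have t0 : nU c' i.-1 + nB c' i.-1 = i.-1 by clear -t1 q1 q3 i0; lia.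
  split=> [|m im mn]; first by rewrite -hU // -hB.
  have [->|mi] := eqVneq m i; last first.
    by rewrite -hU -?hB //; apply: t2 => //; rewrite ltn_neqAle eq_sym mi.
  have [-> _ -> _] := col_profile ca' hi; rewrite -hU // -hB //.
  have e1 : (2 * n - i).+1 = bar i by clear -ltin; lia.
  rewrite !mem' ex' e1 eqxx (negbTE m1) andbF /= !orbF.
  have -> : (i == 2 * n - i) = false by clear -ltin; lia.
  by have -> : (bar i == 2 * n - i) = false; [clear -ltin | move: t0; clear -i0]; lia.
exists z; split=> //; last first.
  by apply/(tight_far s' or2 nz nz' hz).
have [e1 e2 e3 e4] := pair_bits hi hz hp nz nz'.
have exx : x = x'.
  by apply: (col_back_inj hi _ mv'); move: mv; rewrite /col_back e1 e2 e3 e4.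
case: hp => hmem h1 h2.
have xz : [/\ z != x', bar z != x', z != x'.+1 & bar z != x'.+1].
  have hx : x' = i \/ (x' = 2 * n - i /\ i < n).
    by case/orP: mv' => [/andP[/eqP]|/and3P[/eqP]]; auto.
  by split; clear -hx hz hi nz nz'; lia.
case: xz => x1 x2 x3 x4.
split.
- move=> y; rewrite mem mem' hmem exx.
  have [->|y1] := eqVneq y z; first by rewrite x3 /= !orbT.
  have [->|y2] := eqVneq y (bar z); first by rewrite x4 /= !orbT.
  by rewrite !orbF.
- by rewrite mem' (negbTE h1) (negbTE x1).
by rewrite mem' (negbTE h2) (negbTE x2).
Qed.

Lemma contr_crys c c' : contr c c' -> crys n c c'.
Proof.
move=> h; apply: (crys_of_map (R := contr)) => //.
- move=> u v uv i; have [e1 e2] := contr_weights i uv.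
  by split=> //; [apply: contr_fop|apply: contr_eop].
- exact: contr_functional.
exact: contr_injective.
Qed.

Lemma col_iota h : h <= n -> col (iota 1 h).
Proof.
move=> hn; apply/andP; split; first exact: iota_ltn_sorted.
by apply/allP => x; rewrite mem_iota; lia.
Qed.

Lemma col_iota_counts h m : h <= n -> m <= n ->
  nU (iota 1 h) m = minn h m /\ nB (iota 1 h) m = 0.
Proof.
move=> hn mn; split; last first.
  apply/eqP; rewrite -leqn0 leqNgt -has_count; apply/hasPn => x.
  by rewrite mem_iota; lia.
elim: m mn => [|m IH] mn; first by rewrite (nU0 (col_iota hn)) minn0.
by rewrite (nUS m (col_iota hn)) IH; [rewrite mem_iota|]; lia.
Qed.

Lemma contraction k : 0 < k <= n ->
  crys n (rcons (iota 1 k) (bar k)) (iota 1 k.-1).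
Proof.
move=> hk; apply: contr_crys; have k1 : k.-1 <= n by lia.
have kn : k <= n by lia.
split.
- rewrite -cats1 col_split col_iota //=; apply/and3P; split; [|lia|lia].
  by apply/allP => x; rewrite mem_iota; lia.
- exact: (col_iota k1).
- by move=> m mn; have [-> ->] := col_iota_counts k1 mn; lia.
exists k; split=> //.
  split=> [y||]; rewrite ?mem_rcons ?inE ?mem_iota; lia.
split=> [|m km mn].
  by have [-> ->] := col_iota_counts k1 k1; lia.
by have [-> ->] := col_iota_counts k1 mn; lia.
Qed.

End Contraction.

(** * Highest weight words *)

Section HighestWeight.
Variable n : nat.
Local Notation phi := (phi n).
Local Notation eps := (eps n).
Local Notation crys := (crys n).
Local Notation bar x := ((2 * n).+1 - x).

(** The last [x] travels to the left past the larger letters by Knuth relations; all letters are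
    unbarred, so no pair x, bar x can interfere. *)
Lemma crys_shift x l : 0 < x -> x + l <= n ->
  crys (x :: rcons (iota x.+1 l) x) (x :: x :: iota x.+1 l).
Proof.
move=> x0; elim: l => [|l IH] hl; first exact: crys_refl.
have IH' := IH ltac:(lia).
have e1 : iota x.+1 l.+1 = rcons (iota x.+1 l) (x.+1 + l).
  by rewrite -[l.+1]addn1 iotaD cats1.
have e2 : x :: iota x.+1 l = rcons (iota x l) (x + l).
  by rewrite -[x :: _]/(iota x l.+1) -[l.+1]addn1 iotaD cats1.
have -> : x :: rcons (iota x.+1 l.+1) x = iota x l ++ [:: x + l; x.+1 + l; x].
  rewrite e1 -[x :: _]/(rcons (rcons (x :: iota x.+1 l) (x.+1 + l)) x) e2.
  by rewrite -!cats1 -!catA.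
have -> : x :: x :: iota x.+1 l.+1 = rcons (x :: x :: iota x.+1 l) (x.+1 + l).
  by rewrite e1.
apply: crys_trans (_ : crys _ (iota x l ++ [:: x + l; x; x.+1 + l])) _.
  by apply: crys_catl; apply: knuth_crys; lia.
have -> : iota x l ++ [:: x + l; x; x.+1 + l] =
    (x :: rcons (iota x.+1 l) x) ++ [:: x.+1 + l].
  by rewrite -[x :: rcons _ _]/(rcons (x :: iota x.+1 l) x) e2 -!cats1 -!catA.
by rewrite -[rcons (x :: _) _]cats1; apply: crys_catr.
Qed.

(** The symmetric core through which the two orders of a product of columns are compared. *)
Definition doubled (a : nat) : seq nat := flatten [seq [:: k; k] | k <- iota 1 a].

Lemma crys_doubled a b : a <= b -> b <= n ->
  crys (iota 1 b ++ iota 1 a) (doubled a ++ iota a.+1 (b - a)).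
Proof.
move=> + bn; elim: a => [|a IH] ab; first by rewrite cats0 subn0; apply: crys_refl.
have e1 : iota 1 a.+1 = iota 1 a ++ [:: a.+1] by rewrite -[a.+1 in LHS]addn1 iotaD.
have -> : doubled a.+1 = doubled a ++ [:: a.+1; a.+1].
  by rewrite /doubled e1 map_cat flatten_cat.
rewrite e1 catA; apply: crys_trans (crys_catr _ (IH (ltnW ab))) _.
rewrite -!catA; apply: crys_catl.
have -> : b - a = (b - a.+1).+1 by lia.
by rewrite cats1; apply: (@crys_shift a.+1 (b - a.+1)); lia.
Qed.

Lemma crys_columnC a b : a <= n -> b <= n ->
  crys (iota 1 a ++ iota 1 b) (iota 1 b ++ iota 1 a).
Proof.
wlog ab : a b / a <= b.
  move=> h an bn; case: (leqP a b) => ab; first exact: h.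
  by apply: crys_sym; apply: h => //; apply: ltnW.
move=> an bn; apply: crys_trans (crys_sym (crys_doubled ab bn)).
have -> : iota 1 b = iota 1 a ++ iota a.+1 (b - a).
  by rewrite -[in LHS](subnKC ab) iotaD.
rewrite catA; apply: crys_catr.
by have := crys_doubled (leqnn a) an; rewrite subnn cats0.
Qed.

Definition colword (s : seq nat) : seq nat := flatten [seq iota 1 h | h <- s].

Lemma colword_cat s t : colword (s ++ t) = colword s ++ colword t.
Proof. by rewrite /colword map_cat flatten_cat. Qed.

Lemma colword1 h : colword [:: h] = iota 1 h.
Proof. by rewrite /colword /= cats0. Qed.

Lemma crys_colword_rot h s : h <= n -> all (fun k => k <= n) s ->
  crys (iota 1 h ++ colword s) (colword s ++ iota 1 h).
Proof.
move=> hn; elim: s => [|k s IH] /=; first by rewrite cats0 => _; apply: crys_refl.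
case/andP => kn sn; rewrite -[colword (k :: s)]/(iota 1 k ++ colword s) catA.
apply: crys_trans (crys_catr _ (crys_columnC hn kn)) _.
by rewrite -!catA; apply: crys_catl; apply: IH.
Qed.

Lemma phi_iota i h : 0 < i <= n -> h <= n ->
  phi i (iota 1 h) = (i == h) /\ eps i (iota 1 h) = 0.
Proof.
move=> hi hn; have hc := col_iota hn.
have [ein|ltin] : i = n \/ i < n by lia.
  rewrite ein col_phi_n ?col_eps_n ?mem_iota //; lia.
have hi' : 0 < i < n by lia.
rewrite (col_phi hc hi') (col_eps hc hi') !mem_iota.
have -> : (0 < 2 * n - i) && (2 * n - i < 1 + h) = false by lia.
have -> : (0 < bar i) && (bar i < 1 + h) = false by lia.
by rewrite /= andbT; lia.
Qed.

Lemma phi_colword i s : 0 < i <= n -> all (fun k => k <= n) s ->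
  phi i (colword s) = count_mem i s /\ eps i (colword s) = 0.
Proof.
move=> hi; elim: s => [|k s IH] //= /andP[kn /IH[e1 e2]].
rewrite -[colword (k :: s)]/(iota 1 k ++ colword s) phi_cat eps_cat e1 e2.
by have [-> ->] := phi_iota hi kn; rewrite !subn0 addnC eq_sym.
Qed.

Definition hw (w : seq nat) : Prop := forall i, eps i w = 0.

(** Each further letter acts on a multiset of heights: 1 opens a column, k+1 lengthens a column of
    height k, and the bar of k shortens one. A column of height k is available because [phi k] of
    the prefix, which counts these columns, has to absorb the [eps k] of the new letter. *)
Theorem hw_colword w : all (fun a => 0 < a <= 2 * n) w -> hw w ->
  exists2 s, all (fun k => 0 < k <= n) s & crys w (colword s).
Proof.
elim/last_ind: w => [|w x IH]; first by exists [::] => //; apply: crys_refl.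
rewrite all_rcons => /andP[hx aw] hwx.
have hww : hw w by move=> i; have := hwx i; rewrite -cats1 eps_cat; lia.
have [s sn ws] := IH aw hww.
have sn' : all (fun k => k <= n) s.
  by apply: sub_all sn => k /andP[].
(* Columns commute up to crystal equivalence, so the one to be modified can be brought next to the
   new letter. *)
have pop k : 0 < k <= n -> epl n k x -> exists t, [/\ all (fun k => 0 < k <= n) t &
    crys w (colword t ++ iota 1 k)].
  move=> hk ex; have ks : k \in s.
    rewrite -has_pred1 has_count -(phi_colword hk sn').1 -(crys_phi k ws).
    by have := hwx k; rewrite -cats1 eps_cat /= ex; lia.
  have [s1 [s2 es]] : exists s1 s2, s = s1 ++ k :: s2.
    by case/splitPr: ks => s1 s2; exists s1, s2.
  exists (s1 ++ s2); split.
    by move: sn; rewrite es !all_cat /= => /and3P[-> _ ->].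
  apply: crys_trans ws _; rewrite es !colword_cat -catA; apply: crys_catl.
  rewrite -[colword (k :: s2)]/(iota 1 k ++ colword s2).
  by move: sn'; rewrite es all_cat /= => /and3P[_ kn s2n]; apply: crys_colword_rot.
have [x1|[[k [hk xk]]|[k [hk xk]]]] : x = 1 \/ (exists k, 0 < k < n /\ x = k.+1) \/
    (exists k, 0 < k <= n /\ x = bar k).
- case: (leqP x n) => xn; last by right; right; exists (bar x); lia.
  case: (leqP x 1) => x1; [left; lia|right; left; exists x.-1; lia].
- exists (s ++ [:: 1]).
    by rewrite all_cat sn /=; lia.
  by rewrite colword_cat -cats1 x1; apply: crys_catr.
- have kn : 0 < k <= n by lia.
  have ek : epl n k x by rewrite xk /epl; lia.
  have [t [tn wt]] := pop k kn ek.
  exists (t ++ [:: k.+1]); first by rewrite all_cat tn /=; lia.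
  have e1 : iota 1 k.+1 = iota 1 k ++ [:: k.+1] by rewrite -[k.+1 in LHS]addn1 iotaD.
  by rewrite colword_cat colword1 e1 catA -cats1 xk; apply: crys_catr.
have ek : epl n k x by rewrite xk /epl; lia.
have [t [tn wt]] := pop k hk ek.
(* The filter removes a column that has been shortened to height 0. *)
exists (t ++ [seq h <- [:: k.-1] | 0 < h]).
  by rewrite all_cat tn /=; case: ifP => //=; lia.
have -> : colword (t ++ [seq h <- [:: k.-1] | 0 < h]) = colword t ++ iota 1 k.-1.
  by rewrite colword_cat /=; case: (k.-1) => // k'; rewrite -colword1.
rewrite -cats1 xk; apply: crys_trans (crys_catr _ wt) _.
by rewrite -catA cats1; apply: crys_catl; apply: contraction.
Qed.

End HighestWeight.

(** * Insertion of two columns *)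

Section Insertion.
Variable n : nat.
Local Notation phi := (phi n).
Local Notation eps := (eps n).
Local Notation fop := (fop n).
Local Notation eop := (eop n).
Local Notation step := (step n).
Local Notation col := (col n).
Local Notation nB := (nB n).
Local Notation bnd := (bnd n).
Local Notation cle := (cle n).
Local Notation crys := (crys n).
Local Notation hw := (hw n).
Local Notation bar x := ((2 * n).+1 - x).

(** The difference of [phi] and [eps] is the pairing of the weight with the simple coroot of index
    i, written without subtraction. *)
Lemma phi_weight i w : 0 < i < n ->
  phi i w + count_mem i.+1 w + count_mem (bar i) w =
  eps i w + count_mem i w + count_mem (2 * n - i) w.
Proof.
move=> hi; elim: w => //= a w IH.
have e : 0 < i <= n by lia.
have h1 : phl n i a + epl n i a <= 1 by have := @phl_epl n i a; case: (phl n i a);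
  case: (epl n i a) => // /(_ isT).
have h2 : phl n i a = (a == i) + (a == 2 * n - i) :> nat by rewrite /phl e; clear -hi; lia.
have h3 : epl n i a = (a == i.+1) + (a == bar i) :> nat by rewrite /epl e; clear -hi; lia.
by move: IH h1 h2 h3; clear; lia.
Qed.

Lemma phi_weight_n w : 0 < n ->
  phi n w + count_mem n.+1 w = eps n w + count_mem n w.
Proof.
move=> hi; elim: w => //= a w IH.
have e : 0 < n <= n by lia.
have h1 : phl n n a + epl n n a <= 1 by have := @phl_epl n n a; case: (phl n n a);
  case: (epl n n a) => // /(_ isT).
have h2 : phl n n a = (a == n) :> nat by rewrite /phl e; clear -hi; lia.
have h3 : epl n n a = (a == n.+1) :> nat by rewrite /epl e; clear -hi; lia.
by move: IH h1 h2 h3; clear; lia.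
Qed.

(** String lengths determine the weight: the label n gives its last coordinate, and a label j < n
    the difference of the coordinates j and j+1. Hence the descent from n. *)
Lemma crys_weight w w' j : crys w w' -> 0 < j <= n ->
  count_mem j w + count_mem (bar j) w' = count_mem j w' + count_mem (bar j) w.
Proof.
move=> ww' hj; have n0 : 0 < n by clear -hj; lia.
have [d e] : exists d, j = n - d by exists (n - j); lia.
elim: d j e hj => [|d IH] j e hj.
  have -> : j = n by lia.
  have -> : bar n = n.+1 by clear; lia.
  have := phi_weight_n w n0; have := phi_weight_n w' n0.
  rewrite (crys_phi n ww') (crys_eps n ww'); clear; lia.
have hj' : 0 < j < n by clear -e hj; lia.
have := phi_weight w hj'; have := phi_weight w' hj'.
rewrite (crys_phi j ww') (crys_eps j ww').
have := IH j.+1 ltac:(clear -e hj'; lia) ltac:(clear -hj'; lia).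
have -> : bar j.+1 = 2 * n - j by clear; lia.
by clear; lia.
Qed.

Lemma count_colword s j : 0 < j <= n -> all (fun h => h <= n) s ->
  count_mem j (colword s) = count (leq j) s /\ count_mem (bar j) (colword s) = 0.
Proof.
move=> hj; elim: s => [|h s IH] //= /andP[hn /IH[e1 e2]].
rewrite -[colword (h :: s)]/(iota 1 h ++ colword s) !count_cat e1 e2.
rewrite !count_uniq_mem ?iota_uniq // !mem_iota.
by split; clear -hj hn; lia.
Qed.

(* Below height [a] the column is forced, above [a] it is of highest weight;
   a barred letter would then violate [bnd]. *)
Lemma rel_hw_col c a : col c -> bnd c -> (forall k, 0 < k <= a -> k \in c) ->
  (forall i, a < i -> i <= n -> eps i c = 0) -> a <= n ->
  exists b, [/\ a <= b, b <= n & c = iota 1 b].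
Proof.
move=> hc hb ha he an.
have dn k : 0 < k < n -> k.+1 \in c -> k \in c.
  move=> hk kc; case: (leqP k a) => ka; first by apply: ha; clear -hk ka; lia.
  have := he k ka ltac:(clear -hk; lia); rewrite col_eps // kc /=.
  by case: (k \in c).
have dn' k : k <= n -> k \in c -> forall j, 0 < j <= k -> j \in c.
  elim: k => [|k IH] kn kc j hj; first by exfalso; clear -hj; lia.
  have [->//|jk] := eqVneq j k.+1.
  by apply: IH; [clear -kn|apply: dn => //; clear -kn hj jk|clear -hj jk]; lia.
(* Barred letters are excluded from the bar of n onwards, for decreasing j. If the bar of j occurs
   and that of j+1 does not, then j is in [c], being at most [a] or forced by [eps j] = 0; so are 1,
   ..., j, and the bound at j is exceeded. *)
have nob d j : j = n - d -> 0 < j -> bar j \notin c.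
  elim: d j => [|d IH] j ej j0; apply/negP => bj.
    have jn : j = n by clear -ej; lia.
    rewrite jn in bj; have bn : n.+1 \in c by have <- : bar n = n.+1 by clear; lia.
    have jc : n \in c.
      case: (leqP n a) => na; first by apply: ha; clear -na ej j0; lia.
      have := he n na (leqnn n); rewrite col_eps_n; [|exact: hc|by clear -ej j0; lia].
      by rewrite bn; case: (n \in c).
    have cnt m : m <= n -> nU c m = m.
      elim: m => [|m IH] mn; first exact: nU0 hc.
      rewrite (nUS m hc) IH ?(dn' n (leqnn n) jc m.+1) ?addn1 //; clear -mn; lia.
    have hjn : 0 < n <= n by clear -ej j0; lia.
    have := hb n (leqnn n); rewrite cnt //; have [_ _ -> _] := col_profile hc hjn.
    by rewrite bj; clear -hjn; lia.
  have [jn|jn] : j < n \/ j = n by clear -ej; lia.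
    have nb : 2 * n - j \notin c.
      have -> : 2 * n - j = bar j.+1 by clear; lia.
      by apply: IH; clear -ej jn j0; lia.
    have jc : j \in c.
      case: (leqP j a) => na; first by apply: ha; clear -na j0; lia.
      have := he j na (ltnW jn); rewrite col_eps ?j0 // bj nb /=.
      by case: (j \in c) => //=; rewrite addn1.
    have cnt m : m <= j -> nU c m = m.
      elim: m => [|m IHm] mn; first exact: nU0 hc.
      rewrite (nUS m hc) IHm ?(dn' j (ltnW jn) jc m.+1) ?addn1 //; clear -mn; lia.
    have hjn : 0 < j <= n by rewrite j0 ltnW.
    have := hb j (ltnW jn); rewrite cnt //; have [_ _ -> _] := col_profile hc hjn.
    by rewrite bj; clear -j0; lia.
  by exfalso; clear -jn ej j0; lia.
have P m : m <= n -> exists2 b, b <= m & forall k, 0 < k <= m -> (k \in c) = (k <= b).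
  elim: m => [|m IH] mn; first by exists 0 => // k hk; exfalso; clear -hk; lia.
  have [b bm hbm] := IH (ltnW mn).
  case: (boolP (m.+1 \in c)) => mc.
    exists m.+1 => // k hk; rewrite (dn' m.+1 mn mc k hk); clear -hk; lia.
  exists b => [|k hk]; first by clear -bm; lia.
  have [->|km] := eqVneq k m.+1; first by rewrite (negbTE mc); clear -bm; lia.
  by apply: hbm; clear -hk km; lia.
have [b bn hbn] := P n (leqnn n).
exists b; split=> //.
  case: (posnP a) => [->//|a0].
  by rewrite -hbn ?ha // a0 ?leqnn.
apply: (col_eq hc (col_iota bn)) => x; rewrite mem_iota.
case: (leqP x n) => xn.
  case: (posnP x) => [->|x0]; last by rewrite hbn ?x0 //; clear; lia.
  by apply/negbTE/negP => x0; case/andP: hc => _ /allP /(_ _ x0).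
have -> : (0 < x) && (x < 1 + b) = false by clear -xn bn; lia.
apply/negbTE/negP => xc; have hx : 0 < x <= 2 * n by case/andP: hc => _ /allP /(_ _ xc).
have := nob (n - bar x) (bar x) ltac:(clear -xn hx; lia) ltac:(clear -xn hx; lia).
by have -> : bar (bar x) = x by [clear -hx; lia]; rewrite xc.
Qed.

Lemma nU_mono c k m : k <= m -> nU c k <= nU c m.
Proof. by move=> km; apply: sub_count => x /= h; apply: leq_trans h km. Qed.

Lemma nB_mono c k m : k <= m -> nB c k <= nB c m.
Proof. by move=> km; apply: sub_count => x /=; lia. Qed.

Lemma nU_lip c k m : col c -> k <= m -> nU c m + k <= nU c k + m.
Proof.
move=> hc; elim: m => [|m IH]; first by rewrite leqn0 => /eqP ->.
rewrite leq_eqVlt => /orP[/eqP -> //|km]; have := IH km.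
by rewrite (nUS m hc); case: (m.+1 \in c); clear; lia.
Qed.

Lemma cle_nil c : col c -> cle c [::].
Proof.
move=> hc k m km mn; rewrite /nU /= (col_size hc).
have := nU_lip hc km; have := nU_mono c mn; have := nB_mono c mn.
by rewrite /nU /=; clear -km; lia.
Qed.

Lemma cle_iota c a : col c -> a <= n -> cle c (iota 1 a) ->
  forall k, 0 < k <= a -> k \in c.
Proof.
move=> hc an h k hk; have kn : k <= n by clear -hk an; lia.
have k1n : k.-1 <= n by clear -kn; lia.
have [h1 _] := h k k (leqnn k) kn.
have [e1 e2] := col_iota_counts an kn; rewrite e1 e2 in h1.
have := nU_lip hc (leq0n k.-1); rewrite (nU0 hc).
have := nUp hc (ltac:(clear -hk; lia) : 0 < k).
by case: (k \in c) => //; move: h1; clear -hk; lia.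
Qed.

Fixpoint chain (x : seq nat) (cs : seq (seq nat)) : Prop :=
  if cs is c :: cs' then cle c x /\ chain c cs' else True.

(** The prefix [w0] cannot absorb any [eps i] with i > a, and the chain condition forces 1, ..., a
    into the next column. This column is then 1, ..., b with b >= a, and the larger prefix satisfies
    the same hypothesis with b. *)
Lemma hw_tableau cs a w0 : all col cs -> (forall c, c \in cs -> bnd c) ->
  hw (w0 ++ flatten cs) -> (forall i, a < i -> i <= n -> phi i w0 = 0) -> a <= n ->
  chain (iota 1 a) cs ->
  exists s, [/\ path leq a s, all (fun h => h <= n) s & cs = [seq iota 1 h | h <- s]].
Proof.
elim: cs a w0 => [|c cs IH] a w0 /=; first by exists [::].
case/andP => hc hcs hb hh hp an [ca hch].
have [b [ab bn cb]] : exists b, [/\ a <= b, b <= n & c = iota 1 b].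
  apply: (rel_hw_col hc (hb c _) (cle_iota hc an ca) _ an); first by rewrite inE eqxx.
  move=> i ai inn; have := hh i; rewrite eps_cat eps_cat hp // ; clear; lia.
rewrite cb in hch; have [||i bi inn|//|//|s [ps sn e]] := IH b (w0 ++ c) hcs.
- by move=> d dc; apply: hb; rewrite inE dc orbT.
- by rewrite -catA.
- have hi : 0 < i <= n by clear -bi inn; lia.
  rewrite phi_cat cb; have [-> ->] := phi_iota hi bn.
  rewrite hp //; clear -bi ab; lia.
by exists (b :: s); rewrite /= ab ps bn sn e cb.
Qed.

Lemma cle_of_iota c k : col c -> k <= n -> (forall j, 0 < j <= k -> j \in c) ->
  nB c n = 0 -> cle c (iota 1 k).
Proof.
move=> hc kn hk hB i m im mn.
have inn := leq_trans im mn.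
have [-> ->] := col_iota_counts kn mn; have [_ ->] := col_iota_counts kn inn.
have hBm : nB c m = 0 by have := nB_mono c mn; rewrite hB; clear; lia.
have low j : j <= k -> nU c j = j.
  elim: j => [|j IH] jk; first exact: nU0 hc.
  by rewrite (nUS j hc) IH ?hk ?addn1 //; clear -jk; lia.
rewrite hBm size_iota (col_size hc) hB.
have := nU_lip hc im; have h1 := nU_mono c (_ : minn k i <= i).
have {}h1 := h1 ltac:(clear; lia); rewrite low in h1; last by clear; lia.
have h2 := nU_mono c kn; rewrite low // in h2.
by move: h1 h2; clear -im; lia.
Qed.

Lemma nU_count w m : nU w m.+1 = nU w m + count_mem m.+1 w.
Proof. by elim: w => //= x w; rewrite /nU /= => ->; lia. Qed.

Lemma nB_count w m : m < 2 * n -> nB w m.+1 = nB w m + count_mem (2 * n - m) w.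
Proof. by move=> hm; elim: w => //= x w; rewrite /nB /= => ->; lia. Qed.

(** The letter 1 occurs at most twice in the product and once in every column of the reduced form,
    which leaves at most two columns, padded by height 0. If no size is lost there are no barred
    letters; if moreover b is the height of [c1], then [c2] contains [c1] and the product was a
    tableau from the start. *)
Lemma hw_insertion c1 c2 : col c1 -> bnd c1 -> col c2 -> bnd c2 ->
  hw (c1 ++ c2) -> exists b a, [/\ b <= a, a <= n,
    crys (c1 ++ c2) (iota 1 b ++ iota 1 a), b <= size c1 &
    b + a <= size c1 + size c2 /\
    (b = size c1 -> b + a = size c1 + size c2 -> cle c2 c1)].
Proof.
move=> h1 b1 h2 b2 hh; set w := c1 ++ c2.
have aw : all (fun x => 0 < x <= 2 * n) w.
  by rewrite all_cat; case/andP: h1 => _ ->; case/andP: h2.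
have [k [_ kn ek]] : exists b, [/\ 0 <= b, b <= n & c1 = iota 1 b].
  apply: (rel_hw_col h1 b1) => // [k|i _ _]; first by clear; lia.
  by have := hh i; rewrite eps_cat; clear; lia.
have [s sn ws] := hw_colword aw hh.
have sn' : all (fun k => k <= n) s by apply: sub_all sn => j /andP[].
have wt j : 0 < j <= n -> count_mem j w = count (leq j) s + count_mem (bar j) w.
  move=> hj; have := crys_weight ws hj; have [-> ->] := count_colword hj sn'.
  by clear; lia.
have wc j : count_mem j w = (j \in c1) + (j \in c2).
  by rewrite count_cat !count_uniq_mem ?(col_uniq h1) ?(col_uniq h2).
have sz : 0 < n -> size s <= 2.
  move=> n0; have := wt 1 n0; rewrite wc.
  have -> : count (leq 1) s = size s.
    by apply/eqP; rewrite -all_count; apply: sub_all sn => j /andP[].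
  by case: (1 \in c1); case: (1 \in c2); clear; lia.
have [b [a [ba an cs cnt]]] : exists b a, [/\ b <= a, a <= n,
    crys (colword s) (iota 1 b ++ iota 1 a) &
    forall j, 0 < j -> count (leq j) s = (j <= b) + (j <= a)].
  clear ws wt; case: s sn sn' sz => [|x [|y [|z s]]] /=.
  - by exists 0, 0; split=> // [|j]; [apply: crys_refl|clear; lia].
  - move=> _ /andP[xn _] _; exists 0, x; split=> // [|j]; last by clear; lia.
    by rewrite colword1; apply: crys_refl.
  - move=> _ /and3P[xn yn _] _.
    rewrite -[colword _]/(iota 1 x ++ colword [:: y]) colword1.
    case: (leqP x y) => xy.
      by exists x, y; split=> // [|j]; [apply: crys_refl|clear; lia].
    exists y, x; split=> //; [exact: ltnW|exact: crys_columnC|].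
    by move=> j _; clear; lia.
  move=> /andP[x0 _] /andP[xn _] h; exfalso.
  by have := h ltac:(clear -x0 xn; lia).
(* At m = n this says that the product has a + b letters and two more for each barred letter. *)
have tot m : m <= n -> nU w m = minn m b + minn m a + nB w m.
  elim: m => [|m IH] mn.
    by rewrite /w /nU /nB !count_cat -!/(nU _ _) -!/(nB _ _) (nU0 h1) (nU0 h2)
      (nB0 h1) (nB0 h2) !min0n.
  rewrite nU_count nB_count ?IH; try (clear -mn; lia).
  rewrite wt ?cnt //; have -> : bar m.+1 = 2 * n - m by clear; lia.
  by clear; lia.
have sw : size c1 + size c2 = nU w n + nB w n.
  by rewrite (col_size h1) (col_size h2) /w /nU /nB !count_cat; clear; lia.
have bk j : 0 < j <= b -> (j \in c1) /\ (j \in c2).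
  move=> hj; have := wt j ltac:(clear -hj ba an; lia).
  rewrite cnt ?wc; last by clear -hj; lia.
  by case: (j \in c1); case: (j \in c2); clear -hj ba; lia.
exists b, a; split=> //; first exact: crys_trans ws cs.
  case: (posnP b) => [->//|b0].
  have [+ _] := bk b ltac:(clear -b0; lia).
  by rewrite ek mem_iota size_iota; clear; lia.
rewrite sw tot //; split; first by clear -ba an; lia.
move=> eb e; have bw : nB w n = 0 by move: e; clear -ba an; lia.
rewrite ek in eb *; apply: cle_of_iota => //.
  by move=> j hj; apply: (bk j _).2; rewrite eb size_iota.
by move: bw; rewrite /w /nB count_cat; clear; lia.
Qed.

Lemma hwP w : (exists2 i, 0 < i <= n & 0 < eps i w) \/ hw w.
Proof.
case: (boolP (has (fun i => 0 < eps i w) (iota 1 n))) => [/hasP[i]|/hasPn h].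
  by rewrite mem_iota => hi ei; left; exists i => //; clear -hi; lia.
right=> i; case: (boolP (0 < i <= n)) => hi; last by case: (weights_out w hi).
by apply/eqP; rewrite -leqn0 leqNgt; apply: h; rewrite mem_iota; clear -hi; lia.
Qed.

Lemma sumn_eop i w : 0 < eps i w -> sumn (eop i w) < sumn w.
Proof.
move=> /step_eop [u [x [v [-> e _ _ _]]]].
by rewrite e !sumn_cat /=; clear; lia.
Qed.

(** Raise the product by some e_i, insert, and lower the result by f_i; all the properties are
    stable along the two edges. The size clauses are what termination of the rewriting needs. *)
Theorem insertion c1 c2 : col c1 -> bnd c1 -> col c2 -> bnd c2 ->
  exists d1 d2, [/\ col d1, bnd d1, col d2, bnd d2 &
  [/\ cle d2 d1, crys (c1 ++ c2) (d1 ++ d2), size d1 <= size c1,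
      size d1 + size d2 <= size c1 + size c2 &
      size d1 = size c1 -> size d1 + size d2 = size c1 + size c2 -> cle c2 c1]].
Proof.
move: {2}(sumn (c1 ++ c2)).+1 (ltnSn (sumn (c1 ++ c2))) => N.
elim: N c1 c2 => // N IH c1 c2 hN h1 b1 h2 b2.
have [[i hi ei]|hh] := hwP (c1 ++ c2); last first.
  have [b [a [ba an cr bs [tot last]]]] := hw_insertion h1 b1 h2 b2 hh.
  have bn := leq_trans ba an.
  have bnd_iota h : h <= n -> bnd (iota 1 h).
    by move=> hn m mn; have [-> ->] := col_iota_counts hn mn; clear; lia.
  exists (iota 1 b), (iota 1 a); rewrite !size_iota; split; try exact: col_iota;
    try exact: bnd_iota; split=> //.
  apply: cle_of_iota => //; first exact: col_iota.
    by move=> j; rewrite mem_iota; clear -ba; lia.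
  by case: (col_iota_counts an (leqnn n)).
pose e1 := take (size c1) (eop i (c1 ++ c2)).
pose e2 := drop (size c1) (eop i (c1 ++ c2)).
have s1 : size e1 = size c1.
  by rewrite size_takel // size_eop size_cat leq_addr.
have s2 : size e2 = size c2 by rewrite size_drop size_eop size_cat addKn.
have ee : e1 ++ e2 = eop i (c1 ++ c2) by apply: cat_take_drop.
have st : step i (e1 ++ e2) (c1 ++ c2) by rewrite ee; apply: step_eop.
have pair_ok a1 a2 c d : size a1 = size c -> step i (a1 ++ a2) (c ++ d) ->
    (col c /\ bnd c) /\ (col d /\ bnd d) <-> (col a1 /\ bnd a1) /\ (col a2 /\ bnd a2).
  move=> sz /(step_cat _ _ _ _ sz).
  have one x y : step i x y -> (col x /\ bnd x) <-> (col y /\ bnd y).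
    move=> sxy; split=> -[hx hbx]; have hor : col x || col y by rewrite hx ?orbT.
      by have [? [_ ? _ _ _]] := step_col sxy hor; split=> //; apply/(bnd_step sxy hor).
    by have [? [? _ _ _ _]] := step_col sxy hor; split=> //; apply/(bnd_step sxy hor).
  by case=> [[/one o [-> _]]|[-> [/one o _]]]; rewrite o.
have [[g1 k1] [g2 k2]] := (pair_ok _ _ _ _ s1 st).1 (conj (conj h1 b1) (conj h2 b2)).
have lt : sumn (e1 ++ e2) < N.
  by have := sumn_eop ei; rewrite -ee; clear -hN; lia.
have [d1 [d2 [p1 q1 p2 q2 [cl cr z1 z2 z3]]]] := IH _ _ lt g1 k1 g2 k2.
have fp : 0 < phi i (e1 ++ e2) by case: (step_inv st).
have fp' : 0 < phi i (d1 ++ d2) by rewrite -(crys_phi i cr).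
pose f1 := take (size d1) (fop i (d1 ++ d2)).
pose f2 := drop (size d1) (fop i (d1 ++ d2)).
have s3 : size f1 = size d1.
  by rewrite size_takel // size_fop size_cat leq_addr.
have s4 : size f2 = size d2 by rewrite size_drop size_fop size_cat addKn.
have ff : f1 ++ f2 = fop i (d1 ++ d2) by apply: cat_take_drop.
have st' : step i (d1 ++ d2) (f1 ++ f2) by rewrite ff; apply: step_fop.
have [[g3 k3] [g4 k4]] := (pair_ok _ _ _ _ (esym s3) st').2 (conj (conj p1 q1) (conj p2 q2)).
have or1 : col d1 || col f1 by rewrite p1.
have or2 : col d2 || col f2 by rewrite p2.
have or3 : col e1 || col c1 by rewrite g1.
have or4 : col e2 || col c2 by rewrite g2.
exists f1, f2; split=> //; rewrite s3 s4 -s1 -s2; split=> //.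
- by apply/(cle_step (esym s3) st' or1 or2).
- have [_ -> _ _] := step_inv st; rewrite ff; exact: crys_fop.
by move=> t1 t2; apply/(cle_step s1 st or3 or4); apply: z3.
Qed.

End Insertion.

(** * Splitting of columns *)

Section Splitting.
Variable n : nat.
Local Notation col := (col n).
Local Notation nB := (nB n).
Local Notation bnd := (bnd n).
Local Notation cle := (cle n).
Local Notation bar x := ((2 * n).+1 - x).
Local Notation upto k := (fun x => x <= k).

Lemma last_filter_iota (fr : pred nat) k (s := [seq t <- iota 1 k | fr t]) :
  s <> [::] -> [/\ fr (last 0 s), 0 < last 0 s <= k
                 & forall x, 0 < x <= k -> fr x -> x <= last 0 s].
Proof.
rewrite {}/s; elim: k => [|k IH] //.
have -> : iota 1 k.+1 = rcons (iota 1 k) k.+1 by rewrite -[k.+1 in LHS]addn1 iotaD cats1.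
rewrite filter_rcons; case: ifP => fk h.
  by rewrite last_rcons; split=> [||x /andP[]] //; rewrite leqnn.
have [h1 h2 h3] := IH h; split=> //; first by clear -h2; lia.
move=> x hx fx; apply: h3 => //.
by have [ex|nx] := eqVneq x k.+1; [rewrite ex fk in fx|clear -hx nx; lia].
Qed.

Section Greedy.
Variable c : word n.
Local Notation fr := (free_letter c).

(** Scanning downwards, pairs enter a queue and a free letter serves one waiting pair. The queue
    length at k is the count of [ts] minus that of [zs] up to k: never negative, positive where a
    free letter is used, and zero where one is left over. *)
Lemma split_spec zs b ts : sorted gtn zs -> split_ts c zs b = Some ts ->
  [/\ size ts = size zs, path gtn b ts, all (fun t => fr t && (0 < t)) ts
    & [/\ forall k, count (upto k) zs <= count (upto k) ts,
          forall k, k \in ts -> count (upto k) zs < count (upto k) ts &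
          forall k, 0 < k < b -> fr k -> k \notin ts ->
             count (upto k) ts <= count (upto k) zs]].
Proof.
elim: zs b ts => [|z zs IH] b ts /=; first by move=> _ [<-].
move=> zs_s; set s := [seq t <- _ | _]; have := @last_filter_iota fr (minn b z).-1.
rewrite -/s; case es : s => [//|s0 s']; rewrite -es => /(_ ltac:(by rewrite es)).
set t := last 0 s => -[ft ht hmax].
have sz : sorted gtn zs := path_sorted zs_s.
case E : (split_ts c zs t) => [ts'|] //= [<-].
have [h1 h2 h3 [h4 h5 h6]] := IH _ _ sz E.
have gtn_trans : transitive gtn by move=> x y w; clear; lia.
have zs_lt x : x \in zs -> x < z by move/(allP (order_path_min gtn_trans zs_s)).
have ts_lt x : x \in ts' -> x < t by move/(allP (order_path_min gtn_trans h2)).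
have tz : t < z by clear -ht; lia.
have tb : t < b by clear -ht; lia.
split=> /=.
- by rewrite h1.
- by rewrite tb.
- by rewrite ft h3 /=; case/andP: ht => ->.
split=> [k|k|k hk fk].
- by have := h4 k; clear -tz; lia.
- rewrite inE => /orP[/eqP ->|kt].
    rewrite leqnn; have -> : count (upto t) ts' = size ts'.
      by apply/eqP; rewrite -all_count; apply/allP => x /ts_lt /ltnW.
    by rewrite h1; have := count_size (upto t) zs; clear -tz; lia.
  by have := h5 k kt; have := ts_lt k kt; clear -tz; lia.
rewrite inE negb_or => /andP[kt kts].
case: (ltnP k t) => ltk.
  have := h6 k ltac:(clear -hk ltk; lia) fk kts; clear -ltk tz; lia.
have kz : z <= k.
  rewrite leqNgt; apply/negP => kz.
  by have := hmax k ltac:(clear -hk kz; lia) fk; clear -ltk kt; lia.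
have -> : count (upto k) zs = size zs.
  by apply/eqP; rewrite -all_count; apply/allP => x /zs_lt; clear -kz; lia.
by rewrite -h1; have := count_size (upto k) ts'; clear -kz; lia.
Qed.

Definition free_below (x : nat) : nat := count fr (iota 1 x.-1).

(** A condition of Hall type: below each pair there are enough free letters for it and for all
    smaller pairs. *)
Lemma split_exists zs b :
  (forall s1 z s2, zs = s1 ++ z :: s2 -> (size s2).+1 <= free_below z) ->
  size zs <= free_below b -> split_ts c zs b <> None.
Proof.
elim: zs b => [|z zs IH] b //= hz hb.
set s := [seq t <- _ | _]; have := @last_filter_iota fr (minn b z).-1; rewrite -/s.
have sz : (size zs).+1 <= size s.
  rewrite /s size_filter -/(free_below _).
  by case: (leqP b z) => _ //; apply: (hz [::]).
case es : s sz => [//|s0 s'] sz; rewrite -es => /(_ ltac:(by rewrite es)).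
set t := last 0 s => -[ft ht hmax].
suff : split_ts c zs t <> None by case: (split_ts c zs t).
apply: IH => [s1 z' s2 e|]; first by apply: (hz (z :: s1)); rewrite e.
(* The greedy choice takes the largest candidate, so the remaining pairs lose exactly one free
   letter. *)
have : size s = (free_below t).+1.
  rewrite /s size_filter /free_below.
  have -> : (minn b z).-1 = t.-1 + (1 + ((minn b z).-1 - t)) by clear -ht; lia.
  rewrite iotaD iotaD !count_cat /=.
  have -> : 1 + t.-1 = t by clear -ht; lia.
  rewrite ft (_ : count fr (iota (t + 1) _) = 0) ?addn1 ?addn0 //.
  apply/eqP; rewrite -leqn0 leqNgt -has_count; apply/hasPn => x.
  rewrite mem_iota => hx; apply/negP => fx.
  by have := hmax x ltac:(clear -hx ht; lia) fx; clear -hx; lia.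
by rewrite es => e; rewrite e in sz.
Qed.

Local Notation cc := (codes c).

Lemma mem_unbE z : 0 < z <= n -> mem_unb c z = (z \in cc).
Proof.
move=> hz; apply/hasP/mapP => -[x xc].
  case/andP => xb /eqP ez; exists x => //.
  by rewrite -ez /code /rank (negbTE xb).
move=> ez; exists x => //; move: ez hz; rewrite /code /rank /lval.
by case: x {xc} => j [] /=; have := ltn_ord j; lia.
Qed.

Lemma mem_barE z : 0 < z <= n -> mem_bar c z = (bar z \in cc).
Proof.
move=> hz; apply/hasP/mapP => -[x xc].
  case/andP => xb /eqP ez; exists x => //.
  by rewrite -ez /code /rank xb /lval; move: (ltn_ord x.1); set j := nat_of_ord x.1; lia.
move=> ez; exists x => //; move: ez hz; rewrite /code /rank /lval.
by case: x {xc} => j [] /=; have := ltn_ord j; lia.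
Qed.

Local Notation zs := (pair_letters c).

Lemma pair_lettersE z : (z \in zs) = [&& 0 < z <= n, z \in cc & bar z \in cc].
Proof.
rewrite mem_filter mem_rev mem_iota add1n ltnS andbC.
by case: (boolP (0 < z <= n)) => //= hz; rewrite mem_unbE ?mem_barE.
Qed.

Lemma pair_letters_sorted : sorted gtn zs.
Proof.
apply: sorted_filter; first by move=> x y w; clear; lia.
by rewrite rev_sorted; apply: (sub_sorted _ (iota_ltn_sorted 1 n)).
Qed.

Lemma free_letterE z : 0 < z <= n -> fr z = (z \notin cc) && (bar z \notin cc).
Proof. by move=> hz; rewrite /free_letter mem_unbE ?mem_barE. Qed.

Lemma gtn_uniq s : sorted gtn s -> uniq s.
Proof. by apply: sorted_uniq => [x y w|x]; [clear; lia|rewrite /= ltnn]. Qed.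

Lemma nU_uniq s k : uniq s -> nU s k.+1 = nU s k + (k.+1 \in s).
Proof. by move=> us; rewrite nU_count count_uniq_mem. Qed.

Lemma nU_all s k : (forall x, x \in s -> x <= k) -> nU s k = size s.
Proof. by move=> h; apply/eqP; rewrite -all_count; apply/allP. Qed.

Hypothesis hc : col cc.

(** An index carries two letters when it is a pair and none when it is free. Hence U(m) + B(m) <= m
    says that up to m the pairs do not outnumber the free letters, which is what the greedy choice
    requires. *)
Lemma balance m : m <= n ->
  nU cc m + nB cc m + count fr (iota 1 m) = m + nU zs m.
Proof.
elim: m => [|m IH] mn.
  rewrite (nU0 hc) (nB0 hc) /nU; apply/esym/eqP; rewrite -leqn0 leqNgt -has_count.
  by apply/hasPn => x; rewrite pair_lettersE; clear; lia.
have e1 : iota 1 m.+1 = iota 1 m ++ [:: m.+1] by rewrite -[m.+1 in LHS]addn1 iotaD.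
have mn2 : m < 2 * n by clear -mn; lia.
have hm : 0 < m.+1 <= n by rewrite mn.
rewrite e1 count_cat (nUS m hc) nBS // (nU_uniq _ (gtn_uniq pair_letters_sorted)) /=.
rewrite pair_lettersE hm free_letterE //; have -> : bar m.+1 = 2 * n - m by clear; lia.
have := IH (ltnW mn).
by case: (m.+1 \in cc); case: (2 * n - m \in cc) => /=; clear; lia.
Qed.

Lemma t_lettersP : t_letters c <> None <-> bnd cc.
Proof.
rewrite /t_letters; split=> [|hb].
  case E : (split_ts _ _ _) => [ts|] // _ m mn.
  have [h1 h2 h3 [h4 h5 h6]] := split_spec pair_letters_sorted E.
  have h7 : nU ts m <= count fr (iota 1 m).
    rewrite /nU -!size_filter; apply: uniq_leq_size.
      by apply: filter_uniq; move: (gtn_uniq (path_sorted h2)).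
    move=> x; rewrite !mem_filter mem_iota => /andP[xm /(allP h3)/andP[-> x0]].
    by rewrite x0; clear -xm; lia.
  have := h4 m; rewrite -!/(nU _ _); have := balance mn; move: h7; clear; lia.
apply: split_exists => [s1 z s2 e|].
  have hz : z \in zs by rewrite e mem_cat inE eqxx orbT.
  have := hz; rewrite pair_lettersE => /and3P[hzn z1 z2].
  have fz : free_below z = count fr (iota 1 z).
    have e1 : iota 1 z = iota 1 z.-1 ++ [:: z].
      have -> : z = z.-1 + 1 by clear -hzn; lia.
      by rewrite iotaD addn1 /= add1n.
    by rewrite /free_below e1 count_cat /= free_letterE // z1 /= !addn0.
  have s2z : (size s2).+1 <= nU zs z.
    rewrite e /nU count_cat /= leqnn.
    suff : count (upto z) s2 = size s2 by clear; lia.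
    apply/eqP; rewrite -all_count; apply/allP => x xs2.
    have gt_trans : transitive gtn by move=> x' y w; clear; lia.
    have := pair_letters_sorted; rewrite e (sorted_pairwise gt_trans) pairwise_cat /=.
    by case/and3P => _ _ /andP[/allP /(_ x xs2) /= /ltnW].

  rewrite fz; have hzn' : z <= n by case/andP: hzn.
  by have := balance hzn'; have := hb z hzn'; move: s2z; clear; lia.
rewrite /free_below /= -[size zs](@nU_all zs n).
  by have := balance (leqnn n); have := hb n (leqnn n); clear; lia.
by move=> x; rewrite pair_lettersE; clear; lia.
Qed.

Section Split.
Variable ts : seq nat.
Hypothesis hts : t_letters c = Some ts.

Lemma ts_zs k : nU zs k <= nU ts k.
Proof. by have [_ _ _ [h _ _]] := split_spec pair_letters_sorted hts; apply: h. Qed.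

(** A chosen letter serves a waiting pair, and no pair is waiting at n or above. *)
Lemma ts_range t : t \in ts -> 0 < t < n.
Proof.
have [h1 h2 h3 [h4 h5 h6]] := split_spec pair_letters_sorted hts => tt.
have /andP[_ t0] := allP h3 t tt; rewrite t0 ltnNge; apply/negP => nt.
have := h5 t tt; have := ts_zs t; rewrite -!/(nU _ _) [nU zs t]nU_all.
  by rewrite -h1 ltnNge count_size.
by move=> x; rewrite pair_lettersE; clear -nt; lia.
Qed.

Lemma ts_zs_n : nU ts n = nU zs n.
Proof.
have [h1 _ _ _] := split_spec pair_letters_sorted hts.
rewrite !nU_all //; first by move=> x; rewrite pair_lettersE; clear; lia.
by move=> x /ts_range; clear; lia.
Qed.

(* Lindley's recursion, solved: [nU ts k - nU zs k] is the number of pairs above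
   [k] still waiting for a free letter when scanning downwards to [k]. *)
Lemma pending_le X k : k <= n ->
  nU ts k <= X + nU zs k <->
  (forall m, k <= m -> m <= n ->
     nU cc m + nB cc m + k <= X + nU cc k + nB cc k + m).
Proof.
move=> kn; have [d] : exists d, k + d = n by exists (n - k); rewrite subnKC.
elim: d k X kn => [|d IH] k X kn.
  rewrite addn0 => ->; split=> [_ m h1 h2|_].
    by have -> : m = n by [clear -h1 h2; lia]; clear; lia.
  by rewrite ts_zs_n; clear; lia.
move=> e; have kn' : k.+1 <= n by clear -e; lia.
have e' : k.+1 + d = n by clear -e; lia.
have hk : 0 < k.+1 <= n by rewrite kn'.
have [h1 h2 h3 [h4 h5 h6]] := split_spec pair_letters_sorted hts.
have kn2 : k < 2 * n by clear -kn'; lia.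
have hbar : bar k.+1 = 2 * n - k by clear; lia.
have := nU_uniq k (gtn_uniq (path_sorted h2)).
have := nU_uniq k (gtn_uniq pair_letters_sorted).
rewrite pair_lettersE hk hbar; have := nUS k hc; have := nBS hc kn2.
have fk : fr k.+1 = (k.+1 \notin cc) && (2 * n - k \notin cc).
  by rewrite free_letterE // hbar.
have tk : k.+1 \in ts -> fr k.+1 by move=> h; have /andP[] := allP h3 _ h.
have l1 := ts_zs k.+1; have l0 := ts_zs k.
have l2 : k.+1 \in ts -> nU zs k.+1 < nU ts k.+1 := h5 k.+1.
have l3 : fr k.+1 -> k.+1 \notin ts -> nU ts k.+1 <= nU zs k.+1.
  by apply: h6; rewrite /= ltnS kn'.
(* The base point of the inequalities goes from k+1 to k, with the allowance corrected by the
   increment of U + B - k. *)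
have shift Y Z : Z + nU cc k + nB cc k + 1 = Y + nU cc k.+1 + nB cc k.+1 ->
  (forall m, k.+1 <= m -> m <= n ->
    nU cc m + nB cc m + k.+1 <= Y + nU cc k.+1 + nB cc k.+1 + m) <->
  (forall m, k <= m -> m <= n -> nU cc m + nB cc m + k <= Z + nU cc k + nB cc k + m).
  move=> eYZ; split=> h m km mn; last by have := h m (ltnW km) mn; clear -eYZ; lia.
  have [->|nk] := eqVneq m k; first by clear; lia.
  by have := h m ltac:(clear -km nk; lia) mn; clear -eYZ; lia.
move: fk tk l1 l2 l3; case: (k.+1 \in cc);
  case: (2 * n - k \in cc) => /= -> tk l1 l2 l3 eB eU eZ.
(* Here k+1 is a pair: one more pair waits at k, so the allowance X at k is X-1 at k+1, and X = 0 is
   impossible. *)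
- have -> : k.+1 \in ts = false by apply/negbTE/negP => /tk.
  rewrite addn0 => eT; case: X => [|X].
    split=> h; first by exfalso; move: h eT eZ l1; clear; lia.
    by have := h k.+1 (leqnSn k) kn'; rewrite eU eB; clear; lia.
  rewrite -(shift X); last by rewrite eU eB; clear; lia.
  by rewrite -IH //; split; move: eT eZ; clear; lia.
- have -> : k.+1 \in ts = false by apply/negbTE/negP => /tk.
  rewrite addn0 => eT; rewrite -(shift X); last by rewrite eU eB; clear; lia.
  by rewrite -IH //; split; move: eT eZ; clear; lia.
- have -> : k.+1 \in ts = false by apply/negbTE/negP => /tk.
  rewrite addn0 => eT; rewrite -(shift X); last by rewrite eU eB; clear; lia.
  by rewrite -IH //; split; move: eT eZ; clear; lia.
(* Here k+1 is free: it serves a pair, or none is waiting; in both cases the allowance X at k is X+1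
   at k+1. *)
move=> eT; rewrite -(shift X.+1); last by rewrite eU eB; clear; lia.
rewrite -IH //; case: (k.+1 \in ts) l2 l3 eT => l2 l3 eT.
  by split; move: eT eZ; clear; lia.
by have l4 := l3 isT isT; split; move: l4 eT eZ; clear; lia.
Qed.

Lemma count_split T (P a : pred T) s :
  count a s = count (fun x => a x && P x) s + count (fun x => a x && ~~ P x) s.
Proof. by elim: s => //= x s ->; case: (P x); case: (a x); clear; lia. Qed.

Lemma ts_map : [seq nth 0 ts (index z zs) | z <- zs] = ts.
Proof.
have [h1 _ _ _] := split_spec pair_letters_sorted hts.
apply: (@eq_from_nth _ 0); rewrite size_map // => j hj.
by rewrite (nth_map 0) // index_uniq // (gtn_uniq pair_letters_sorted).
Qed.

(** Each pair has exactly one letter with a given bar flag, so counts over these letters become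
    counts over the pairs. *)
Lemma count_pairs (b : bool) (g : nat -> nat) M :
  count (fun x : letter n => (g (lval x) < M) && ((x.2 == b) && (lval x \in zs))) c =
  count (fun z => g z < M) zs.
Proof.
have -> : count (fun x : letter n => (g (lval x) < M) && ((x.2 == b) && (lval x \in zs))) c
  = count (fun z => g z < M) [seq lval x | x <- c & (x.2 == b) && (lval x \in zs)].
  by rewrite count_map count_filter; apply: eq_count.
apply/permP/uniq_perm; last first.
- move=> z; apply/mapP/idP => [[x]|hz].
    by rewrite mem_filter => /andP[/andP[_ h] _] ->.
  have := hz; rewrite pair_lettersE => /and3P[hzn h1 h2].
  have [x xc /andP[xb /eqP xz]] : exists2 x, x \in c & (x.2 == b) && (lval x == z).
    move: h1 h2; rewrite -(mem_unbE hzn) -(mem_barE hzn) => /hasP[x xc xp] /hasP[y yc yp].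
    by case: b; [exists y => //; case: (y.2) yp|exists x => //; case: (x.2) xp].
  by exists x => //; rewrite mem_filter xb xz hz.
- exact: (gtn_uniq pair_letters_sorted).
rewrite map_inj_in_uniq ?filter_uniq //.
  by move: (col_uniq hc); rewrite map_inj_uniq //; apply: code_inj.
move=> x y; rewrite !mem_filter => /andP[/andP[/eqP xb _] _] /andP[/andP[/eqP yb _] _].
case: x xb => i b1 /= ->; case: y yb => j b2 /= ->; rewrite /lval /= => -[e].
by congr pair; apply: val_inj.
Qed.

(** The left split replaces the unbarred letters of [zs] by those of [ts]. Ranks start at 0, so a
    rank below M is a position at most M. *)
Lemma count_lrank M :
  count (fun x => lrank c x < M) c + nU zs M = nU cc M + nU ts M.
Proof.
rewrite (count_split (fun x => (x.2 == false) && (lval x \in zs))).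
have -> : nU cc M = count (fun x : letter n => rank x < M) c.
  by rewrite /nU count_map; apply: eq_count.
rewrite [X in _ = X + _](count_split (fun x => (x.2 == false) && (lval x \in zs))).
have e1 : count (fun x => (lrank c x < M) && ((x.2 == false) && (lval x \in zs))) c = nU ts M.
  have -> : nU ts M = count (fun z => (nth 0 ts (index z zs)).-1 < M) zs.
    rewrite /nU -{1}ts_map count_map; apply: eq_in_count => z hz /=.
    have : nth 0 ts (index z zs) \in ts by have [h1 _ _ _] := split_spec pair_letters_sorted hts; rewrite mem_nth // h1 index_mem.
    by move/ts_range; case: (nth 0 ts _) => //=.
  rewrite -(count_pairs false); apply: eq_in_count => x xc /=.
  rewrite eqbF_neg; case: (boolP (~~ x.2 && (lval x \in zs))) => h; rewrite ?andbF ?andbT //.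
  by rewrite /lrank h hts.
have e2 : count (fun x : letter n => (rank x < M) && ((x.2 == false) && (lval x \in zs))) c = nU zs M.
  have -> : nU zs M = count (fun z => z.-1 < M) zs.
    by apply: eq_in_count => z; rewrite pair_lettersE /=; clear; case: z.
  rewrite -(count_pairs false); apply: eq_in_count => x xc /=.
  by rewrite /rank /lval; case: (x.2) => //=; rewrite ?andbF.
have e3 : count (fun x => (lrank c x < M) && ~~ ((x.2 == false) && (lval x \in zs))) c =
   count (fun x : letter n => (rank x < M) && ~~ ((x.2 == false) && (lval x \in zs))) c.
  apply: eq_count => x; rewrite eqbF_neg /lrank.
  by case: (~~ x.2 && (lval x \in zs)); rewrite ?andbF.
by rewrite e1 e2 e3 addnAC [RHS]addnAC; congr (_ + _); apply: addnC.
Qed.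

Lemma count_rrank M :
  count (fun x => rrank c x < M) c + count (fun z => 2 * n - z < M) zs =
  nU cc M + count (fun t => 2 * n - t < M) ts.
Proof.
rewrite (count_split (fun x => (x.2 == true) && (lval x \in zs))).
have -> : nU cc M = count (fun x : letter n => rank x < M) c.
  by rewrite /nU count_map; apply: eq_count.
rewrite [X in _ = X + _](count_split (fun x => (x.2 == true) && (lval x \in zs))).
have e1 : count (fun x => (rrank c x < M) && ((x.2 == true) && (lval x \in zs))) c =
    count (fun t => 2 * n - t < M) ts.
  rewrite -{1}ts_map count_map -(count_pairs true (fun z => 2 * n - nth 0 ts (index z zs))).
  apply: eq_in_count => x xc /=.
  rewrite eqb_id; case: (boolP (x.2 && (lval x \in zs))) => h; rewrite ?andbF ?andbT //.
  by rewrite /rrank h hts.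
have e2 : count (fun x : letter n => (rank x < M) && ((x.2 == true) && (lval x \in zs))) c =
    count (fun z => 2 * n - z < M) zs.
  rewrite -(count_pairs true); apply: eq_in_count => x xc /=.
  rewrite /rank /lval; case: (x.2) => //=; rewrite ?andbF //.
  have := ltn_ord x.1; set j := nat_of_ord x.1 => hj.
  by congr (_ && _); clear -hj; lia.
have e3 : count (fun x => (rrank c x < M) && ~~ ((x.2 == true) && (lval x \in zs))) c =
   count (fun x : letter n => (rank x < M) && ~~ ((x.2 == true) && (lval x \in zs))) c.
  apply: eq_count => x; rewrite eqb_id /rrank.
  by case: (x.2 && (lval x \in zs)); rewrite ?andbF.
by rewrite e1 e2 e3 addnAC [RHS]addnAC; congr (_ + _); apply: addnC.
Qed.

Lemma nU_nB k : k <= n -> nU cc (2 * n - k) + nB cc k = size c.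
Proof.
move=> kn; rewrite -[size c](size_map (@code n)) -(count_predC (upto (2 * n - k)));
  congr (_ + _).
by apply: eq_count => x /=; clear -kn; lia.
Qed.

Lemma count_rrank_lo k : k <= n -> count (fun x => rrank c x < k) c = nU cc k.
Proof.
move=> kn; have := count_rrank k.
rewrite [count _ zs](_ : _ = 0); last first.
  apply/eqP; rewrite -leqn0 leqNgt -has_count; apply/hasPn => x.
  by rewrite pair_lettersE; clear -kn; lia.
rewrite [count _ ts](_ : _ = 0) ?addn0 //.
apply/eqP; rewrite -leqn0 leqNgt -has_count; apply/hasPn => x.
by move/ts_range; clear -kn; lia.
Qed.

Lemma count_above s k : (forall x, x \in s -> x <= n) -> k <= n ->
  count (fun z => 2 * n - z < 2 * n - k) s + nU s k = size s.
Proof.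
move=> hs kn; rewrite addnC -(count_predC (upto k)); congr (_ + _).
by apply: eq_in_count => x /hs /=; clear -kn; lia.
Qed.

Lemma count_rrank_hi k : k <= n ->
  count (fun x => rrank c x < 2 * n - k) c + nB cc k + nU ts k = size c + nU zs k.
Proof.
move=> kn; rewrite -(nU_nB kn); have := count_rrank (2 * n - k).
have [h1 _ _ _] := split_spec pair_letters_sorted hts.
have := @count_above zs k _ kn; have := @count_above ts k _ kn; rewrite h1.
move=> /(_ ltac:(by move=> x /ts_range; clear; lia)).
move=> e1 /(_ ltac:(by move=> x; rewrite pair_lettersE; clear; lia)).
move: e1; clear; set A := count _ c; set B := count _ zs;
  set C := count _ ts. move: (nU ts k) (nU zs k) (nB cc k) (size zs) (nU cc (2 * n - k)) => a1 a2 a3 a4 a5; lia.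
Qed.

Lemma count_lrank_hi k : k <= n ->
  count (fun x => lrank c x < 2 * n - k) c + nB cc k = size c.
Proof.
move=> kn; rewrite -(nU_nB kn); have := count_lrank (2 * n - k).
have [h1 _ _ _] := split_spec pair_letters_sorted hts.
rewrite [nU zs _]nU_all; last by move=> x; rewrite pair_lettersE; clear -kn; lia.
rewrite [nU ts _]nU_all; last by move=> x /ts_range; clear -kn; lia.
rewrite h1; clear; move: (count _ c) (size zs) (nB cc k) (nU cc (2 * n - k)) => a1 a2 a3 a4; lia.
Qed.

End Split.
End Greedy.

Lemma sorted_nth_lt s k M : sorted leq s -> k < size s ->
  (nth 0 s k < M) = (k < count (fun x => x < M) s).
Proof.
elim: s k => //= x s IH k hs hk; have ss := path_sorted hs.
have hx y : y \in s -> x <= y by move/(allP (order_path_min leq_trans hs)).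
case: (ltnP x M) => xM; last first.
  have -> : count (fun x => x < M) s = 0.
    by apply/eqP; rewrite -leqn0 leqNgt -has_count; apply/hasPn => y /hx; clear -xM; lia.
  case: k hk => [|k] hk /=; first by clear -xM; lia.
  have := hx (nth 0 s k) (mem_nth _ hk); clear -xM; lia.
by case: k hk => [|k] hk /=; [rewrite xM|rewrite IH].
Qed.

(** Counting functions, unlike entries, do not depend on the sorting in [lcol] and [rcol]. *)
Lemma sorted_nth_le s t : sorted leq s -> sorted leq t -> size t <= size s ->
  (forall k, k < size t -> nth 0 s k <= nth 0 t k) <->
  (forall M, count (fun x => x < M) t <= count (fun x => x < M) s).
Proof.
move=> ss st sz; split=> h M.
  case E : (count _ t) => [//|j].
  have jt : j < size t by rewrite -E; apply: count_size.
  have : nth 0 t j < M by rewrite (sorted_nth_lt _ st jt) E.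
  have := h j jt => h1 h2.
  by rewrite -(sorted_nth_lt _ ss (leq_trans jt sz)); apply: leq_ltn_trans h1 h2.
move=> Mt; rewrite -ltnS (sorted_nth_lt _ ss (leq_trans Mt sz)).
by apply: leq_trans (h _); rewrite -(sorted_nth_lt _ st Mt).
Qed.

(** Below a threshold k <= n the right split of [c1] has the same count as [c1], so the condition
    bounds the pairs of [c2] waiting at k. Below 2n-k the left split of [c2] has the same count as
    [c2], so it bounds the pairs of [c1] waiting at k. [pending_le] turns each bound into a family
    of inequalities in m. *)
Lemma colleP (c1 c2 : word n) : col (codes c1) -> col (codes c2) ->
  bnd (codes c1) -> bnd (codes c2) -> colle c1 c2 <-> cle (codes c1) (codes c2).
Proof.
move=> h1 h2 /(t_lettersP h1) + /(t_lettersP h2).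
case E1 : (t_letters c1) => [t1|] // _; case E2 : (t_letters c2) => [t2|] // _.
have cnt f (c : word n) M :
    count (fun x => x < M) (sort leq (map f c)) = count (fun x => f x < M) c.
  by rewrite (permP (permEl (perm_sort leq _))) count_map.
have srt (f : letter n -> nat) c : sorted leq (sort leq (map f c)).
  exact: (sort_sorted leq_total).
have key : colle c1 c2 <-> size c2 <= size c1 /\ forall M,
    count (fun x => lrank c2 x < M) c2 <= count (fun x => rrank c1 x < M) c1.
  have sz f (c : word n) : size (sort leq (map f c)) = size c by rewrite size_sort size_map.
  rewrite /colle; split=> [/andP[hs /allP h]|[hs h]].
    split=> // M; rewrite -!cnt.
    apply: (sorted_nth_le (srt _ _) (srt _ _) _).1; rewrite !sz // => k hk.
    by apply: h; rewrite mem_iota.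
  rewrite hs; apply/allP => k; rewrite mem_iota add0n => hk.
  apply: (sorted_nth_le (srt _ _) (srt _ _) _).2; rewrite ?sz // => M.
  by rewrite !cnt.
rewrite key; split=> [[hs h] k m km mn|h].
  have kn := leq_trans km mn.
  split.
    have := h k; rewrite (count_rrank_lo h1 E1 kn); have := count_lrank h2 E2 k.
    have := ts_zs E2 k => z1 z2 z3.
    (* The truncated difference is exact: splitting [c2] only increases its count below k. *)
    have := (pending_le h2 E2 (nU (codes c1) k - nU (codes c2) k) kn).1.
    move=> /(_ ltac:(move: z1 z2 z3; clear; lia) m km mn).
    by move: z1 z2 z3; clear; lia.
  have := h (2 * n - k); have := count_rrank_hi h1 E1 kn; have := count_lrank_hi h2 E2 kn.
  have := ts_zs E1 k => z1 z2 z3 z4.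
  have := (pending_le h1 E1 (size c1 + nB (codes c2) k - size c2 - nB (codes c1) k) kn).1.
  move=> /(_ ltac:(move: z1 z2 z3 z4; clear; lia) m km mn).
  by rewrite !size_map; move: z1 z2 z3 z4; clear; lia.
have hs : size c2 <= size c1.
  have [_] := h 0 0 (leqnn 0) (leq0n n); rewrite !size_map (nU0 h1) !nB0 //; clear; lia.
have lo k : k <= n -> count (fun x => lrank c2 x < k) c2 <= count (fun x => rrank c1 x < k) c1.
  (* The diagonal instance guarantees that the truncated difference used as allowance is exact. *)
  move=> kn; have [z5 _] := h k k (leqnn k) kn.
  have := (pending_le h2 E2 (nU (codes c1) k - nU (codes c2) k) kn).2.
  move=> /(_ ltac:(move=> m km mn; have [+ _] := h k m km mn; move: z5; clear; lia)).
  rewrite (count_rrank_lo h1 E1 kn); have := count_lrank h2 E2 k.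
  by move: z5; clear; lia.
have hi k : k <= n ->
    count (fun x => lrank c2 x < 2 * n - k) c2 <= count (fun x => rrank c1 x < 2 * n - k) c1.
  move=> kn; have [_ z5] := h k k (leqnn k) kn; rewrite !size_map in z5.
  have := (pending_le h1 E1 (size c1 + nB (codes c2) k - size c2 - nB (codes c1) k) kn).2.
  move=> /(_ ltac:(move=> m km mn; have [_] := h k m km mn; rewrite !size_map; move: z5;
    clear; lia)).
  have := count_rrank_hi h1 E1 kn; have := count_lrank_hi h2 E2 kn.
  by move: z5; clear; lia.
split=> // M; case: (leqP M n) => Mn; first exact: lo.
case: (leqP M (2 * n)) => M2n.
  have -> : M = 2 * n - (2 * n - M) by clear -M2n; lia.
  by apply: hi; clear -Mn; lia.
apply: leq_trans (count_size _ _) _; apply: leq_trans hs _.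
have := count_rrank_hi h1 E1 (leq0n n); rewrite (nB0 h1) subn0.
have z0 (s : seq nat) : (forall x, x \in s -> 0 < x) -> nU s 0 = 0.
  move=> hx; apply/eqP; rewrite -leqn0 leqNgt -has_count; apply/hasPn => x /hx; clear; lia.
rewrite (z0 t1) => [|x /(ts_range E1) /andP[] //].
rewrite (z0 (pair_letters c1)) => [|x]; last by rewrite pair_lettersE => /and3P[/andP[]].
rewrite !addn0 => <-; apply: sub_count => x /= hx; apply: ltn_trans hx M2n.
Qed.

Lemma admissibleP (c : word n) :
  admissible c <-> [/\ c <> [::], col (codes c) & bnd (codes c)].
Proof.
rewrite /admissible /is_column.
have -> : sorted (@ltl n) c = col (codes c).
  rewrite /col codesP andbT /codes sorted_map; apply: eq_sorted => x y.
  by rewrite /= /ltl /code ltnS.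
split=> [/andP[/andP[h1 h2] /eqP h3]|[h1 h2 h3]].
  by split=> //; [case: (c) h1|apply/t_lettersP].
rewrite h2 andbT; apply/andP; split; first by case: (c) h1.
by apply/eqP/t_lettersP.
Qed.

End Splitting.

(** * Normal forms *)

Section Assembly.
Variable n : nat.
Local Notation eps := (eps n).
Local Notation step := (step n).
Local Notation col := (col n).
Local Notation bnd := (bnd n).
Local Notation cle := (cle n).
Local Notation crys := (crys n).
Local Notation hw := (hw n).
Local Notation chain := (chain n).

Definition good (c : seq nat) : Prop := col c /\ bnd c.

Definition adj (i : nat) (a b : seq nat) : Prop := step i a b \/ step i b a.

Lemma step_size i a b : step i a b -> size b = size a.
Proof. by move=> [u [x [v [-> -> _ _ _]]]]; rewrite !size_cat. Qed.

Lemma adj_cat i a1 a2 b1 b2 : size a1 = size b1 -> adj i (a1 ++ a2) (b1 ++ b2) ->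
  (adj i a1 b1 /\ a2 = b2) \/ (a1 = b1 /\ adj i a2 b2).
Proof.
move=> s [] /step_cat => [/(_ s)|/(_ (esym s))] [[h1 [h2 _]]|[h1 [h2 _]]].
- by left; split=> //; left.
- by right; split=> //; left.
- by left; split=> //; right.
- by right; split=> //; right.
Qed.

Lemma adj_good i a b : adj i a b -> good a -> good b.
Proof.
move=> [] s [ha hb].
  have hor : col a || col b by rewrite ha.
  by have [? [_ ? _ _ _]] := step_col s hor; split=> //; apply/(bnd_step s hor).
have hor : col b || col a by rewrite ha orbT.
by have [? [? _ _ _ _]] := step_col s hor; split=> //; apply/(bnd_step s hor).
Qed.

(** An edge changes one letter inside one column, so cutting the new word at the old heights again
    gives admissible columns. This lifts edges from words to words of columns. *)
Lemma adj_flatten i cs b : adj i (flatten cs) b -> (forall c, c \in cs -> good c) ->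
  exists ds, [/\ b = flatten ds, shape ds = shape cs & forall d, d \in ds -> good d].
Proof.
elim: cs b => [|c cs IH] b /=.
  by move=> [] [u [x [v [e1 e2 _ _ _]]]] _;
    [move/(congr1 size): e1|move/(congr1 size): e2]; rewrite size_cat /= addnS.
move=> hb hg.
have sb : size b = size (c ++ flatten cs) by case: hb => /step_size.
have eb : b = take (size c) b ++ drop (size c) b by rewrite cat_take_drop.
have st : size c = size (take (size c) b) by rewrite size_takel // sb size_cat leq_addr.
have gc : good c by apply: hg; rewrite inE eqxx.
have gcs d : d \in cs -> good d by move=> h; apply: hg; rewrite inE h orbT.
rewrite eb in hb; case: (adj_cat st hb) => [[h1 h2]|[h1 h2]].
  exists (take (size c) b :: cs); split; first by rewrite /= h2 cat_take_drop.
    by rewrite /= -st.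
  by move=> d; rewrite inE => /orP[/eqP ->|/gcs //]; apply: adj_good h1 gc.
have [ds [e1 e2 e3]] := IH _ h2 gcs.
exists (c :: ds); split; first by rewrite /= -e1 [X in X ++ _]h1 cat_take_drop.
  by rewrite /= e2.
by move=> d; rewrite inE => /orP[/eqP ->|/e3].
Qed.

Definition chained (cs : seq (seq nat)) : Prop :=
  if cs is c :: cs' then chain c cs' else True.

(** Only the neighbours of the modified column matter, and the edge restricts to an edge of each of
    these products of two columns, to which [cle_step] applies. *)
Lemma chained_step i cs ds : shape cs = shape ds -> step i (flatten cs) (flatten ds) ->
  (forall c, c \in cs -> good c) -> chained cs <-> chained ds.
Proof.
elim: cs ds => [|c cs IH] [|d ds] //= [sc scs] st hg.
have gc : good c by apply: hg; rewrite inE eqxx.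
have gcs c' : c' \in cs -> good c' by move=> h; apply: hg; rewrite inE h orbT.
have [[s1 [e1 h]]|[e1 [s1 h]]] := (step_cat _ _ _ _ sc).1 st.
  have ec : cs = ds by apply: eq_from_flatten_shape.
  subst ds; case: cs {IH hg scs e1 st} gcs h => [|c2 cs] //= gcs h.
  have g2 : good c2 by apply: gcs; rewrite inE eqxx.
  have s2 : step i (c ++ c2) (d ++ c2).
    by apply/step_cat => //; left; split=> //; split=> //; move: h; rewrite eps_cat; lia.
  by rewrite (cle_step sc s2); rewrite ?gc.1 ?g2.1.
subst d; have IH' := IH ds scs s1 gcs.
case: cs ds scs s1 gcs h IH' {IH hg st} => [|c2 cs] [|d2 ds] //= [sc2 scs] s1 gcs h IH'.
have g2 : good c2 by apply: gcs; rewrite inE eqxx.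
suff -> : cle c2 c <-> cle d2 c by rewrite IH'.
have [[s2 [e1 h2]]|[-> //]] := (step_cat _ _ _ _ sc2).1 s1.
have s3 : step i (c ++ c2) (c ++ d2).
  apply/step_cat => //; right; split=> //; split=> //.
  by move: h; rewrite eps_cat; lia.
by rewrite (cle_step _ s3); rewrite ?gc.1 ?g2.1.
Qed.

(** The zeros are the heights of epsilons, which no [phi i] counts; their number comes from the
    total length. *)
Lemma sorted_counts_eq s1 s2 : sorted leq s1 -> sorted leq s2 -> size s1 = size s2 ->
  all (fun h => h <= n) s1 -> all (fun h => h <= n) s2 ->
  (forall i, 0 < i <= n -> count_mem i s1 = count_mem i s2) -> s1 = s2.
Proof.
move=> o1 o2 sz a1 a2 h.
have e m : m <= n -> nU s1 m + nU s2 0 = nU s2 m + nU s1 0.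
  elim: m => [|m IH] mn; first by rewrite addnC.
  by rewrite !nU_count h ?mn //; have := IH (ltnW mn); lia.
have big s : all (fun h => h <= n) s -> nU s n = size s.
  by move=> a; apply/eqP; rewrite -all_count.
have z s : nU s 0 = count_mem 0 s by apply: eq_count => x /=; rewrite leqn0.
have e0 : count_mem 0 s1 = count_mem 0 s2.
  by have := e n (leqnn n); rewrite !big // sz !z; lia.
apply: (sorted_eq leq_trans anti_leq o1 o2); apply/allP => x _ /=; apply/eqP.
case: (posnP x) => [-> //|x0]; case: (leqP x n) => xn; first by apply: h; rewrite x0.
have out s : all (fun h => h <= n) s -> count_mem x s = 0.
  by move=> a; apply/count_memPn; apply/negP => /(allP a); lia.
by rewrite !out.
Qed.

(** Both tableaux are raised by the same e_i until the heights can be compared. Coming back, f_i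
    gives the same word, and the heights, constant along edges, give the same cuts. *)
Theorem chained_unique cs ds : (forall c, c \in cs -> good c) ->
  (forall d, d \in ds -> good d) -> chained cs -> chained ds -> size cs = size ds ->
  crys (flatten cs) (flatten ds) -> cs = ds.
Proof.
move: {2}(sumn (flatten cs)).+1 (ltnSn (sumn (flatten cs))) => N.
elim: N cs ds => // N IH cs ds hN gcs gds hcs hds sz cr.
have [[i hi ei]|hh] := hwP n (flatten cs); last first.
  have hh' : hw (flatten ds) by move=> i; rewrite -(crys_eps i cr).
  have tab es : (forall c, c \in es -> good c) -> chained es -> hw (flatten es) ->
      exists s, [/\ sorted leq s, all (fun h => h <= n) s & es = [seq iota 1 h | h <- s]].
    move=> ges hes hwes; have [||//|//|//||s [ps sn e]] := @hw_tableau n es 0 [::].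
    - by apply/allP => c /ges [].
    - by move=> c /ges [].
    - case: es ges hes {hwes} => [|c es] //= ges hes; split=> //.
      by apply: cle_nil; case: (ges c _) => //; rewrite inE eqxx.
    by exists s; split=> //; apply: path_sorted ps.
  have [s [os sn es]] := tab _ gcs hcs hh; have [t [ot tn et]] := tab _ gds hds hh'.
  have -> : cs = ds; last by [].
  rewrite es et; congr map; apply: sorted_counts_eq => //.
    by move: sz; rewrite es et !size_map.
  move=> i hi; have := crys_phi i cr; rewrite es et.
  by rewrite -!/(colword _) (phi_colword hi sn).1 (phi_colword hi tn).1.
have ei' : 0 < eps i (flatten ds) by rewrite -(crys_eps i cr).
have s1 := step_eop ei; have s2 := step_eop ei'.
have [cs' [f1 sh1 g1]] := adj_flatten (or_intror s1) gcs.
have [ds' [f2 sh2 g2]] := adj_flatten (or_intror s2) gds.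
have cr' := crys_eop cr ei; rewrite f1 in s1 cr'; rewrite f2 in s2 cr'.
have e : cs' = ds'.
  apply: IH => //.
  - by rewrite -f1; have := sumn_eop ei; lia.
  - by apply/(chained_step sh1 s1 g1).
  - by apply/(chained_step sh2 s2 g2).
  by rewrite -(size_map size cs') -(size_map size ds') -!/(shape _) sh1 sh2 /shape !size_map.
apply: eq_from_flatten_shape; last by rewrite -sh1 -sh2 e.
by have [_ -> _ _] := step_inv s1; have [_ -> _ _] := step_inv s2; rewrite e.
Qed.

(** * Admissible columns as letters *)

Local Notation ac a := (codes (pcol a)).

Lemma ac_good (a : ACol n) : good (ac a).
Proof.
case: a => [[c hc]|] /=; first by have [_ ? ?] := (admissibleP c).1 hc.
by split=> // m mn; rewrite /nU /nB.
Qed.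

Lemma ac_inj (a b : ACol n) : ac a = ac b -> a = b.
Proof.
case: a b => [[c hc]|] [[d hd]|] //= h.
- by congr Some; apply: val_inj; apply: (@codes_inj n).
- have [nz _ _] := (admissibleP c).1 hc.
  by case: nz; apply: size0nil; rewrite -(size_map (@code n)) -/(codes c) h.
have [nz _ _] := (admissibleP d).1 hd.
by case: nz; apply: size0nil; rewrite -(size_map (@code n)) -/(codes d) -h.
Qed.

Lemma ac_surj c : good c -> exists a : ACol n, ac a = c.
Proof.
move=> [hc hb]; have [v ev] : exists v : word n, c = codes v.
  by apply: codes_surj; case/andP: hc.
case: v ev => [|x v] ev; first by exists None.
have hv : admissible (x :: v) by apply/admissibleP; rewrite -ev.
by exists (Some (exist _ (x :: v) hv)).
Qed.

Lemma ac_surj_seq cs : (forall c, c \in cs -> good c) ->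
  exists w : seq (ACol n), [seq ac a | a <- w] = cs.
Proof.
elim: cs => [|c cs IH] h; first by exists [::].
have [a ea] := ac_surj (h c (mem_head _ _)).
have [|w ew] := IH; first by move=> d dc; apply: h; rewrite inE dc orbT.
by exists (a :: w); rewrite /= ea ew.
Qed.

Lemma codes_p (w : seq (ACol n)) : codes (p w) = flatten [seq ac a | a <- w].
Proof. by rewrite /codes /p map_flatten -map_comp. Qed.

Lemma shape_ac (w : seq (ACol n)) :
  shape [seq ac a | a <- w] = [seq size (pcol a) | a <- w].
Proof. by rewrite /shape -map_comp; apply: eq_map => a; rewrite /= size_map. Qed.

(** The conventions on epsilon are those of the empty column: at k = m = 0 the second inequality of
    [cle] compares heights, so the empty column precedes no nonempty one. *)
Lemma leA_cle (a b : ACol n) : leA a b <-> cle (ac a) (ac b).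
Proof.
have [ha ka] := ac_good a; have [hb kb] := ac_good b.
case: a b ha ka hb kb => [[c hc]|] [[d hd]|] //= ha ka hb kb.
- exact: colleP.
- by split=> // _; apply: cle_nil.
- split=> // h; have [_] := h 0 0 (leqnn 0) (leq0n n).
  rewrite (nB0 hb) /= size_map => sd; have [nz _ _] := (admissibleP d).1 hd.
  by case: nz; apply: size0nil; move: sd; rewrite /nU /nB /=; lia.
Qed.

(** Once epsilon is the empty column the four cases merge; the forbidden case is the one in which
    the order fails. *)
Lemma insert_relE (c1 c2 d1 d2 : ACol n) : insert_rel c1 c2 d1 d2 <->
  cle (ac d2) (ac d1) /\ crys (ac c1 ++ ac c2) (ac d1 ++ ac d2).
Proof.
rewrite -leA_cle /insert_rel /codes -!map_cat.
case: d1 d2 => [d1|] [d2|] /=; rewrite ?cats0 ?plac_equivE; split=> //.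
- by case.
- by case.
- by case.
Qed.

Lemma comp_isoA (w1 w2 : seq (ACol n)) :
  comp_iso (@edgeA n) w1 w2 <-> crys (codes (p w1)) (codes (p w2)).
Proof.
apply: (comp_iso_transport (g := fun w => codes (p w))
  (sh := fun w => [seq size (pcol a) | a <- w])).
- by move=> i a b; rewrite /edgeA edgeW_step.
- move=> a b sab; rewrite !codes_p => h; apply: (inj_map ac_inj).
  by apply: eq_from_flatten_shape => //; rewrite !shape_ac.
- move=> i a b'; rewrite codes_p => h.
  have [|ds [-> sh gd]] := adj_flatten (or_introl h).
    by move=> c /mapP[x _ ->]; apply: ac_good.
  have [w ew] := ac_surj_seq gd; exists w; first by rewrite codes_p ew.
  by rewrite -!shape_ac ew.
move=> i a b'; rewrite codes_p => h.
have [|ds [-> sh gd]] := adj_flatten (or_intror h).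
  by move=> c /mapP[x _ ->]; apply: ac_good.
have [w ew] := ac_surj_seq gd; exists w; first by rewrite codes_p ew.
by rewrite -!shape_ac ew.
Qed.

Lemma ext_relE (w1 w2 : seq (ACol n)) :
  ext_rel w1 w2 <-> size w1 = size w2 /\ crys (codes (p w1)) (codes (p w2)).
Proof. by rewrite /ext_rel comp_isoA. Qed.

Lemma plN_ext (w w' : seq (ACol n)) : plN_rel w w' -> ext_rel w w'.
Proof.
move=> [c1 [c2 [d1 [d2 [-> -> _ /insert_relE[_ h]]]]]]; apply/ext_relE; split=> //.
by rewrite !codes_p /= !cats0.
Qed.

(** A column weighs its height times its place counted from the right. Insertion increases neither
    the first height nor the total, and applied to a pair out of order it lowers at least one of
    them, hence this sum. *)
Fixpoint potential (w : seq (ACol n)) : nat :=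
  if w is a :: v then (size v).+1 * size (pcol a) + potential v else 0.

Lemma potential_cat u v v' : size v' = size v -> potential v' < potential v ->
  potential (u ++ v') < potential (u ++ v).
Proof. by move=> s h; elim: u => //= a u IH; rewrite !size_cat s ltn_add2l. Qed.

Definition tab (w : seq (ACol n)) : bool := sorted (fun c d => leA d c) w.

Lemma not_tab w : ~~ tab w ->
  exists u c1 c2 v, w = u ++ c1 :: c2 :: v /\ ~~ leA c2 c1.
Proof.
elim: w => [|a [|b w] IH] //=; rewrite negb_and => /orP[h|h].
  by exists [::], a, b, w.
have [u [c1 [c2 [v [e hv]]]]] := IH h.
by exists (a :: u), c1, c2, v; rewrite e.
Qed.

Lemma plN_size (w w' : seq (ACol n)) : plN_equiv w w' -> size w = size w'.
Proof.
elim=> {w w'} // [w w' [c1 [c2 [d1 [d2 [-> -> _ _]]]]]|u v w _ -> _ -> //|x y u v _ h] //.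
by rewrite !size_cat h.
Qed.

(** Existence of normal forms only; their uniqueness comes from [chained_unique] rather than from
    confluence of the rewriting. *)
Lemma plN_tab (w : seq (ACol n)) : exists2 w', plN_equiv w w' & tab w'.
Proof.
move: {2}(potential w).+1 (ltnSn (potential w)) => N.
elim: N w => // N IH w hN; case: (boolP (tab w)) => [tw|/not_tab].
  by exists w => //; apply: cg_refl.
move=> [u [c1 [c2 [v [ew hle]]]]].
have [h1 b1] := ac_good c1; have [h2 b2] := ac_good c2.
have [e1 [e2 [k1 g1 k2 g2 [cl cr z1 z2 z3]]]] := insertion h1 b1 h2 b2.
have [d1 ed1] := ac_surj (conj k1 g1); have [d2 ed2] := ac_surj (conj k2 g2).
subst e1 e2; rewrite !size_map in z1 z2 z3.
have rel : plN_rel [:: c1; c2] [:: d1; d2].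
  by exists c1, c2, d1, d2; split=> //; apply/insert_relE.
have lt : potential (u ++ d1 :: d2 :: v) < N.
  rewrite ltnS in hN; apply: leq_trans hN; rewrite ew; apply: potential_cat => //=.
  have ne : ~ (size (pcol d1) = size (pcol c1) /\
      size (pcol d1) + size (pcol d2) = size (pcol c1) + size (pcol c2)).
    by move=> [q1 q2]; move/negP: hle; apply; apply/leA_cle; apply: z3.
  move: z1 z2 ne.
  move: (size (pcol c1)) (size (pcol c2)) (size (pcol d1)) (size (pcol d2)) (size v) (potential v).
  clear=> x1 x2 y1 y2 s r z1 z2 ne.
  have -> : s.+2 * y1 + (s.+1 * y2 + r) = s.+1 * (y1 + y2) + y1 + r by lia.
  have -> : s.+2 * x1 + (s.+1 * x2 + r) = s.+1 * (x1 + x2) + x1 + r by lia.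
  rewrite ltn_add2r.
  have [lt|eq] : y1 + y2 < x1 + x2 \/ y1 + y2 = x1 + x2 by lia.
    by have : s.+1 * (y1 + y2) < s.+1 * (x1 + x2); [rewrite ltn_pmul2l|lia].
  by rewrite eq; lia.
have [w' ww' tw'] := IH _ lt; exists w' => //; apply: cg_trans ww'.
rewrite ew -[c1 :: _]/([:: c1; c2] ++ v) -[d1 :: _]/([:: d1; d2] ++ v).
by apply: cg_ctx; apply: cg_step.
Qed.

Lemma tab_chained w : tab w -> chained [seq ac a | a <- w].
Proof.
rewrite /tab; case: w => //= a w; elim: w a => //= b w IH a /andP[h1 h2].
by split; [apply/leA_cle|apply: IH].
Qed.

Lemma cong_gen_sub T (R S : seq T -> seq T -> Prop) u v :
  (forall x y, R x y -> cong_gen S x y) -> cong_gen R u v -> cong_gen S u v.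
Proof.
move=> h; elim=> {u v} [u v /h //|u|u v _ IH|u v w _ IH1 _ IH2|x y u v _ IH].
- exact: cg_refl.
- exact: cg_sym.
- exact: cg_trans IH1 IH2.
- exact: cg_ctx.
Qed.

Lemma plN_crys (w w' : seq (ACol n)) : plN_equiv w w' -> crys (codes (p w)) (codes (p w')).
Proof.
elim=> {w w'} [w w' /plN_ext /ext_relE[] //|w|w w' _|u v w _ h1 _ h2|x y u v _ h].
- exact: crys_refl.
- exact: crys_sym.
- exact: crys_trans h1 h2.
rewrite !codes_p !map_cat !flatten_cat -!codes_p.
by apply: crys_catl; apply: crys_catr.
Qed.

(** Rewriting preserves length and crystal class, so the two normal forms are crystal equivalent
    tableaux with the same number of columns, epsilons included, and therefore coincide. *)
Lemma ext_plN (w w' : seq (ACol n)) : ext_rel w w' -> plN_equiv w w'.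
Proof.
move/ext_relE => [sz cr].
have [t wt tt] := plN_tab w; have [t' wt' tt'] := plN_tab w'.
suff e : t = t' by apply: cg_trans wt _; rewrite e; apply: cg_sym.
apply: (inj_map ac_inj); apply: chained_unique.
- by move=> c /mapP[x _ ->]; apply: ac_good.
- by move=> c /mapP[x _ ->]; apply: ac_good.
- exact: tab_chained.
- exact: tab_chained.
- by rewrite !size_map -(plN_size wt) -(plN_size wt').
rewrite -!codes_p; apply: crys_trans (crys_sym (plN_crys wt)) _.
exact: crys_trans cr (plN_crys wt').
Qed.

End Assembly.

Theorem theorem3p6 (n : nat) (hn : 0 < n) (w1 w2 : seq (ACol n)) :
  ext_equiv w1 w2 <-> plN_equiv w1 w2.
Proof.
split; apply: cong_gen_sub => x y; first exact: ext_plN.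
by move=> /plN_ext; apply: cg_step.
Qed.
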